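(* Let $X$ be a real Hilbert space, $Y$ a separable closed subspace of $X$ and $Z=Y^\perp$. Let $\rho>r>0$ and $z\in Z$ with $\|z\|=1$, and set $$\mathcal M=\{u=y+\lambda z:\ \|u\|\le\rho,\ \lambda\ge0,\ y\in Y\},$$ $$\mathcal M_0=\{u=y+\lambda z:\ y\in Y,\ \text{and either } (\|u\|=\rho \text{ and } \lambda\ge0)\ \text{or}\ (\|u\|\le\rho \text{ and } \lambda=0)\},$$ $$S=\{u\in Z:\ \|u\|=r\}.$$ Let $I:X\to\mathbb{R}$ be locally Lipschitz and $\tau$-upper semicontinuous, satisfy condition $(H)$ (see context), and suppose that $$b:=\inf_S I>0=\sup_{\mathcal M_0}I,\qquad d:=\sup_{\mathcal M}I<\infty.$$ Then there exist $c\in[b,d]$ and a sequence $(u_n)\subset X$ such that $I(u_n)\to c$ and $\lambda_I(u_n)\to0$.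
   Context: For $u\in X$, $u^+$ and $u^-$ denote the orthogonal projections of $u$ onto $Z$ and $Y$. Fix a total orthonormal sequence $(e_k)$ in $Y$; $\tau$ is the topology on $X$ generated by the norm $|||u|||=\max\{\|u^+\|,\ \sum_{k}2^{-k}|(u^-,e_k)|\}$. For a locally Lipschitz $I:X\to\mathbb{R}$, $I^\circ(u;v)=\limsup_{h\to0,\delta\downarrow0}\frac1\delta\,(I(u+h+\delta v)-I(u+h))$, the generalized gradient is $\partial I(u)=\{\xi\in X^*: I^\circ(u;v)\ge\langle\xi,v\rangle\ \forall v\in X\}$, and $\lambda_I(u)=\min\{\|\xi\|_{X^*}:\xi\in\partial I(u)\}$. Condition $(H)$: for all real $\alpha<\beta$, if $(u_n)\subset I^{-1}([\alpha,\beta])$ and $u_n\to u_0$ in the topology $\tau$, then there is $M>0$ such that $\partial I(u_n)\subset B_M(0)\subset X^*$ for all $n\in\mathbb{N}$; and, in addition, if $\xi_n\in\partial I(u_n)$ and $\xi_n\rightharpoonup\xi_0$ weakly-$*$ in $X^*$, then $\xi_0\in\partial I(u_0)$. *)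

(* Defs.v *)
From HB Require Import structures.
From mathcomp Require Import all_boot all_order all_algebra sesquilinear.
From mathcomp Require Import all_classical all_reals all_analysis.
Import Order.TTheory GRing.Theory Num.Theory.
Import numFieldNormedType.Exports.

Set Implicit Arguments.
Unset Strict Implicit.
Unset Printing Implicit Defensive.

Local Open Scope classical_set_scope.
Local Open Scope ring_scope.

(* The completeNormedModType X is a Hilbert space for the inner product ip
   exactly when its norm is the one induced by ip. *)
Definition induces_norm (R : realType) (X : completeNormedModType R)
    (ip : {dot X for idfun}) :=
  forall u : X, `|u| = Num.sqrt (ip u u).

Section HilbertSubspaces.
Variables (R : realType) (X : completeNormedModType R).
Variable ip : {dot X for idfun}.
Implicit Types (Y : set X) (K : set nat) (e : nat -> X) (u : X).

Definition closed_subspace Y := submod_closed [in Y] /\ closed Y.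

Definition separable_set Y :=
  exists D : set X, [/\ countable D, D `<=` Y & Y `<=` closure D].

Definition orthogonal_complement Y : set X :=
  [set u | forall y, Y y -> ip u y = 0].

Definition orthogonal_projection Y u : X :=
  xget 0 [set y | Y y /\ orthogonal_complement Y (u - y)].

(* A finite or infinite sequence is a map e restricted to an initial segment K
   of nat, so that finite-dimensional Y (even Y = 0) are covered. *)
Definition total_orthonormal_sequence Y K e :=
  [/\ forall m n, (m <= n)%N -> K n -> K m,
      forall k, K k -> Y (e k),
      forall k l, K k -> K l -> ip (e k) (e l) = (k == l)%:R
    & Y `<=` closure [set u | exists n (a : nat -> R),
                        u = \sum_(0 <= k < n | k \in K) a k *: e k]].

Definition tau_norm Y K e u : R :=
  Num.max `|orthogonal_projection (orthogonal_complement Y) u|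
          (limn (fun n => \sum_(0 <= k < n | k \in K)
                   2^-1 ^+ k * `|ip (orthogonal_projection Y u) (e k)|)).

End HilbertSubspaces.

(* norm_topology N is a copy of X whose open sets are those that contain an
   N-ball around each of their points; N need not be the norm of X. *)
Definition norm_topology (R : realType) (X : normedModType R) (N : X -> R)
  : Type := X.

Section NormTopology.
Variables (R : realType) (X : normedModType R) (N : X -> R).

Definition norm_open (A : set (norm_topology N)) :=
  forall u : X, A u ->
    exists2 eps : R, 0 < eps & forall v : X, N (v - u) < eps -> A v.

Lemma norm_openT : norm_open setT.
Proof. by move=> u _; exists 1. Qed.

Lemma norm_openI : setI_closed norm_open.
Proof.
move=> A B oA oB u [/oA[e e0 eA] /oB[d d0 dB]].
exists (Num.min e d); first by rewrite lt_min e0 d0.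
by move=> v; rewrite lt_min => /andP[/eA Av /dB Bv].
Qed.

Lemma norm_open_bigU (J : Type) (f : J -> set (norm_topology N)) :
  (forall i, norm_open (f i)) -> norm_open (\bigcup_i f i).
Proof.
move=> of_ u [i _ /of_[e e0 ef]].
by exists e => // v /ef fv; exists i.
Qed.

HB.instance Definition _ := Choice.copy (norm_topology N) X.
HB.instance Definition _ := isOpenTopological.Build (norm_topology N)
  norm_openT norm_openI norm_open_bigU.

End NormTopology.

Definition upper_semicontinuous (T : topologicalType) (R : numFieldType)
    (f : T -> \bar R) :=
  lower_semicontinuous (\- f)%E.

Section NonsmoothCalculus.
Variables (R : realType) (X : normedModType R).
Implicit Types (I : X -> R) (u v : X) (xi : {scalar X}).

Definition locally_lipschitz I :=
  forall u, exists2 U, nbhs u U & [lipschitz I x | x in U].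

Definition generalized_derivative I u v : \bar R :=
  limf_esup
    (fun p : X * R => (p.2^-1 * (I (u + p.1 + p.2 *: v) - I (u + p.1)))%:E)
    (filter_prod (nbhs (0 : X)) (at_right (0 : R))).

(* X^* consists of the continuous elements of {scalar X}. *)
Definition dual : set {scalar X} := [set xi | continuous (xi : X -> R)].

Definition dual_norm xi : R := sup [set `|xi v| | v in [set v | `|v| <= 1]].

Definition weak_star_cvg (xi_ : nat -> {scalar X}) xi :=
  forall v, xi_ n v @[n --> \oo] --> (xi v : R).

Definition generalized_gradient I u : set {scalar X} :=
  [set xi | dual xi /\
     forall v, ((xi v)%:E <= generalized_derivative I u v)%E].

(* The least element of the set of norms; it is +oo if there is none. *)
Definition lambda I u : \bar R :=
  let norms := [set (dual_norm xi)%:E | xi in generalized_gradient I u] in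
  xget +oo%E (norms `&` lbound norms).

Definition condition_H (N : X -> R) I :=
  forall alpha beta : R, alpha < beta ->
  forall (u_ : nat -> X) (u0 : X),
    (forall n, alpha <= I (u_ n) <= beta) ->
    (u_ : nat -> norm_topology N) @ \oo --> (u0 : norm_topology N) ->
  (exists2 M : R, 0 < M & forall n xi,
      generalized_gradient I (u_ n) xi -> dual_norm xi < M) /\
  (forall (xi_ : nat -> {scalar X}) (xi0 : {scalar X}),
      (forall n, generalized_gradient I (u_ n) (xi_ n)) ->
      dual xi0 -> weak_star_cvg xi_ xi0 -> generalized_gradient I u0 xi0).

End NonsmoothCalculus.

Section LinkingSets.
Variables (R : realType) (X : normedModType R).
Implicit Types (Y Z : set X) (z : X).

Definition linking_M Y z (rho : R) : set X :=
  [set u | exists y lam,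
     [/\ u = y + lam *: z, `|u| <= rho, 0 <= lam & Y y]].

Definition linking_M0 Y z (rho : R) : set X :=
  [set u | exists y lam,
     [/\ u = y + lam *: z, Y y
       & (`|u| = rho /\ 0 <= lam) \/ (`|u| <= rho /\ lam = 0)]].

Definition sphere_in Z (r : R) : set X := [set u | Z u /\ `|u| = r].

End LinkingSets.

(* Main.v *)
Require Import Defs.
From mathcomp Require Import all_boot zify.

Set Implicit Arguments.
Unset Strict Implicit.
Unset Printing Implicit Defensive.

(* No deformation flow and no degree are used. Fix [al] with [0 <= al < b], let
   [P = [0, 1] x M], which is sequentially compact for [tau], and consider the
   maps [f : P -> X], continuous from [tau] to the norm, with [f (0, u) = 0] and
   [I (u + f (t, u)) <= max (I u) al]. Uniform limits of such maps are again of
   this kind, and [phi f = sup_M I (u + f (1, u))] is lower semicontinuous.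

   [phi >= b]: a point [u] of [M] with [u + f (1, u)] on [S] is a fixed point of
   a homotopy of compact maps that has no fixed point on [M_0], where [I <= 0].
   It is obtained from a variational inequality on [M], solved on finitely
   generated convex sets by Brouwer's theorem, which in turn follows from
   Scarf's lemma applied to a fine grid of the simplex.

   If the minimal norm of the generalized gradient were at least [eps] on
   [al <= I <= d], then condition (H) and compactness of [P] would give, for each
   [f], a finite partition of unity and a field of almost steepest descent; a
   short step along it yields [g] with
   [sup_P |f - g| <= (2 / eps) (phi f - phi g)] and [phi g < phi f]. This
   contradicts the Ekeland-Caristi principle. *)

(** The obstacle is that descent and compactness belong to different topologies: [I] is continuous
    for the norm, while [M] is in general compact only for [tau]. Continuity of [f] from [tau] to
    the norm reconciles them. The point [u + f (t, u)] is then [tau]-continuous in [(t, u)], so that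
    upper semicontinuity and (H) apply to it, and the displacement [f] is a compact map, so that
    fixed point arguments apply. A finite sum of fixed vectors with [tau]-continuous coefficients is
    such a displacement; each descent step is built in this way. No slope is known below [al], hence
    the maximum in the constraint on [f]; it does no harm because [al < b <= phi f]. The compact map
    of the linking argument need not send [M] into itself. A variational inequality takes the place
    of a direct fixed point theorem, since its solutions are fixed points once they are off [M_0].
    They are kept off [M_0] by letting [t] be a function of [u] that vanishes on [M_0]. *)

(** * Scarf's lemma *)

(* The linear orders of Scarf's lemma are given by injective ranks. The slack
   element of index [i] lies below everything for the order [i] and above all
   proper elements for the others; it stands for the face opposite to the
   vertex [i] of the simplex. *)
Section Scarf.
Variables (I T : finType) (rk : I -> T -> nat) (slack : I -> T) (x0 : T).
Variable c : T -> I.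
Hypothesis rk_inj : forall i, injective (rk i).
Hypothesis slack_min : forall i x, rk i (slack i) <= rk i x.
Hypothesis slack_top : forall i j x, j != i -> x \notin codom slack ->
  rk i x < rk i (slack j).
Hypothesis x0_slack : x0 \notin codom slack.
Hypothesis c_slack : forall i, c (slack i) = i.
Hypothesis card_I : 1 < #|I|.

Definition dominant (s : {set T}) :=
  [forall y, [exists i, [forall (x | x \in s), rk i y <= rk i x]]].

Lemma dominantP (s : {set T}) :
  reflect (forall y, exists i, forall x, x \in s -> rk i y <= rk i x)
          (dominant s).
Proof.
apply: (iffP forallP) => H y; have := H y.
  by move=> /existsP[i /forall_inP Hi]; exists i.
by move=> [i Hi]; apply/existsP; exists i; apply/forall_inP.
Qed.

Section Wall.
Variables (t : {set T}) (xt : T).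
Hypotheses (t_dom : dominant t) (xt_t : xt \in t) (t_card : #|t|.+1 = #|I|).

Definition least i := [arg min_(x < xt in t) rk i x].

Lemma least_in i : least i \in t. Proof. by rewrite /least; case: arg_minnP. Qed.

Lemma least_le i x : x \in t -> rk i (least i) <= rk i x.
Proof. by rewrite /least; case: arg_minnP => // y _ H /H. Qed.

Lemma least_eq i x : x \in t -> (forall y, y \in t -> rk i x <= rk i y) -> least i = x.
Proof.
move=> xt' H; apply: (@rk_inj i); apply/eqP.
by rewrite eqn_leq least_le //= H // least_in.
Qed.

(** When [y] joins [t] and becomes least for the order [i] alone, the other orders keep their least
    elements; these [y] are the candidates. *)
Definition above i := [set y | [forall (k | k != i), rk k (least k) < rk k y]].

Lemma aboveP i y :
  reflect (forall k, k != i -> rk k (least k) < rk k y) (y \in above i).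
Proof. by rewrite inE; apply: (iffP forall_inP). Qed.

Definition max_above i y := (y \in above i) && [forall z in above i, rk i z <= rk i y].

Lemma card_max_above i : #|[set y | max_above i y]| = (above i != set0).
Proof.
case: (set_0Vmem (above i)) => [E|[y yi]].
  rewrite E eqxx; apply/eqP; rewrite cards_eq0; apply/eqP/setP => y.
  by rewrite !inE /max_above E in_set0.
have -> : above i != set0 by apply/set0Pn; exists y.
apply/eqP/cards1P; exists [arg max_(z > y in above i) rk i z].
case: arg_maxnP => // z zi zmax; apply/setP => x; rewrite !inE.
apply/andP/eqP => [[xi /forall_inP xm]|->].
  by apply: (@rk_inj i); apply/eqP; rewrite eqn_leq (zmax x xi : rk i x <= rk i z) xm.
by split=> //; apply/forall_inP.
Qed.

(** Without [k] there are as many indices as elements of [t], so surjectivity gives injectivity. *)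
Lemma least_injective k : (forall x, x \in t -> exists2 l, l != k & least l = x) ->
  {in [set~ k] &, injective least}.
Proof.
move=> H; apply/imset_injP.
rewrite eqn_leq leq_imset_card /=.
have -> : #|[set~ k]| = #|t|.
  by apply/succn_inj; rewrite t_card cardsC1 prednK // (ltn_trans _ card_I).
apply/subset_leq_card/subsetP => x /H[l lk <-].
by apply: imset_f; rewrite !inE.
Qed.

Lemma least_onto x : x \in t -> exists l, least l = x.
Proof.
move=> xt'; have [i Hi] := dominantP _ t_dom x.
by exists i; exact: least_eq.
Qed.

(** Dominance makes [least] a surjection of [I] onto a set with one element less, so a single pair
    of indices collides, and the removal of either one restores injectivity. *)
Lemma least_collision : exists i j,
  [/\ i != j, least i = least j, {in [set~ i] &, injective least}
    & {in [set~ j] &, injective least}].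
Proof.
have : ~~ injectiveb least.
  apply/negP => /injectiveP mi.
  have : #|I| <= #|t|.
    rewrite -cardsT -(card_imset _ mi); apply/subset_leq_card/subsetP => x.
    by move=> /imsetP[k _ ->]; exact: least_in.
  by rewrite -t_card ltnn.
move=> /injectivePn[i [j ij mij]]; exists i, j; split=> //; apply: least_injective.
  move=> x /least_onto[l <-]; have [->|li] := eqVneq l i; last by exists l.
  by exists j => //; rewrite eq_sym.
move=> x /least_onto[l <-]; have [->|li] := eqVneq l j; last by exists l.
by exists i.
Qed.

(** The pivoting rule. In a dominant [y |: t] the new element is least for one order [k] only, and
    the former least element for [k] must be least for another order, so [k] belongs to the
    colliding pair. Dominance of the larger set then forbids elements of [above k] that exceed [y]
    for the order [k]. *)
Lemma dominant_add y : (y \notin t) && dominant (y |: t) =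
  [exists k, [exists l, (k != l) && (least k == least l)] && max_above k y].
Proof.
apply/andP/existsP => [[yt /dominantP D]|[k /andP[/existsP[l /andP[kl /eqP mkl]]]]].
  have [k Hk] := D y; exists k.
  have Hl x : x \in t -> exists2 l, l != k &
      least l = x /\ (forall x', x' \in y |: t -> rk l x <= rk l x').
    move=> xt'; have [l Hl] := D x; exists l.
      apply: contraNneq yt => lk; rewrite -lk in Hk.
      suff -> : y = x by [].
      apply: (@rk_inj l); apply/eqP.
      by rewrite eqn_leq Hk ?inE ?xt' ?orbT //= Hl ?inE ?eqxx.
    by split=> //; apply: least_eq => // z zt; rewrite Hl // inE zt orbT.
  have mi : {in [set~ k] &, injective least}.
    by apply: least_injective => x /Hl[l lk []]; exists l.
  have yk : y \in above k.
    apply/aboveP => l lk; have [l' l'k [ml' Hl']] := Hl _ (least_in l).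
    have E : l' = l by apply: mi; rewrite ?inE.
    rewrite -E -[least _]/(least l') ltn_neqAle ml' E in Hl' *.
    rewrite Hl' ?inE ?eqxx // andbT; apply: contraNneq yt => /rk_inj <-.
    exact: least_in.
  apply/andP; split.
    have [i [j [ij mij mii mij']]] := least_collision.
    apply/existsP; have [->|ki] := eqVneq k i.
      by exists j; rewrite ij mij eqxx.
    have [->|kj] := eqVneq k j; first by exists i; rewrite eq_sym ij mij eqxx.
    by have := mi i j; rewrite !inE ![_ == k]eq_sym ki kj => /(_ isT isT mij)/eqP;
       rewrite (negbTE ij).
  rewrite /max_above yk; apply/forall_inP => z /aboveP zk.
  have [l Hlz] := D z; have [lk|lk] := eqVneq l k.
    by rewrite -lk; apply: Hlz; rewrite setU11.
  by have := Hlz (least l); rewrite leqNgt zk // inE least_in orbT => /(_ isT).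
move=> /andP[/aboveP yk /forall_inP ymax]; split.
  apply/negP => /least_onto[l' ml'].
  have [l'k|l'k] := eqVneq l' k; last by have := yk _ l'k; rewrite ml' ltnn.
  by have := yk l; rewrite eq_sym kl -mkl -l'k ml' ltnn => /(_ isT).
apply/dominantP => z; have [zk|] := boolP (z \in above k).
  have [l' Hl'] := dominantP _ t_dom z.
  have E : l' = k.
    apply/eqP; apply: contraT => l'k; have /aboveP/(_ l' l'k) := zk.
    by rewrite ltnNge Hl' // least_in.
  exists k => x; rewrite !inE => /orP[/eqP->|]; first exact: ymax.
  by rewrite -E; exact: Hl'.
rewrite inE => /forall_inPn[l' l'k]; rewrite -leqNgt => lez.
exists l' => x; rewrite !inE => /orP[/eqP->|xt'].
  by apply: (leq_trans lez); apply: ltnW; apply: yk.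
exact: leq_trans lez (least_le _ xt').
Qed.

Lemma card_wall : exists i j, [/\ i != j, least i = least j &
  #|[set y | (y \notin t) && dominant (y |: t)]|
    = (above i != set0) + (above j != set0)].
Proof.
have [i [j [ij mij mi mj]]] := least_collision; exists i, j; split=> //.
rewrite -!card_max_above.
have -> : [set y | (y \notin t) && dominant (y |: t)] =
    [set y | max_above i y] :|: [set y | max_above j y].
  apply/setP => y; rewrite !inE dominant_add.
  apply/existsP/orP => [[k /andP[/existsP[l /andP[kl /eqP mkl]] ky]]|].
    have [<-|ki] := eqVneq k i; first by left.
    have [<-|kj] := eqVneq k j; first by right.
    have [li|li] := eqVneq l i.
      by have := mj k l; rewrite !inE kj {1}li ij => /(_ isT isT mkl)/eqP;
         rewrite (negbTE kl).
    by have := mi k l; rewrite !inE ki li => /(_ isT isT mkl)/eqP; rewrite (negbTE kl).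
  case=> ky; [exists i|exists j]; rewrite ky andbT; apply/existsP;
    [exists j|exists i]; by rewrite ?ij 1?eq_sym ?ij mij eqxx.
(* An element of both sets would exceed the least elements of all orders, against the dominance of
   [t]. *)
rewrite cardsU; set s := _ :&: _; suff -> : s = set0 by rewrite cards0 subn0.
apply/setP => y; rewrite !inE; apply/negP => /andP[/andP[/aboveP yi _] /andP[/aboveP yj _]].
have [k Hk] := dominantP _ t_dom y.
have := Hk _ (least_in k); rewrite leqNgt; apply/negP; rewrite negbK.
by have [->|] := eqVneq k i; [exact: yj | exact: yi].
Qed.

End Wall.

Variable i0 : I.

Definition wall (t : {set T}) :=
  [&& dominant t, #|t|.+1 == #|I| & c @: t == [set~ i0]].

Definition slack_wall := slack @: [set~ i0].

Lemma slack_inj : injective slack.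
Proof. exact: (can_inj c_slack). Qed.

Lemma wall_slack_wall : wall slack_wall.
Proof.
apply/and3P; split.
- apply/dominantP => y; have [/codomP[k ->]|yS] := boolP (y \in codom slack).
    by exists k => x _; exact: slack_min.
  exists i0 => _ /imsetP[j + ->]; rewrite !inE => ji0.
  by apply/ltnW/slack_top.
- by rewrite card_imset ?cardsC1 ?prednK //; [apply: (ltn_trans _ card_I) | exact: slack_inj].
- rewrite -imset_comp (eq_imset _ (_ : c \o slack =1 id)) ?imset_id //.
Qed.

Lemma wall_eq_slack t : wall t -> {subset t <= codom slack} -> t = slack_wall.
Proof.
move=> /and3P[_ /eqP tc /eqP ct] tS; apply/eqP; rewrite eqEcard; apply/andP; split.
  apply/subsetP => x xt; have /codomP[i xi] := tS _ xt.
  rewrite xi; apply: imset_f; rewrite -ct; apply/imsetP; exists x => //.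
  by rewrite xi c_slack.
rewrite -ltnS tc; case/and3P: wall_slack_wall => _ /eqP -> _; exact: leqnn.
Qed.

(** A wall with a proper element has two extensions, because every [above k] contains [slack k]. In
    [slack_wall] the index [i0] collides with some [l]; there [above i0] contains [x0] and [above l]
    is empty, which leaves one extension. *)
Lemma odd_wall t : wall t ->
  odd #|[set y | (y \notin t) && dominant (y |: t)]| = (t == slack_wall).
Proof.
move=> W; case/and3P: (W) => td /eqP tc /eqP ct.
have [xt xtt] : exists x, x \in t.
  by apply/set0Pn; rewrite -card_gt0 -ltnS tc.
have [i [j [ij mij ->]]] := card_wall td xtt tc.
have [E|tS] := eqVneq t slack_wall; last first.
  have [x xt' xS] : exists2 x, x \in t & x \notin codom slack.
    apply/exists_inP; apply: contraR tS; rewrite negb_exists_in => /forall_inP H.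
    by apply/eqP; apply: wall_eq_slack => // x /H; rewrite negbK.
  have ne k : above t xt k != set0.
    apply/set0Pn; exists (slack k); apply/aboveP => // l lk.
    by apply: leq_ltn_trans (least_le _ _ xt') _ => //; apply: slack_top => //; rewrite eq_sym.
  by rewrite !ne.
have leastE k : k != i0 -> least t xt k = slack k.
  by move=> ki; apply: least_eq => //; rewrite E; apply: imset_f; rewrite !inE.
have o0 : above t xt i0 != set0.
  apply/set0Pn; exists x0; apply/aboveP => k ki; rewrite leastE //.
  rewrite ltn_neqAle slack_min andbT; apply: contraNneq x0_slack => /rk_inj <-.
  exact: codom_f.
have oj l : l != i0 -> least t xt i0 = slack l -> above t xt l = set0.
  move=> li m0; apply/setP => y; rewrite in_set0; apply/negP => /aboveP yl.
  have y0 : rk i0 (slack l) < rk i0 y by rewrite -m0; apply: yl; rewrite eq_sym.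
  have [/codomP[k yk]|yS] := boolP (y \in codom slack); last first.
    by have := slack_top li yS; rewrite ltnNge ltnW.
  have ki0 : k != i0.
    by apply: contraTneq y0 => k0; rewrite yk k0 -leqNgt slack_min.
  have kl : k != l by apply: contraTneq y0 => k0; rewrite yk k0 ltnn.
  by have := yl _ kl; rewrite leastE // yk ltnn.
have [ii|ii] := eqVneq i i0.
  by rewrite ii in ij mij *; rewrite o0 oj ?eqxx // 1?eq_sym // mij leastE // eq_sym.
have [jj|jj] := eqVneq j i0.
  by rewrite jj in ij mij *; rewrite o0 oj ?eqxx // -mij leastE.
by move: mij; rewrite !leastE // => /slack_inj /eqP; rewrite (negbTE ij).
Qed.

Lemma odd_sum (J : finType) (P : pred J) (F : J -> nat) :
  odd (\sum_(j | P j) F j) = odd #|[set j | P j && odd (F j)]|.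
Proof.
rewrite -sum1_card (big_morph odd oddD (erefl _)) (big_morph odd oddD (erefl _)).
rewrite [RHS](eq_bigl (fun j => P j && odd (F j))); last by move=> j; rewrite !inE.
by rewrite [RHS]big_mkcondr; apply: eq_bigr => j _; case: (odd _).
Qed.

(** Pairs of a wall and a cell containing it are counted twice. By walls their number is odd, as
    only [slack_wall] contributes an odd number. A cell that misses a colour contributes 0 or 2: if
    [y] can be removed, exactly one other element [y'] has the colour of [y], and only these two can
    be removed. So some cell has all colours. *)
Theorem scarf : exists s : {set T},
  [/\ dominant s, #|s| = #|I| & c @: s = setT].
Proof.
pose cell s := dominant s && (#|s| == #|I|).
pose N := \sum_(t | wall t) #|[set y | (y \notin t) && dominant (y |: t)]|.
have oddN : odd N.
  rewrite odd_sum (_ : [set t | _] = [set slack_wall]) ?cards1 //.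
  apply/setP => t; rewrite !inE; apply/andP/eqP => [[wt]|->].
    by rewrite odd_wall // => /eqP.
  by rewrite odd_wall ?wall_slack_wall.
have NE : N = \sum_(s | cell s) #|[set y in s | c @: (s :\ y) == [set~ i0]]|.
  rewrite /N.
  under eq_bigr do rewrite -sum1dep_card.
  rewrite (exchange_big_dep xpredT) //=.
  under [RHS]eq_bigr do rewrite -sum1dep_card.
  rewrite [RHS](exchange_big_dep xpredT) //=.
  apply: eq_bigr => y _.
  rewrite (reindex_onto (fun s => s :\ y) (fun t => y |: t)) /=; last first.
    by move=> t /and3P[_ yt _]; rewrite setU1K.
  apply: eq_bigl => s; apply/idP/idP.
    move=> /andP[/andP[/and3P[_ /eqP sc cs] /andP[_ sd]] /eqP E].
    have ys : y \in s by rewrite -E !inE eqxx.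
    by rewrite /cell -{1}E sd ys -sc (cardsD1 y s) ys cs eqxx.
  move=> /andP[/andP[sd /eqP sc] /andP[ys cs]].
  rewrite setD1K // sd eqxx !inE eqxx /wall cs /= !andbT -sc (cardsD1 y s) ys eqxx andbT.
  apply/dominantP => z; have [k Hk] := dominantP _ sd z.
  by exists k => x; rewrite !inE => /andP[_]; exact: Hk.
move: oddN; rewrite NE odd_sum => /odd_gt0; rewrite card_gt0 => /set0Pn[s].
rewrite inE => /andP[/andP[sd /eqP sc] so]; exists s; split=> //.
apply/eqP; apply: contraLR so => cs.
case: (set_0Vmem [set y in s | c @: (s :\ y) == [set~ i0]]) => [->|[y]].
  by rewrite cards0.
rewrite inE => /andP[ys /eqP cy].
have cs' : c @: s = c y |: [set~ i0] by rewrite -cy -imsetU1 setD1K.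
have cyi : c y != i0.
  apply: contraNneq cs => E; rewrite cs' E; apply/eqP/setP => k.
  by rewrite !inE; case: eqP.
have [y' y's cyy'] : exists2 y', y' \in s :\ y & c y = c y'.
  by apply/imsetP; rewrite cy !inE.
have cinj : {in s :\ y &, injective c}.
  apply/imset_injP; rewrite cy cardsC1 -sc (cardsD1 y s) ys //.
have cy' : c @: (s :\ y') = [set~ i0].
  apply/setP => k; rewrite -cy; apply/imsetP/imsetP => -[x].
    move=> xs ->; have [->|xy] := eqVneq x y; first by exists y'.
    by exists x => //; move: xs; rewrite !inE xy => /andP[_ ->].
  move=> xs ->; have [->|xy] := eqVneq x y'.
    exists y => //; rewrite !inE ys; move: y's; rewrite !inE eq_sym => /andP[-> _].
    by [].
  by exists x => //; move: xs; rewrite !inE xy => /andP[_ ->].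
rewrite (_ : [set _ in _ | _] = [set y; y']).
  by rewrite cards2; move: y's; rewrite !inE eq_sym => /andP[-> _].
apply/setP => x; rewrite !inE; apply/andP/orP => [[xs /eqP cx]|].
  have [|xy] := eqVneq x y; first by left.
  right; apply/eqP.
  have [u us cu] : exists2 u, u \in s :\ x & c x = c u.
    apply/imsetP; rewrite cx -cy; apply/imsetP; exists x => //.
    by rewrite !inE xy.
  have [uy|uy] := eqVneq u y.
    by apply: cinj; rewrite ?inE ?xy // -?cyy' ?cu ?uy //; move: y's; rewrite !inE.
  move: us; rewrite !inE => /andP[ux us].
  have := cinj x u; rewrite !inE xy uy us xs => /(_ isT isT cu)/eqP.
  by rewrite eq_sym (negbTE ux).
case=> /eqP->; first by rewrite ys cy.
by move: y's; rewrite !inE cy' => /andP[_ ->].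
Qed.

End Scarf.

(** * Scarf's lemma on a grid of the simplex *)

Section Grid.
Variables (n m : nat).
Definition grid := {x : {ffun 'I_n.+1 -> 'I_m.+1} | \sum_i x i == m}.
Implicit Types x y : grid.

Lemma grid_mk (a : 'I_n.+1 -> nat) : \sum_i a i = m ->
  exists y : grid, forall i, val y i = a i :> nat.
Proof.
move=> am.
have le i : a i < m.+1 by rewrite ltnS -am (bigD1 i) //= leq_addr.
pose g := [ffun i => Ordinal (le i)].
have H : \sum_i g i == m.
  by rewrite -[X in _ == X]am; apply/eqP/eq_bigr => i _; rewrite ffunE.
by exists (Sub g H : grid) => i; rewrite SubK ffunE.
Qed.

Lemma grid_sum x : \sum_i val x i = m.
Proof. by case: x => x /= /eqP. Qed.

Let T := (grid + 'I_n.+1)%type.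
Let N := #|{: T}|.

(** Order by the [i]-th coordinate, with [enum_rank] breaking ties. The summand 1 reserves the rank
    0 for the slack of [i]; the other slacks begin at [m.+1 * N + 1], beyond all grid points. *)
Definition grid_rk (i : 'I_n.+1) (t : T) : nat :=
  match t with
  | inl x => val x i * N + enum_rank t + 1
  | inr j => if j == i then 0 else m.+1 * N + 1 + j
  end.

Lemma grid_rk_lt i x : grid_rk i (inl x) < m.+1 * N + 1.
Proof.
rewrite /grid_rk; have := ltn_ord (enum_rank (inl x : T)); rewrite -/T -/N.
have := ltn_ord (val x i); nia.
Qed.

Lemma grid_rk_le i x y : grid_rk i (inl x) <= grid_rk i (inl y) ->
  val x i <= val y i.
Proof.
rewrite /grid_rk; have := ltn_ord (enum_rank (inl y : T)); rewrite -/T -/N.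
nia.
Qed.

Lemma grid_rk_inj i : injective (grid_rk i).
Proof.
move=> [x|j] [y|k].
- move=> H; apply: enum_rank_inj; apply: val_inj => /=.
  have E : val x i = val y i :> nat.
    by apply/eqP; rewrite eqn_leq !grid_rk_le ?H.
  by move: H; rewrite /= E => /addIn/addnI.
- by have := grid_rk_lt i x; rewrite /grid_rk; case: eqP; lia.
- by have := grid_rk_lt i y; rewrite /grid_rk; case: eqP; lia.
- rewrite /=; case: eqP => [->|_]; case: eqP => [->|_] //; try lia.
  by move=> H; congr inr; apply: val_inj => /=; lia.
Qed.

(** Let [C] be the indices whose slack is absent from Scarf's set [s]. The minima [a] of the
    coordinates on [s] add up to almost [m], so each coordinate varies by at most [n.+1] on [s]. A
    colour in [C] is carried by a grid point of [s]; outside [C] the bound [a i] is 0 and the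
    coordinate itself is small. *)
Lemma grid_colour (c : grid -> 'I_n.+1) : exists x, forall i,
  val x i <= n.+1 \/ exists2 y, c y = i &
    forall k, val x k <= val y k + n.+1 /\ val y k <= val x k + n.+1.
Proof.
have [x0 _] : exists y : grid, forall i, val y i = (if i == ord0 then m else 0) :> nat.
  by apply: grid_mk; rewrite -big_mkcond /= big_pred1_eq.
(* Scarf's lemma asks for at least two orders, so the one-point simplex is treated apart. *)
have [n0|n0] := posnP n.
  exists x0 => i; right; exists x0; last by move=> k; rewrite leq_addr.
  by move: (c x0) i; rewrite n0 => a b; rewrite !ord1.
pose sl : 'I_n.+1 -> T := inr.
pose ct (t : T) := match t with inl x => c x | inr j => j end.
have inS x : inl x \notin codom sl by apply/negP => /codomP[].
have [s [sd sc cs]] : exists s : {set T},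
    [/\ dominant grid_rk s, #|s| = #|'I_n.+1| & ct @: s = setT].
  apply: (@scarf _ _ (@grid_rk) sl (inl x0) ct _ _ _ _ _ _ ord0) => //.
  - exact: grid_rk_inj.
  - by move=> i x; rewrite /= eqxx.
  - move=> i j [x|k] ji; last by rewrite codom_f.
    move=> _; rewrite (_ : grid_rk i (sl j) = m.+1 * N + 1 + j).
      by rewrite ltn_addr // grid_rk_lt.
    by rewrite /= (negbTE ji).
  - by rewrite card_ord.
pose C := [set i | inr i \notin s].
have dom y : exists2 i, i \in C & forall x, inl x \in s -> val y i <= val x i.
  have [i Hi] := dominantP _ _ sd (inl y); exists i.
    by rewrite inE; apply/negP => /Hi; rewrite /= eqxx addn1.
  by move=> x /Hi/grid_rk_le.
have colC i : i \in C -> exists2 x, inl x \in s & c x = i.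
  rewrite inE => iC; have : i \in ct @: s by rewrite cs inE.
  by move=> /imsetP[[x|j] ts E]; [exists x | rewrite E /= ts in iC].
have [k0 k0C _] := dom x0; have [x1 x1s _] := colC _ k0C.
pose mi k := [arg min_(x < x1 | inl x \in s) val x k].
have mi_in k : inl (mi k) \in s by rewrite /mi; case: arg_minnP.
have mi_le k x : inl x \in s -> val (mi k) k <= val x k.
  by rewrite /mi; case: arg_minnP => // y _ H /H.
pose a k := if k \in C then val (mi k) k : nat else 0.
(* Otherwise, raising the bounds in [C] by one and giving the surplus to [k0] produces a grid point
   that contradicts [dom]. *)
have lt : m < \sum_k a k + #|C|.
  rewrite ltnNge; apply/negP => le.
  have [y yE] : exists y : grid, forall k, val y k = a k + (k \in C) +
      (if k == k0 then m - (\sum_k a k + #|C|) else 0) :> nat.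
    apply: grid_mk; rewrite !big_split /=.
    have -> : \sum_k (k \in C : nat) = #|C|.
      by rewrite -sum1_card [RHS]big_mkcond; apply: eq_bigr => k _; case: (k \in C).
    by rewrite -[X in _ + X]big_mkcond big_pred1_eq subnKC.
  have [i iC /(_ _ (mi_in i))] := dom y.
  by rewrite yE /a iC addn1 addSn leqNgt ltnS leq_addr.
have ale k x : inl x \in s -> a k <= val x k.
  by move=> xs; rewrite /a; case: ifP => // _; exact: mi_le.
have xle k x : inl x \in s -> val x k <= a k + n.+1.
  move=> xs; have := grid_sum x; rewrite (bigD1 k) //=.
  have : \sum_(i | i != k) a i <= \sum_(i | i != k) val x i.
    by apply: leq_sum => i _; exact: ale.
  move: lt; rewrite (bigD1 k) //=; have := max_card C; rewrite card_ord.
  rewrite -[sval x]/(val x); move=> h1 h2 h3 h4.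
  rewrite -(leq_add2r (\sum_(i < n.+1 | i != k) a i)).
  apply: leq_trans (_ : m <= _).
    by rewrite -[X in _ <= X]h4 leq_add2l.
  apply: (leq_trans (ltnW h2)).
  by rewrite addnAC leq_add2r leq_add2l.
exists x1 => i; have [iC|iC] := boolP (i \in C); last first.
  by left; have := xle i _ x1s; rewrite /a (negbTE iC).
right; have [y ys cy] := colC i iC; exists y => // k; split.
  by apply: (leq_trans (xle k _ x1s)); rewrite leq_add2r ale.
by apply: (leq_trans (xle k _ ys)); rewrite leq_add2r ale.
Qed.

End Grid.

From mathcomp Require Import all_order all_algebra sesquilinear.
From mathcomp Require Import all_classical all_reals all_analysis.
From mathcomp Require Import ring lra.
Import Order.TTheory GRing.Theory Num.Theory.
Import numFieldNormedType.Exports.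
Local Open Scope classical_set_scope.
Local Open Scope ring_scope.

(** * Brouwer's theorem on a simplex *)

Section Limits.
Variable R : realType.

Lemma cvg_seq_le (u : nat -> R) l c :
  u n @[n --> \oo] --> l -> (forall n, u n <= c) -> l <= c.
Proof.
move=> ul uc; apply: ler_cvg_to ul (cvg_cst c) _; exact: nearW.
Qed.

Lemma cvg_seq_ge (u : nat -> R) l c :
  u n @[n --> \oo] --> l -> (forall n, c <= u n) -> c <= l.
Proof.
move=> ul uc; apply: ler_cvg_to (cvg_cst c) ul _; exact: nearW.
Qed.

Lemma cvg_fsum (V : normedModType R) (J : Type) (s : seq J) (P : pred J)
    (u : J -> nat -> V) l :
  (forall i, u i n @[n --> \oo] --> l i) ->
  \sum_(i <- s | P i) u i n @[n --> \oo] --> \sum_(i <- s | P i) l i.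
Proof.
move=> ul; elim: s => [|j s IH].
  by rewrite big_nil; under eq_fun do rewrite big_nil; exact: cvg_cst.
rewrite big_cons; under eq_fun do rewrite big_cons.
by case: (P j) => //; apply: cvgD.
Qed.

Lemma cvg_sub (V : topologicalType) (phi : nat -> nat) (u : nat -> V) (l : V) :
  phi @ \oo --> \oo -> u n @[n --> \oo] --> l -> u (phi n) @[n --> \oo] --> l.
Proof. by move=> phioo ul; apply: cvg_comp phioo ul. Qed.

Lemma cvg_natSinv : (n.+1%:R^-1 : R) @[n --> \oo] --> 0.
Proof. exact: cvg_harmonic. Qed.

End Limits.

Section Subsequences.
Variable R : realType.

Lemma cvg_strict_mono (phi : nat -> nat) :
  (forall n, phi n < phi n.+1)%N -> phi @ \oo --> \oo.
Proof.
move=> H; have ge n : (n <= phi n)%N.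
  by elim: n => // n IH; exact: leq_ltn_trans IH (H n).
move=> A [N _ NA]; exists N => // n /= Nn; apply: NA => /=.
exact: leq_trans Nn (ge n).
Qed.

(** Tychonoff's theorem provides a cluster point [l] of the sequence in a product of segments. The
    indices are then chosen increasing, with more and more coordinates closer and closer to those of
    [l]. *)
Lemma common_subsequence (a : nat -> nat -> R) :
  (forall k, exists M, forall n, `|a k n| <= M) ->
  exists2 phi : nat -> nat, phi @ \oo --> \oo & forall k, cvgn (a k \o phi).
Proof.
move=> /choice[M aM].
pose RN := prod_topology (fun _ : nat => R : topologicalType).
pose x n : RN := fun k => a k n.
have := @tychonoff nat (fun _ => R) (fun k => [set y | `|y| <= M k]).
move=> /(_ _ (x @ \oo) _ _)[].
- move=> k; have -> : [set y : R | `|y| <= M k] = `[- M k, M k]%classic.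
    by apply/seteqP; split=> y; rewrite /= in_itv /= ler_norml.
  exact: segment_compact.
- by exists 0%N => // n _ k /=; exact: aM.
move=> l [_ lc].
have P N k : exists n, (N < n)%N /\ forall j, (j < k)%N -> `|a j n - l j| < k.+1%:R^-1.
  have U : nbhs (l : RN) [set f : RN |
      forall j, (j < k)%N -> `|f j - l j| < k.+1%:R^-1].
    elim: {1}k => [|q IH]; first by apply: filterS filterT => f _ j.
    have pj : nbhs (l : RN) [set f : RN |
        `|f q - l q| < k.+1%:R^-1].
      apply: (@proj_continuous nat (fun _ => R) q l [set y | `|y - l q| < k.+1%:R^-1]).
      apply/nbhs_ballP; exists k.+1%:R^-1 => /=; first by rewrite invr_gt0.
      by move=> y; rewrite /ball /= distrC.
    apply: filterS2 IH pj => f H1 H2 j; rewrite ltnS leq_eqVlt => /orP[/eqP->//|].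
    exact: H1.
  have := lc [set x n | n in [set n | (N < n)%N]] _ _ U.
  case; first by exists N.+1 => // n /= Nn; exists n.
  by move=> _ [[n /= Nn <-] H]; exists n.
have [g gP] : exists g : nat -> nat -> nat, forall N k, (N < g N k)%N /\
    forall j, (j < k)%N -> `|a j (g N k) - l j| < k.+1%:R^-1.
  exists (fun N k => sval (cid (P N k))) => N k; exact: (svalP (cid (P N k))).
pose phi := fix phi n := if n is m.+1 then g (phi m) m.+1 else g 0%N 0%N.
exists phi; first by apply: cvg_strict_mono => n /=; case: (gP (phi n) n.+1).
move=> k; apply/cvg_ex; exists (l k); apply/cvgrPdist_lt => e e0.
have [N Ne] : exists N : nat, N.+1%:R^-1 < e.
  have := near_infty_natSinv_lt (PosNum e0); case=> N _ /(_ N (leqnn _)) H.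
  by exists N.
exists (maxn k.+1 N) => // n /=; rewrite geq_max => /andP[kn Nn].
rewrite distrC; apply: le_lt_trans (Ne).
case: n kn Nn => // n kn Nn; have [_ /(_ _ kn)] := gP (phi n) n.+1.
move=> /= /ltW; move/le_trans; apply.
by rewrite lef_pV2 ?posrE // ler_nat ltnS.
Qed.

Lemma finite_subsequence (I : finType) (a : I -> nat -> R) M :
  (forall i n, `|a i n| <= M) ->
  exists2 phi : nat -> nat, phi @ \oo --> \oo & forall i, cvgn (a i \o phi).
Proof.
move=> aM; pose b k n := if @unpickle I k is Some i then a i n else 0.
have [|phi phioo bphi] := @common_subsequence b.
  move=> k; rewrite /b; case: unpickle => [i|]; first by exists M.
  by exists 0 => n; rewrite normr0.
exists phi => // i; have := bphi (pickle i).
by rewrite (_ : b (pickle i) = a i) // /b pickleK.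
Qed.

End Subsequences.

Section Brouwer.
Variables (R : realType) (n : nat).
Implicit Types s : 'I_n.+1 -> R.

Definition simplex : set ('I_n.+1 -> R) :=
  [set s | (forall i, 0 <= s i) /\ \sum_i s i = 1].

Lemma simplex_le1 s i : simplex s -> s i <= 1.
Proof.
by move=> [s0 <-]; rewrite (bigD1 i) //= lerDl sumr_ge0.
Qed.

Let pt m (x : grid n m.+1) : 'I_n.+1 -> R := fun i => (val x i)%:R / m.+1%:R.

Let pt_simplex m (x : grid n m.+1) : simplex (pt x).
Proof.
split=> [i|]; first by rewrite divr_ge0.
by rewrite /pt -mulr_suml -natr_sum grid_sum divff.
Qed.

(** A grid point is coloured by a coordinate that [f] does not decrease; one exists because both
    points have sum 1. Near the point [x] of [grid_colour], each coordinate [i] satisfies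
    [s i <= f s i] up to a small error: either at a point of colour [i], or because [s i] is itself
    small. In the limit the inequality holds for all [i], and equal sums turn it into equality. *)
Theorem brouwer_simplex (f : ('I_n.+1 -> R) -> 'I_n.+1 -> R) :
  (forall s, simplex s -> simplex (f s)) ->
  (forall (s_ : nat -> 'I_n.+1 -> R) s, (forall m, simplex (s_ m)) -> simplex s ->
     (forall i, s_ m i @[m --> \oo] --> s i) ->
     forall i, f (s_ m) i @[m --> \oo] --> f s i) ->
  exists2 s, simplex s & f s =1 s.
Proof.
move=> fS fC.
have col m : exists c : grid n m.+1 -> 'I_n.+1, forall x, pt x (c x) <= f (pt x) (c x).
  suff /choice[c cP] : forall x : grid n m.+1, exists i, pt x i <= f (pt x) i.
    by exists c.
  move=> x; apply/not_existsP => H.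
  have [_] := fS _ (pt_simplex x); have [_ <-] := pt_simplex x.
  apply/eqP; rewrite lt_eqF // ltr_sum //.
    by apply/hasP; exists ord0; rewrite ?mem_index_enum.
  by move=> i _; rewrite ltNge; apply/negP; exact: H.
have ex m : exists y : 'I_n.+1 -> 'I_n.+1 -> R, exists x : 'I_n.+1 -> R,
   [/\ simplex x, forall i, simplex (y i),
     forall i k, `|y i k - x k| <= n.+1%:R / m.+1%:R &
     forall i, y i i <= f (y i) i + n.+1%:R / m.+1%:R].
  have [c cP] := col m; have [x xP] := grid_colour c.
  have [y yP] : exists y : 'I_n.+1 -> grid n m.+1, forall i,
      ((val x i <= n.+1)%N /\ y i = x) \/ (c (y i) = i /\
      forall k, (val x k <= val (y i) k + n.+1)%N /\ (val (y i) k <= val x k + n.+1)%N).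
    suff /choice[y yP] : forall i, exists y : grid n m.+1,
      ((val x i <= n.+1)%N /\ y = x) \/ (c y = i /\
      forall k, (val x k <= val y k + n.+1)%N /\ (val y k <= val x k + n.+1)%N).
      by exists y.
    by move=> i; have [xi|[y cy yk]] := xP i; [exists x; left|exists y; right].
  exists (fun i => pt (y i)), (pt x); split=> //.
  - move=> i k; rewrite /pt -mulrBl normrM [X in _ * X]ger0_norm // ler_wpM2r //.
    have [[_ ->]|[_ /(_ k)[h1 h2]]] := yP i; first by rewrite subrr normr0.
    by rewrite ler_distl lerBlDr -!natrD !ler_nat h1 h2.
  - move=> i; have [[xi ->]|[cy _]] := yP i.
      rewrite ler_wpDl //; first by have [+ _] := fS _ (pt_simplex x); exact.
      by rewrite /pt ler_wpM2r // ler_nat.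
    by rewrite ler_wpDr ?divr_ge0 //; have := cP (y i); rewrite cy.
have {ex}[y /choice[x xyP]] := choice ex.
have [phi phioo xphi] : exists2 phi : nat -> nat, phi @ \oo --> \oo &
    forall i, cvgn ((fun m => x m i) \o phi).
  apply: (@finite_subsequence R _ (fun i m => x m i) 1) => i m.
  have [xm _ _ _] := xyP m.
  by rewrite ger0_norm ?simplex_le1 //; case: xm.
pose s i := limn ((fun m => x m i) \o phi).
have xs i : x (phi m) i @[m --> \oo] --> s i by exact: xphi.
have e0 : (n.+1%:R / (phi m).+1%:R : R) @[m --> \oo] --> 0.
  rewrite -(mulr0 n.+1%:R); apply: cvgMl_tmp.
  exact: cvg_sub phioo (@cvg_natSinv R).
have ys i k : y (phi m) i k @[m --> \oo] --> s k.
  rewrite -[s k]add0r.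
  rewrite (_ : (fun _ => _) = (fun m => (y (phi m) i k - x (phi m) k) + x (phi m) k)); last first.
    by apply/funext => m; rewrite subrK.
  apply: cvgD => //; apply/norm_cvg0P.
  apply: (squeeze_cvgr _ (cvg_cst 0) e0); apply: nearW => m.
  by rewrite normr_ge0; have [_ _ ->] := xyP (phi m).
have sS : simplex s.
  split=> [i|].
    by apply: (cvg_seq_ge (xs i)) => m; have [[+ _] _ _ _] := xyP (phi m); exact.
  have sx : \sum_i x (phi m) i @[m --> \oo] --> \sum_i s i by exact: cvg_fsum.
  have x1 m : \sum_i x (phi m) i = 1 by have [[]] := xyP (phi m).
  by apply/eqP; rewrite eq_le (cvg_seq_le sx) ?(cvg_seq_ge sx) // => m; rewrite x1.
exists s => //.
have le i : s i <= f s i.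
  have fy : f (y (phi m) i) i @[m --> \oo] --> f s i.
    by apply: fC => // m; have [_ + _ _] := xyP (phi m).
  rewrite -[f s i]addr0; apply: ler_cvg_to (ys i i) (cvgD fy e0) _.
  by apply: nearW => m; have [_ _ _] := xyP (phi m).
move=> i; apply/eqP; rewrite eq_le le andbT; have [_] := fS _ sS; have [_ <-] := sS.
move=> /eqP; rewrite -subr_eq0 -sumrB psumr_eq0 => [|j _]; last by rewrite subr_ge0.
by move=> /allP/(_ i); rewrite mem_index_enum => /(_ isT); rewrite /= subr_eq0 => /eqP->.
Qed.

End Brouwer.

(** * Hilbert spaces *)

Section CauchySequences.
Variables (R : realType).

Lemma cauchy_seq_cvg (X : completeNormedModType R) (u : nat -> X) :
  (forall e : R, 0 < e -> exists N, forall n p, (N <= n)%N -> (N <= p)%N ->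
     `|u n - u p| < e) -> cvgn u.
Proof.
move=> H; apply/cauchy_cvgP/cauchyP => e e0; have [N NP] := H e e0.
by exists (u N); exists N => // n /= Nn; rewrite -ball_normE /=; exact: NP.
Qed.

Lemma cvg_seq_cauchy (X : normedModType R) (u : nat -> X) (e : R) :
  cvgn u -> 0 < e -> exists N, forall n p, (N <= n)%N -> (N <= p)%N ->
     `|u n - u p| < e.
Proof.
move=> /cvg_ex[l /cvgrPdist_lt/(_ (e / 2))] H e0.
have [|N _ NP] := H; first by rewrite divr_gt0.
exists N => n p /NP /= h1 /NP /= h2.
by rewrite (splitr e) (le_lt_trans (ler_distD l _ _)) // ltrD // distrC.
Qed.

Lemma natSinv_lt (e : R) : 0 < e -> exists N, forall n, (N <= n)%N -> n.+1%:R^-1 < e.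
Proof.
move=> e0; have [N _ NP] := near_infty_natSinv_lt (PosNum e0).
by exists N => n /NP.
Qed.

(** First-order condition at a minimum. For [0 < b] the test value [- a / (2 * b)] minimises the
    quadratic. *)
Lemma quadratic_ge0 (a b : R) : (forall t, 0 <= t * a + t ^+ 2 * b) -> a = 0.
Proof.
move=> H; have [b0|b0] := lerP b 0.
  by have := H 1; have := H (-1); rewrite sqrrN !expr1n; lra.
have := H (- a / (2 * b)); rewrite (_ : _ + _ = - (a ^+ 2 / (4 * b))); last by field; lra.
rewrite oppr_ge0 pmulr_lle0 ?invr_gt0 ?mulr_gt0 // => a2.
by apply/eqP; rewrite -sqrf_eq0 eq_le a2 sqr_ge0.
Qed.

End CauchySequences.

Section Hilbert.
Variables (R : realType) (X : completeNormedModType R).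
Variable ip : {dot X for idfun}.
Hypothesis ip_norm : induces_norm ip.
Implicit Types u v w x y : X.

Lemma ipC u v : ip u v = ip v u.
Proof. by rewrite hermC /= expr0 mul1r. Qed.
Lemma ipDl u v w : ip (u + v) w = ip u w + ip v w.
Proof. by rewrite linearDl. Qed.
Lemma ipDr u v w : ip u (v + w) = ip u v + ip u w.
Proof. by rewrite linearDr. Qed.
Lemma ipZl k u v : ip (k *: u) v = k * ip u v.
Proof. by rewrite linearZl. Qed.
Lemma ipZr k u v : ip u (k *: v) = k * ip u v.
Proof. by rewrite linearZr. Qed.
Lemma ipNl u v : ip (- u) v = - ip u v.
Proof. by rewrite linearNl. Qed.
Lemma ipNr u v : ip u (- v) = - ip u v.
Proof. by rewrite linearNr. Qed.
Lemma ip0l u : ip 0 u = 0.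
Proof. by rewrite linear0l. Qed.
Lemma ip0r u : ip u 0 = 0.
Proof. by rewrite linear0r. Qed.
Definition ipE := (ipDl, ipDr, ipNl, ipNr, ipZl, ipZr).

Lemma ip_suml (J : Type) (s : seq J) (P : pred J) (F : J -> X) v :
  ip (\sum_(i <- s | P i) F i) v = \sum_(i <- s | P i) ip (F i) v.
Proof. by apply: (big_morph (ip^~ v)) => [x y|]; rewrite ?ipDl ?ip0l. Qed.

Lemma ip_normsq u : ip u u = `|u| ^+ 2.
Proof.
rewrite ip_norm sqr_sqrtr //; have [->|u0] := eqVneq u 0; first by rewrite ip0l.
exact/ltW/neq0_dnorm_gt0.
Qed.

Lemma normsqD u v : `|u + v| ^+ 2 = `|u| ^+ 2 + 2 * ip u v + `|v| ^+ 2.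
Proof. by rewrite -!ip_normsq !ipE (ipC v u); ring. Qed.

Lemma normsqB u v : `|u - v| ^+ 2 = `|u| ^+ 2 - 2 * ip u v + `|v| ^+ 2.
Proof. by rewrite -!ip_normsq !ipE (ipC v u); ring. Qed.

Lemma cauchy_schwarz u v : `|ip u v| <= `|u| * `|v|.
Proof.
have [->|v0] := eqVneq v 0; first by rewrite ip0r !normr0 mulr0.
have vv : 0 < `|v| ^+ 2 by rewrite exprn_gt0 // normr_gt0.
rewrite -(ler_pXn2r (_ : 0 < 2)%N) // ?nnegrE ?mulr_ge0 //.
have := sqr_ge0 `|u - (ip u v / `|v| ^+ 2) *: v|.
rewrite -[leRHS]ip_normsq !ipE (ipC v u) !ip_normsq.
rewrite (_ : _ + _ = `|u| ^+ 2 - ip u v ^+ 2 / `|v| ^+ 2); last by field; rewrite normr_eq0.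
rewrite exprMn real_normK ?num_real //.
by rewrite subr_ge0 ler_pdivrMr.
Qed.

Lemma ip_le u v : ip u v <= `|u| * `|v|.
Proof. exact: le_trans (ler_norm _) (cauchy_schwarz _ _). Qed.

Lemma cvg_normsq0 (u : nat -> X) :
  `|u n| ^+ 2 @[n --> \oo] --> 0 -> u n @[n --> \oo] --> 0.
Proof.
move=> /cvgr0Pnorm_lt H; apply/cvgr0Pnorm_lt => e e0.
have := H _ (exprn_gt0 2 e0); apply: filterS => n.
by rewrite ger0_norm ?sqr_ge0 // ltr_pXn2r // nnegrE // ltW.
Qed.

Lemma cvg_ip (u v : nat -> X) u0 v0 : u n @[n --> \oo] --> u0 ->
  v n @[n --> \oo] --> v0 -> ip (u n) (v n) @[n --> \oo] --> ip u0 v0.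
Proof.
move=> uu vv.
have E x y : ip x y = 4^-1 * (`|x + y| ^+ 2 - `|x - y| ^+ 2).
  by rewrite normsqD normsqB; field.
rewrite E; under eq_fun do rewrite E.
apply: cvgMl_tmp; apply: cvgB; apply: cvgM; apply: cvg_norm;
  by [apply: cvgD|apply: cvgB].
Qed.

Lemma normsq_continuous : continuous (fun x : X => `|x| ^+ 2).
Proof.
move=> y; apply: (@continuous_comp _ _ _ (fun y => `|y|) (fun r : R => r ^+ 2)).
  exact: norm_continuous.
exact: exprn_continuous.
Qed.

(** The value at the midpoint of two near-minimisers is not below the infimum, so strong convexity
    brings them close together and a minimising sequence is Cauchy. Projections, Riesz
    representation and Moreau regularisation all rest on this. *)
Lemma strongly_convex_min (A : set X) (F : X -> R) (m k : R) :
  A !=set0 -> closed A -> (forall x y, A x -> A y -> A (2^-1 *: (x + y))) ->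
  continuous F -> (forall x, A x -> m <= F x) -> 0 < k ->
  (forall x y, A x -> A y ->
     F (2^-1 *: (x + y)) <= (F x + F y) / 2 - k * `|x - y| ^+ 2) ->
  exists2 x, A x & forall y, A y -> F x <= F y.
Proof.
move=> [a0 Aa0] Acl Amid Fc Fm k0 Fsc.
have Fi : has_inf (F @` A).
  by split; [exists (F a0); exists a0|exists m => _ [x Ax <-]; exact: Fm].
pose i := inf (F @` A).
have iF x : A x -> i <= F x by move=> Ax; apply: ge_inf; [case: Fi|exists x].
have /choice[x xP] : forall n : nat, exists x, A x /\ F x < i + n.+1%:R^-1.
  move=> n; have [|_ [x Ax <-] H] := @inf_adherent _ _ n.+1%:R^-1 _ Fi.
    by rewrite invr_gt0.
  by exists x.
have xc : cvgn x.
  apply: cauchy_seq_cvg => e e0.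
  have [N NP] := natSinv_lt (mulr_gt0 k0 (exprn_gt0 2 e0)).
  exists N => n p /NP nN /NP pN.
  rewrite -(ltr_pXn2r (_ : 0 < 2)%N) // ?nnegrE ?normr_ge0 ?(ltW e0) // -(ltr_pM2l k0).
  have [An Fn] := xP n; have [Ap Fp] := xP p.
  have {}Fn : F (x n) < i + k * e ^+ 2 by apply: lt_trans Fn _; rewrite ltrD2l.
  have {}Fp : F (x p) < i + k * e ^+ 2 by apply: lt_trans Fp _; rewrite ltrD2l.
  have := Fsc _ _ An Ap; have := iF _ (Amid _ _ An Ap).
  move: Fn Fp; clear; move: (F _) (F _) (F _) i (k * _) (k * _) => f1 f2 f3 j q1 q2; lra.
exists (limn x) => [|y Ay].
  by apply: (closed_cvg _ Acl) xc; apply: nearW => n; case: (xP n).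
apply: le_trans (iF _ Ay).
have Fx : F (x n) @[n --> \oo] --> F (limn x) by apply: continuous_cvg xc; exact: Fc.
rewrite -[i]addr0; apply: ler_cvg_to Fx (cvgD (cvg_cst i) (@cvg_natSinv R)) _.
by apply: nearW => n; apply: ltW; case: (xP n).
Qed.

Definition subspace (V : set X) :=
  V 0 /\ forall k u v, V u -> V v -> V (k *: u + v).

Lemma closed_subspaceP V : closed_subspace V -> subspace V.
Proof.
move=> [[V0 VL] _]; split; first by move: V0; rewrite inE.
by move=> k u v Vu Vv; have := VL k u v; rewrite !inE; apply.
Qed.

Lemma subspaceD V u v : subspace V -> V u -> V v -> V (u + v).
Proof. by move=> [_ H] Vu Vv; rewrite -[u]scale1r; exact: H. Qed.

Lemma subspaceZ V k u : subspace V -> V u -> V (k *: u).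
Proof. by move=> [V0 H] Vu; rewrite -[k *: u]addr0; exact: H. Qed.

Lemma subspaceB V u v : subspace V -> V u -> V v -> V (u - v).
Proof.
by move=> sV Vu Vv; apply: subspaceD => //; rewrite -scaleN1r; apply: subspaceZ.
Qed.

Lemma projection_exists V a : subspace V -> closed V ->
  exists2 y, V y & forall w, V w -> ip (a - y) w = 0.
Proof.
move=> sV cV.
have [| | | | | |y Vy ymin] :=
    @strongly_convex_min V (fun y => `|a - y| ^+ 2) 0 4^-1 _ cV.
- by exists 0; case: sV.
- by move=> x y Vx Vy; apply: subspaceZ => //; apply: subspaceD.
- move=> y; apply: (@continuous_comp _ _ _ (fun y => a - y) (fun x => `|x| ^+ 2)).
    by apply: cvgB; [exact: cvg_cst|exact: cvg_id].
  exact: normsq_continuous.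
- by move=> x _; rewrite sqr_ge0.
- by rewrite invr_gt0.
- move=> x y _ _; rewrite (_ : a - _ = 2^-1 *: ((a - x) + (a - y))); last first.
    rewrite addrACA -opprD scalerBr -[a + a]mulr2n -[a *+ 2]scaler_nat scalerA.
    by rewrite mulVf ?scale1r.
  rewrite (_ : x - y = (a - y) - (a - x)); last by rewrite opprB [RHS]addrC addrA subrK.
  move: (a - x) (a - y) => p q.
  by rewrite normrZ exprMn normsqD normsqB (ipC q p) ger0_norm ?invr_ge0 //; lra.
exists y => // w Vw; suff E : - 2 * ip (a - y) w = 0 by lra.
apply: (@quadratic_ge0 _ _ (`|w| ^+ 2)) => t.
have := ymin (y + t *: w) (subspaceD sV Vy (subspaceZ _ sV Vw)).
rewrite opprD addrA; move: (a - y) => q.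
rewrite normsqB ipZr normrZ exprMn real_normK ?num_real //; lra.
Qed.

Lemma lipschitz_continuous (L : X -> R) k : 0 < k ->
  (forall u v, `|L u - L v| <= k * `|u - v|) -> continuous L.
Proof.
move=> k0 H u; apply/cvgrPdist_lt => e e0.
apply/nbhs_normP; exists (e / k) => /=; first by rewrite divr_gt0.
move=> v /= uv; apply: le_lt_trans (H u v) _.
by rewrite mulrC -ltr_pdivlMr.
Qed.

(** The representing vector minimises the energy [|y|^2 / 2 - L y], and the representation is the
    first-order condition. *)
Lemma riesz (L : X -> R) M : 0 < M ->
  (forall u v, L (u + v) = L u + L v) -> (forall k u, L (k *: u) = k * L u) ->
  (forall u, `|L u| <= M * `|u|) -> exists g, forall v, L v = ip g v.
Proof.
move=> M0 LD LZ LM.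
have LB u v : L (u - v) = L u - L v by rewrite LD -scaleN1r LZ mulN1r.
have [| | | | | | |g _ gmin] :=
    @strongly_convex_min setT (fun y => `|y| ^+ 2 / 2 - L y) (- M ^+ 2 / 2) 8^-1.
- by exists 0.
- exact: closedT.
- by [].
- move=> y; apply: (@continuousB _ _ _ (fun y : X => `|y| ^+ 2 / 2) L).
    apply: (@continuousM _ _ (fun y : X => `|y| ^+ 2) (cst 2^-1)); last exact: cst_continuous.
    exact: normsq_continuous.
  by apply: (lipschitz_continuous M0) => u v; rewrite -LB.
- move=> x _; have := LM x; rewrite ler_norml => /andP[_].
  have := sqr_ge0 (`|x| - M); rewrite sqrrB; lra.
- by rewrite invr_gt0.
- move=> x y _ _; rewrite LZ LD normrZ exprMn normsqB normsqD ger0_norm ?invr_ge0 //; lra.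
exists g => v; apply/esym/eqP; rewrite -subr_eq0; apply/eqP.
apply: (@quadratic_ge0 _ _ (`|v| ^+ 2 / 2)) => t.
have := gmin (g + t *: v) I; rewrite LD LZ normsqD ipZr normrZ exprMn.
rewrite real_normK ?num_real //; lra.
Qed.

Definition weak_cvg (u : nat -> X) u0 :=
  forall v, ip (u n) v @[n --> \oo] --> ip u0 v.

(** A subsequence is taken along which the inner products with every term [u k] converge. The
    vectors with convergent inner products form a closed subspace [W] that contains all [u k]; a
    vector orthogonal to [W] is orthogonal to the whole sequence, so [W] is the entire space and
    Riesz's theorem yields the limit. *)
Lemma weak_compactness (u : nat -> X) M : (forall n, `|u n| <= M) ->
  exists2 phi : nat -> nat, phi @ \oo --> \oo &
    exists u0, weak_cvg (u \o phi) u0.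
Proof.
move=> uM0.
have [M' [M'0 uM]] : exists M', 0 < M' /\ forall n, `|u n| <= M'.
  exists (`|M| + 1); split=> [|n]; first by rewrite ltr_wpDl.
  by apply: le_trans (uM0 n) _; rewrite ler_wpDr // ler_norm.
have [|phi phioo pc] := @common_subsequence R (fun k n => ip (u n) (u k)).
  move=> k; exists (M' * `|u k|) => n.
  by apply: le_trans (cauchy_schwarz _ _) _; rewrite ler_wpM2r.
exists phi => //.
pose c v n := ip (u (phi n)) v.
pose W := [set v | cvgn (c v)].
have sW : subspace W.
  split=> [|k v w Wv Ww]; rewrite /W /=.
    by rewrite (_ : c 0 = cst 0); [exact: is_cvg_cst|apply/funext => n; rewrite /c ip0r].
  rewrite (_ : c _ = (fun n => k * c v n) + c w); last first.
    by apply/funext => n; rewrite /c ipDr ipZr.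
  by apply: is_cvgD => //; apply: is_cvgMl_tmp.
have cW : closed W.
  move=> v Wv; apply: (@cauchy_seq_cvg R^o) => e e0.
  have e3 : 0 < e / (4 * M') by rewrite divr_gt0 // mulr_gt0.
  have [w [Ww vw]] := Wv _ (nbhsx_ballx v _ e3).
  have [N NP] := cvg_seq_cauchy Ww (divr_gt0 e0 (ltr0n R 2)).
  exists N => n p nN pN; have := NP _ _ nN pN.
  have vw' : `|v - w| < e / (4 * M') by move: vw; rewrite -ball_normE.
  have d q : `|c v q - c w q| <= e / 4.
    rewrite /c -ipNr -ipDr; apply: le_trans (cauchy_schwarz _ _) _.
    apply: (le_trans (ler_pM _ _ (uM _) (ltW vw'))) => //.
    by rewrite (_ : M' * _ = e / 4) //; field; lra.
  have := d n; have := d p; rewrite !ler_norml !ltr_norml /=.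
  by move=> /andP[? ?] /andP[? ?] /andP[? ?]; apply/andP; split; lra.
have WT v : W v.
  have [y Wy yP] := projection_exists v sW cW.
  rewrite -(subrK y v); apply: (subspaceD sW _ Wy).
  rewrite /W /= (_ : c _ = cst 0); first exact: is_cvg_cst.
  by apply/funext => n; rewrite /c ipC yP //; exact: pc.
have cl v : c v n @[n --> \oo] --> limn (c v) by exact: WT.
have [| | |g gP] := @riesz (fun v => limn (c v)) M' M'0.
- move=> v w; apply: cvg_lim => //; rewrite (_ : c _ = c v + c w).
    exact: cvgD.
  by apply/funext => n; rewrite /c ipDr.
- move=> k w; apply: cvg_lim => //; rewrite (_ : c _ = (fun n => k * c w n)).
    exact: cvgMl_tmp.
  by apply/funext => n; rewrite /c ipZr.
- move=> v; apply: (cvg_seq_le (cvg_norm (cl v))) => n.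
  by apply: le_trans (cauchy_schwarz _ _) _; rewrite ler_wpM2r.
by exists g => v; rewrite -gP; exact: cl.
Qed.

Lemma weak_cvg_norm_le (u : nat -> X) u0 M :
  weak_cvg u u0 -> (forall n, `|u n| <= M) -> `|u0| <= M.
Proof.
move=> uu uM; have [->|n0] := eqVneq u0 0.
  by rewrite normr0; exact: le_trans (uM 0%N).
have n1 : 0 < `|u0| by rewrite normr_gt0.
rewrite -(ler_pM2r n1) -expr2 -ip_normsq; apply: (cvg_seq_le (uu u0)) => n.
by apply: le_trans (ip_le _ _) _; rewrite ler_pM2r.
Qed.

Lemma weak_cvg_sub (u : nat -> X) u0 phi :
  phi @ \oo --> \oo -> weak_cvg u u0 -> weak_cvg (u \o phi) u0.
Proof. by move=> ph uu v; exact: cvg_sub ph (uu v). Qed.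

Lemma weak_cvg_unique (u : nat -> X) u0 u1 :
  weak_cvg u u0 -> weak_cvg u u1 -> u0 = u1.
Proof.
move=> h0 h1; apply/eqP; rewrite -subr_eq0 -normr_eq0 -sqrf_eq0 -ip_normsq ipDl ipNl.
by rewrite subr_eq0; apply/eqP; apply: cvg_unique (h0 _) (h1 _).
Qed.

Lemma cvg_weak (u : nat -> X) u0 : u n @[n --> \oo] --> u0 -> weak_cvg u u0.
Proof. by move=> uu v; apply: cvg_ip => //; exact: cvg_cst. Qed.

Lemma cvg_ip_weak (u v : nat -> X) u0 v0 M : u n @[n --> \oo] --> u0 ->
  weak_cvg v v0 -> (forall n, `|v n| <= M) ->
  ip (u n) (v n) @[n --> \oo] --> ip u0 v0.
Proof.
move=> uu vv vM.
rewrite (_ : (fun _ => _) = (fun n => ip (u n - u0) (v n)) + (fun n => ip u0 (v n))); last first.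
  apply/funext => n; rewrite -[RHS]/(ip (u n - u0) (v n) + ip u0 (v n)).
  by rewrite ipDl ipNl subrK.
rewrite -[ip u0 v0]add0r; apply: cvgD; last first.
  by rewrite ipC; under eq_fun do rewrite ipC; exact: vv.
apply/norm_cvg0P.
have h : `|u n - u0| * M @[n --> \oo] --> 0.
  rewrite -(mul0r M); apply: cvgMr_tmp; apply/norm_cvg0P; rewrite -(subrr u0).
  by apply: cvgB => //; exact: cvg_cst.
apply: (squeeze_cvgr _ (cvg_cst 0) h); apply: nearW => n; rewrite normr_ge0 /=.
by apply: le_trans (cauchy_schwarz _ _) _; rewrite ler_wpM2l.
Qed.

End Hilbert.

(** * Subgradients and the Clarke derivative *)

Section Sublinear.
Variables (R : realType) (X : completeNormedModType R).
Variable ip : {dot X for idfun}.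
Hypothesis ip_norm : induces_norm ip.
Variables (p : X -> R) (L : R).
Hypothesis L0 : 0 < L.
Hypothesis pD : forall v w, p (v + w) <= p v + p w.
Hypothesis pZ : forall k v, 0 < k -> p (k *: v) = k * p v.
Hypothesis pL : forall v, p v <= L * `|v|.

Lemma small_quadratic_ge0 (a b : R) :
  (forall s, 0 < s < 1 -> 0 <= s * a + s ^+ 2 * b) -> 0 <= a.
Proof.
move=> H; rewrite leNgt; apply/negP => a0.
have b0 := normr_ge0 b.
have q0 : 0 < 2 * (- a + `|b|) by lra.
(* For this [s] one has [s * |b| <= - a / 2], so the linear term outweighs the quadratic one. *)
pose s := - a / (2 * (- a + `|b|)).
have sE : s * (2 * (- a + `|b|)) = - a by rewrite divfK // gt_eqF.
have s0 : 0 < s by rewrite divr_gt0 // oppr_gt0.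
have s1 : s < 1 by rewrite ltr_pdivrMr // mul1r; lra.
have := H s; rewrite s0 s1 => /(_ isT).
rewrite expr2 -mulrA -mulrDr pmulr_rge0 // leNgt => /negP; apply.
clearbody s.
have : s * b <= s * `|b| by rewrite ler_pM2l // ler_norm.
have : 0 < s * - a by rewrite mulr_gt0 // oppr_gt0.
lra.
Qed.

Lemma sublinear_lipschitz v w : `|p v - p w| <= L * `|v - w|.
Proof.
have H x y : p x - p y <= L * `|x - y|.
  by rewrite lerBlDl; apply: le_trans (lerD (lexx _) (pL _)); rewrite -{1}(subrK y x) addrC.
by rewrite ler_norml lerNl opprB [in X in X && _]distrC !H.
Qed.

(* The subgradient inequality at the minimiser of [p x + (t / 2) |x - w|^2],
   a Moreau regularisation of [p], replaces the Hahn-Banach theorem. *)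
Lemma prox_subgradient t w : 0 < t -> exists x,
  (forall v, ip (t *: (w - x)) v <= p v) /\ ip (t *: (w - x)) x = p x.
Proof.
move=> t0.
have [| | | | | | |x _ xmin] := @strongly_convex_min _ _ setT
    (fun x => p x + t / 2 * `|x - w| ^+ 2) (- (L * `|w| + L ^+ 2 / (2 * t))) (t / 8).
- by exists 0.
- exact: closedT.
- by [].
- move=> y; apply: (@continuousD _ _ _ p (fun x => t / 2 * `|x - w| ^+ 2)).
    exact: (lipschitz_continuous L0 sublinear_lipschitz).
  apply: (@continuousM _ _ (cst (t / 2)) (fun x => `|x - w| ^+ 2)); first exact: cst_continuous.
  apply: (@continuous_comp _ _ _ (fun y => y - w) (fun x => `|x| ^+ 2)).
    by apply: cvgB; [exact: cvg_id|exact: cvg_cst].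
  exact: normsq_continuous.
- move=> x _.
  have h0 : 0 <= p x + p (- x).
    have := pD x (- x); rewrite subrr; have := pZ 0 (ltr0n R 2); rewrite scaler0; lra.
  have h1 : p (- x) <= L * (`|w| + `|x - w|).
    apply: le_trans (pL _) _; rewrite ler_pM2l // normrN -{1}(subrK w x) addrC.
    exact: ler_normD.
  have h2 : 0 <= (t * `|x - w| - L) ^+ 2 / (2 * t) by rewrite divr_ge0 ?sqr_ge0 // mulr_ge0 // ltW.
  have h3 : (t * `|x - w| - L) ^+ 2 / (2 * t)
      = t / 2 * `|x - w| ^+ 2 - L * `|x - w| + L ^+ 2 / (2 * t).
    by field; rewrite gt_eqF.
  move: h0 h1 h2 h3; rewrite mulrDr; move: (L ^+ 2 / _) => c; lra.
- by rewrite divr_gt0.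
- move=> x y _ _.
  rewrite pZ ?invr_gt0 //.
  rewrite (_ : 2^-1 *: (x + y) - w = 2^-1 *: ((x - w) + (y - w))); last first.
    rewrite addrACA -opprD scalerBr -[w + w]mulr2n -[w *+ 2]scaler_nat scalerA.
    by rewrite mulVf ?scale1r.
  rewrite (_ : x - y = (x - w) - (y - w)); last by rewrite opprB addrA subrK.
  have := pD x y; move: (x - w) (y - w) => a b.
  rewrite normrZ exprMn (normsqB ip_norm) (normsqD ip_norm) ger0_norm ?invr_ge0 //.
  move: (p (x + y)) (p x) (p y) (ip a b) (`|a| ^+ 2) (`|b| ^+ 2) => p1 p2 p3 q q1 q2 h.
  rewrite -subr_ge0 (_ : _ - _ = (p2 + p3 - p1) / 2); last by field.
  by rewrite divr_ge0 // subr_ge0.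
exists x.
have le v : ip (t *: (w - x)) v <= p v.
  rewrite -subr_ge0; apply: (@small_quadratic_ge0 _ (t / 2 * `|v| ^+ 2)) => s /andP[s0 _].
  have := xmin (x + s *: v) I; have := pD x (s *: v); rewrite pZ //.
  rewrite (addrAC x) -(opprB x w); move: (x - w) => q.
  rewrite (normsqD ip_norm) !ipZl ipZr ipNl normrZ exprMn real_normK ?num_real //.
  lra.
(* The reverse inequality is obtained by shrinking [x] towards 0, along a ray where [p] is
   linear. *)
split=> //; apply/eqP; rewrite eq_le le /= -subr_ge0.
apply: (@small_quadratic_ge0 _ (t / 2 * `|x| ^+ 2)) => s /andP[s0 s1].
have := xmin (x - s *: x) I.
rewrite {1}(_ : x - s *: x = (1 - s) *: x); last by rewrite scalerBl scale1r.
rewrite pZ ?subr_gt0 //.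
rewrite (addrAC x) -(opprB x w); move: (x - w) => q.
rewrite (normsqB ip_norm) !ipZl ipZr ipNl normrZ exprMn real_normK ?num_real //.
lra.
Qed.

Lemma subgradient_norm_le g : (forall v, ip g v <= p v) -> `|g| <= L.
Proof.
move=> H; have [->|g0] := eqVneq g 0; first by rewrite normr0 ltW.
have g1 : 0 < `|g| by rewrite normr_gt0.
by rewrite -(ler_pM2r g1) -expr2 -(ip_normsq ip_norm); apply: le_trans (H g) (pL g).
Qed.

(** That is, [p] is the support function of its subgradients. The subgradient [t (w - x)] at the
    proximal point [x] has norm at most [L], so for [t = L^2 / e] the values [p x] and [p w] differ
    by at most [e], while [p x] is at most the value of the subgradient at [w]. *)
Lemma sublinear_le_subgradients w c :
  (forall g, (forall v, ip g v <= p v) -> ip g w <= c) -> p w <= c.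
Proof.
move=> H; apply/ler_addgt0Pr => e e0.
pose t := L ^+ 2 / e; have t0 : 0 < t by rewrite divr_gt0 // exprn_gt0.
have [x [xle xE]] := prox_subgradient w t0.
have gL := subgradient_norm_le xle.
move: gL; rewrite normrZ gtr0_norm // => gL.
have := H _ xle; rewrite -{2}(subrK x w) ipDr xE ipZl (ip_normsq ip_norm) => h1.
have h2 : 0 <= t * `|w - x| ^+ 2 by rewrite mulr_ge0 ?sqr_ge0 // ltW.
have := sublinear_lipschitz w x; rewrite ler_norml => /andP[_ h3].
have h4 : L * `|w - x| <= e.
  rewrite -(ler_pM2l t0) mulrCA; apply: (le_trans (ler_wpM2l (ltW L0) gL)).
  by rewrite /t -expr2 divfK // gt_eqF.
lra.
Qed.

(** The proximal point of the origin gives the subgradient of least norm: any other one [g']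
    satisfies [ip g' (- g) <= p (- g) <= - |g|^2]. *)
Lemma sublinear_min_subgradient : exists g, (forall v, ip g v <= p v) /\
  p (- g) <= - `|g| ^+ 2.
Proof.
have [x [xle xE]] := prox_subgradient 0 ltr01.
exists (- x); rewrite scale1r sub0r in xle xE *; split=> //.
by rewrite opprK -xE ipNl (ip_normsq ip_norm) normrN.
Qed.

End Sublinear.

(** * The Clarke derivative as a finite sublinear function *)

Section ClarkeDerivative.
Variables (R : realType) (X : normedModType R) (I : X -> R).
Hypothesis I_lip : locally_lipschitz I.

(** A filter-free bound on the limsup: it follows from the strict inequality for the generalized
    derivative and implies the weak one. *)
Definition slope_bound u v (a : R) := exists2 del : R, 0 < del &
  forall h s, `|h| < del -> 0 < s < del -> I (u + h + s *: v) - I (u + h) <= s * a.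

Lemma generalized_derivative_le u v a :
  slope_bound u v a -> (generalized_derivative I u v <= a%:E)%E.
Proof.
move=> [del del0 H]; apply: ge_ereal_inf.
exists (ereal_sup [set (p.2^-1 * (I (u + p.1 + p.2 *: v) - I (u + p.1)))%:E
    | p in [set p : X * R | `|p.1| < del /\ 0 < p.2 < del]]).
  exists [set p : X * R | `|p.1| < del /\ 0 < p.2 < del] => //.
  exists ([set h | `|h| < del], [set s | 0 < s < del]).
    split=> /=.
      by apply/nbhs_normP; exists del => // h /=; rewrite sub0r normrN.
    exists del => //= s /=; rewrite sub0r normrN => sd s0.
    by rewrite s0 (le_lt_trans (ler_norm _) sd).
  by move=> [h s] [/= hd sd]; split.
apply: ge_ereal_sup => _ [[h s] /= [hd /andP[s0 sd]] <-].
by rewrite lee_fin mulrC ler_pdivrMr // mulrC H // s0.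
Qed.

Lemma slope_bound_gt u v a :
  (generalized_derivative I u v < a%:E)%E -> slope_bound u v a.
Proof.
move=> /ereal_inf_lt[_ [A [[B C] [/= B0 C0] BCA] <-] lt].
have /nbhs_normP[d1 /= d10 H1] := B0.
have [d2 /= d20 H2] := C0.
exists (Num.min d1 d2); first by rewrite lt_min d10.
move=> h s; rewrite !lt_min => /andP[hd1 _] /andP[s0 /andP[_ sd2]].
have Ahs : A (h, s).
  apply: BCA; split=> /=; first by apply: H1; rewrite /= sub0r normrN.
  by apply: H2 => //; rewrite /= sub0r normrN gtr0_norm.
rewrite -ler_pdivrMl // -lee_fin; apply/ltW/(le_lt_trans _ lt).
by apply: ereal_sup_ubound; exists (h, s).
Qed.

Lemma locally_lipschitz_bound u : exists L del, [/\ 0 < L, 0 < del &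
  forall x y, `|x - u| < del -> `|y - u| < del -> `|I x - I y| <= L * `|x - y|].
Proof.
have [U Uu [M0 [_ HM]]] := I_lip u.
have /nbhs_normP[del /= del0 Hd] := Uu.
exists (`|M0| + 1), del; split=> //.
move=> x y xu yu; have := HM (`|M0| + 1).
have -> : M0 < `|M0| + 1 by rewrite (le_lt_trans (ler_norm _)) // ltrDl.
move=> /(_ isT (x, y)); apply; split=> /=; apply: Hd; by rewrite /= distrC.
Qed.

Lemma locally_lipschitz_continuous : continuous I.
Proof.
move=> u; have [L [del [L0 del0 H]]] := locally_lipschitz_bound u.
apply/cvgrPdist_lt => e e0; apply/nbhs_normP.
exists (Num.min del (e / L)) => /=; first by rewrite lt_min del0 divr_gt0.
move=> v /=; rewrite lt_min => /andP[uv uv'].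
apply: le_lt_trans (H _ _ _ _) _; rewrite ?subrr ?normr0 // 1?distrC //.
by rewrite distrC mulrC -ltr_pdivlMr.
Qed.

Lemma slope_bound_lipschitz u : exists2 L, 0 < L &
  (forall v, slope_bound u v (L * `|v|)) /\
  (forall v a, slope_bound u v a -> - (L * `|v|) <= a).
Proof.
have [L [del [L0 del0 H]]] := locally_lipschitz_bound u; exists L => //; split.
  (* Each of [h] and [s *: v] receives half of the radius; [1 + |v|] instead of [|v|] avoids a
     division by zero. *)
  move=> v; have d0 : 0 < del / 2 / (1 + `|v|) by rewrite !divr_gt0 // ltr_wpDr.
  exists (Num.min (del / 2) (del / 2 / (1 + `|v|))).
    by rewrite lt_min d0 divr_gt0.
  move=> h s; rewrite !lt_min => /andP[hd _] /andP[s0 /andP[_ sd]].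
  have sv : s * `|v| < del / 2.
    have : s * (1 + `|v|) < del / 2 by rewrite -ltr_pdivlMr // ltr_wpDr.
    by rewrite mulrDr mulr1; lra.
  have := H (u + h + s *: v) (u + h).
  have -> : u + h + s *: v - u = h + s *: v by rewrite addrC !addrA addNr add0r.
  have -> : u + h - u = h by rewrite addrAC subrr add0r.
  have -> : u + h + s *: v - (u + h) = s *: v by rewrite addrAC subrr add0r.
  rewrite normrZ gtr0_norm // mulrCA => H1.
  apply: le_trans (ler_norm _) _; apply: H1; last by lra.
  by apply: le_lt_trans (ler_normD _ _) _; rewrite normrZ gtr0_norm //; lra.
move=> v a [d2 d20 Ha].
pose s := Num.min (d2 / 2) (del / 2 / (1 + `|v|)).
have s0 : 0 < s by rewrite lt_min !divr_gt0 // ltr_wpDr.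
have sd : s < d2 by rewrite gt_min; apply/orP; left; lra.
have sv : s * `|v| < del.
  have : s * (1 + `|v|) <= del / 2.
    by rewrite -ler_pdivlMr ?ltr_wpDr // ge_min lexx orbT.
  by rewrite mulrDr mulr1; lra.
have := Ha 0 s; rewrite normr0 s0 sd addr0 => /(_ d20 isT) h1.
have := H (u + s *: v) u; rewrite addrAC subrr add0r normr0 normrZ gtr0_norm //.
move=> /(_ sv del0); rewrite ler_norml => /andP[h2 _].
by rewrite -(ler_pM2l s0); apply: le_trans h1; rewrite mulrN mulrCA.
Qed.

(** The increment is split at the base point shifted by [s *: w], which is legitimate because slopes
    are bounded at all nearby base points. *)
Lemma slope_boundD u v w a b :
  slope_bound u v a -> slope_bound u w b -> slope_bound u (v + w) (a + b).
Proof.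
move=> [d1 d10 H1] [d2 d20 H2].
have q0 : 0 < d1 / 2 / (1 + `|w|) by rewrite !divr_gt0 // ltr_wpDr.
exists (Num.min (Num.min (d1 / 2) d2) (d1 / 2 / (1 + `|w|))).
  by rewrite !lt_min q0 d20 divr_gt0.
move=> h s; rewrite !lt_min => /andP[/andP[hd1 hd2] _].
move=> /andP[s0 /andP[/andP[sd1 sd2] sw]].
have sw' : s * `|w| < d1 / 2.
  have : s * (1 + `|w|) < d1 / 2 by rewrite -ltr_pdivlMr // ltr_wpDr.
  by rewrite mulrDr mulr1; lra.
have h1 : I (u + (h + s *: w) + s *: v) - I (u + (h + s *: w)) <= s * a.
  apply: H1; last by rewrite s0; lra.
  by apply: le_lt_trans (ler_normD _ _) _; rewrite normrZ gtr0_norm //; lra.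
have := H2 h s hd2; rewrite s0 sd2 => /(_ isT).
move: h1; rewrite scalerDr !addrA (addrAC _ (s *: v)) mulrDr; lra.
Qed.

Lemma slope_boundZ u v k a :
  0 < k -> slope_bound u v a -> slope_bound u (k *: v) (k * a).
Proof.
move=> k0 [d1 d10 H1]; exists (Num.min d1 (d1 / k)); first by rewrite lt_min d10 divr_gt0.
move=> h s; rewrite !lt_min => /andP[hd _] /andP[s0 /andP[_ sd]].
by rewrite scalerA mulrA; apply: H1 => //; rewrite mulr_gt0 //= -ltr_pdivlMr.
Qed.

Definition clarke u v : R := fine (generalized_derivative I u v).

Lemma clarkeE u v : generalized_derivative I u v = (clarke u v)%:E.
Proof.
rewrite /clarke fineK // fin_numE.
have [L L0 [HL HN]] := slope_bound_lipschitz u.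
have := generalized_derivative_le (HL v).
case E : (generalized_derivative I u v) => [x| |] // _.
have /HN : slope_bound u v (- (L * `|v|) - 1).
  by apply: slope_bound_gt; rewrite E ltNyr.
by lra.
Qed.

Lemma clarke_le u v a : slope_bound u v a -> clarke u v <= a.
Proof. by move=> /generalized_derivative_le; rewrite clarkeE lee_fin. Qed.

Lemma clarke_lt u v a : clarke u v < a -> slope_bound u v a.
Proof. by move=> h; apply: slope_bound_gt; rewrite clarkeE lte_fin. Qed.

Lemma clarkeD u v w : clarke u (v + w) <= clarke u v + clarke u w.
Proof.
apply/ler_addgt0Pr => e e0.
rewrite (_ : _ + e = (clarke u v + e / 2) + (clarke u w + e / 2)); last by lra.
by apply/clarke_le/slope_boundD; apply: clarke_lt; lra.
Qed.

Lemma clarkeZ u k v : 0 < k -> clarke u (k *: v) = k * clarke u v.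
Proof.
have H c w : 0 < c -> clarke u (c *: w) <= c * clarke u w.
  move=> c0; apply/ler_addgt0Pr => e e0.
  rewrite (_ : _ + e = c * (clarke u w + e / c)); last by field; lra.
  by apply/clarke_le/slope_boundZ => //; apply: clarke_lt; rewrite ltrDl divr_gt0.
move=> k0; apply/eqP; rewrite eq_le H //=.
have := H k^-1 (k *: v); rewrite invr_gt0 k0 scalerA mulVf ?scale1r ?gt_eqF // => /(_ isT).
by rewrite ler_pdivlMl.
Qed.

Lemma clarke_bound u : exists2 L, 0 < L & forall v, clarke u v <= L * `|v|.
Proof.
have [L L0 [HL _]] := slope_bound_lipschitz u.
by exists L => // v; exact: clarke_le.
Qed.

End ClarkeDerivative.

Section RealInduction.
Variable R : realType.

(** At the infimum of the failures [P] holds by the left-limit rule, and then the step to the right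
    keeps the failures away from their infimum. *)
Lemma real_induction (P : R -> Prop) (d : R) : 0 <= d -> P 0 ->
  (forall s, 0 <= s < d -> P s -> exists2 h, 0 < h &
     forall s', s < s' < s + h -> P s') ->
  (forall s, 0 < s <= d -> (forall s', 0 <= s' < s -> P s') -> P s) -> P d.
Proof.
move=> d0 P0 Pr Pl; apply: contrapT => Pd.
pose B := [set s | 0 <= s <= d /\ ~ P s].
have Bd : B d by split; rewrite ?d0 ?lexx.
have Bi : has_inf B by split; [exists d|exists 0 => s [/andP[]]].
pose b := inf B.
have bB s : B s -> b <= s by move=> Bs; apply: ge_inf => //; case: Bi.
have b0 : 0 <= b by apply: lb_le_inf; [exists d|move=> s [/andP[]]].
have bd : b <= d by exact: bB.
have Plt s : 0 <= s < b -> P s.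
  move=> /andP[s0 sb]; apply: contrapT => Ps.
  have : b <= s by apply: bB; split; rewrite ?s0 //= (ltW (lt_le_trans sb bd)).
  by rewrite leNgt sb.
have Pb : P b.
  have [<-//|b1] := eqVneq 0 b.
  by apply: Pl Plt; rewrite bd lt_neqAle b1 b0.
have [bd1|bd1] := ltP b d; last first.
  by apply: Pd; rewrite (_ : d = b) //; apply/eqP; rewrite eq_le bd bd1.
have [|h h0 H] := Pr b _ Pb; first by rewrite b0 bd1.
have [s Bs sbh] := inf_adherent h0 Bi.
have bs := bB s Bs; case: (Bs) => _; apply.
by have [<-//|b1] := eqVneq b s; apply: H; rewrite sbh lt_neqAle b1 bs.
Qed.

End RealInduction.

(** * The generalized gradient and descent along segments *)

Section Gradient.
Variables (R : realType) (X : completeNormedModType R).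
Variable ip : {dot X for idfun}.
Hypothesis ip_norm : induces_norm ip.
Variable I : X -> R.
Hypothesis I_lip : locally_lipschitz I.

Lemma dual_ip g : dual (ip g).
Proof.
apply: (@lipschitz_continuous _ _ _ (`|g| + 1)); first by rewrite ltr_wpDl.
move=> u v; rewrite -ipNr -ipDr; apply: le_trans (cauchy_schwarz ip_norm _ _) _.
by rewrite ler_wpM2r // lerDl.
Qed.

Lemma dual_norm_ip (xi : {scalar X}) g : (forall v, xi v = ip g v) ->
  dual_norm xi = `|g|.
Proof.
move=> E; rewrite /dual_norm; set A := [set _ | _ in _].
have gA : A `|g|.
  have [->|g0] := eqVneq g 0.
    exists 0; [by rewrite /= normr0 ler01 | by rewrite E ip0r !normr0].
  have g1 : `|g| != 0 by rewrite normr_eq0.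
  exists (`|g|^-1 *: g); rewrite /= ?E.
    by rewrite normrZ normfV normr_id mulVf.
  by rewrite ipZr (ip_normsq ip_norm) normrM normfV normr_id normrX normr_id expr2 mulKf.
have Ag : ubound A `|g|.
  move=> _ [v /= v1 <-]; rewrite E; apply: le_trans (cauchy_schwarz ip_norm _ _) _.
  by rewrite ler_piMr.
apply/eqP; rewrite eq_le ge_sup ?ub_le_sup //=; first by exists `|g|.
by exists `|g|.
Qed.

Lemma dual_riesz (xi : {scalar X}) : dual xi -> exists g, forall v, xi v = ip g v.
Proof.
move=> xi_c.
have /cvgrPdist_lt/(_ 1 ltr01)/nbhs_normP[del /= del0 H] := xi_c 0.
apply: (@riesz _ _ _ ip_norm xi (2 / del)).
- by rewrite divr_gt0.
- by move=> u v; rewrite linearD.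
- by move=> k u; rewrite linearZ.
move=> u; have [->|u0] := eqVneq u 0; first by rewrite linear0 !normr0 mulr0.
have u1 : 0 < `|u| by rewrite normr_gt0.
have [k k0 kE] : exists2 k, 0 < k & k * `|u| = del / 2.
  by exists (del / 2 / `|u|); rewrite ?divr_gt0 // divfK ?gt_eqF.
have := H (k *: u); rewrite /= linear0 !sub0r !normrN linearZ /= normrZ normrM.
rewrite (gtr0_norm k0) kE (_ : del / 2 < del) => [/(_ isT)|]; last by lra.
rewrite -(ltr_pM2r u1) mul1r mulrAC kE => h.
by rewrite mulrAC ler_pdivlMr //; lra.
Qed.

Lemma gradient_ip u g : (forall v, ip g v <= clarke I u v) ->
  generalized_gradient I u (ip g).
Proof.
move=> H; split; first exact: dual_ip.
by move=> v; rewrite clarkeE // lee_fin; exact: H.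
Qed.

Lemma gradient_riesz u xi : generalized_gradient I u xi -> exists g,
  [/\ forall v, xi v = ip g v, dual_norm xi = `|g| & forall v, ip g v <= clarke I u v].
Proof.
move=> [/dual_riesz[g gE] H]; exists g; split=> //; first exact: dual_norm_ip.
by move=> v; have := H v; rewrite clarkeE // lee_fin gE.
Qed.

(** The direction is opposite to the gradient element [g] of least norm: every [xi] satisfies
    [xi (- g) <= - |g|^2], and division by [|g|] gives the rate. For [g = 0] the convention that the
    inverse of 0 is 0 makes [w = 0]. *)
Lemma lambda_descent u : exists l w, [/\ lambda I u = l%:E, 0 <= l, `|w| <= 1 &
  forall xi, generalized_gradient I u xi -> xi w <= - l].
Proof.
have [L L0 HL] := clarke_bound I_lip u.
have [g [gle gmin]] := sublinear_min_subgradient ip_norm L0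
  (clarkeD I_lip u) (fun k v => @clarkeZ _ _ _ I_lip u k v) HL.
have xig (xi : {scalar X}) : generalized_gradient I u xi -> xi (- g) <= - `|g| ^+ 2.
  move=> /gradient_riesz[g' [-> _ /(_ (- g)) h]]; exact: le_trans h gmin.
exists `|g|, (- (`|g|^-1 *: g)); split=> //.
- rewrite /lambda; set A := _ `&` _.
  have Ag : A `|g|%:E.
    split; first by exists (ip g); [exact: gradient_ip|rewrite (@dual_norm_ip _ g)].
    move=> _ [xi xiI <-]; rewrite lee_fin.
    have [g' [xiE -> _]] := gradient_riesz xiI.
    have := xig _ xiI; rewrite xiE ipNr lerN2 => h.
    have [->|g0] := eqVneq g 0; first by rewrite normr0.
    have g1 : 0 < `|g| by rewrite normr_gt0.
    rewrite -(ler_pM2r g1) -expr2; apply: le_trans h (ip_le ip_norm _ _).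
  case: xgetP => [x -> [xA xmin]|/(_ _ Ag)//].
  by apply/eqP; rewrite eq_le xmin ?(proj2 Ag) //; case: Ag.
- rewrite normrN normrZ normfV normr_id.
  by have [->|g0] := eqVneq g 0; rewrite ?normr0 ?mulr0 // mulVf // normr_eq0.
- move=> xi /xig h; rewrite -scalerN (_ : xi _ = `|g|^-1 * xi (- g)); last exact: linearZ.
  have [g0|g0] := eqVneq g 0; first by rewrite g0 oppr0 linear0 mulr0 normr0 oppr0.
  rewrite mulrC ler_pdivrMr ?normr_gt0 //.
  by rewrite mulNr -expr2.
Qed.

(** The Clarke derivative is the support function of the generalized gradient, so a bound valid for
    all [xi] passes to the slopes. *)
Lemma slope_bound_gradient u w c :
  (forall xi, generalized_gradient I u xi -> xi w <= c) ->
  forall e, 0 < e -> slope_bound I u w (c + e).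
Proof.
move=> H e e0; apply: clarke_lt => //; apply: (@le_lt_trans _ _ c); last by rewrite ltrDl.
have [L L0 HL] := clarke_bound I_lip u.
apply: (sublinear_le_subgradients ip_norm L0
  (clarkeD I_lip u) (fun k v => @clarkeZ _ _ _ I_lip u k v) HL) => g gle.
exact: (H (ip g) (gradient_ip gle)).
Qed.

Lemma weak_star_subsequence (xi : nat -> {scalar X}) M :
  (forall n, dual (xi n)) -> (forall n, dual_norm (xi n) <= M) ->
  exists2 phi : nat -> nat, phi @ \oo --> \oo &
    exists xi0 : {scalar X}, dual xi0 /\ weak_star_cvg (xi \o phi) xi0.
Proof.
move=> xid xiM; have /choice[g gE] : forall n, exists g, forall v, xi n v = ip g v.
  by move=> n; exact: dual_riesz.
have [|phi phioo [g0 gg0]] := @weak_compactness _ _ _ ip_norm g M.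
  by move=> n; rewrite -(dual_norm_ip (gE n)).
exists phi => //; exists (ip g0); split; first exact: dual_ip.
move=> v; have := gg0 v.
by under [X in X @ _ --> _ -> _]eq_fun do rewrite /= -gE.
Qed.

(* Continuous induction on the Dini derivative; once the value has dropped
   below [al] nothing is known about the slope, hence the maximum. *)
Lemma descent_path v V d c al : 0 <= d -> 0 <= c ->
  (forall s, 0 <= s < d -> al <= I (v + s *: V) ->
     forall e, 0 < e -> slope_bound I (v + s *: V) V (- c + e)) ->
  I (v + d *: V) <= Num.max al (I v - c * d).
Proof.
move=> d0 c0 H.
have Ic : continuous (fun s : R => I (v + s *: V)).
  move=> s; apply: (@continuous_comp _ _ _ (fun s : R => v + s *: V) I).
    by apply: cvgD; [exact: cvg_cst|apply: cvgZr_tmp; exact: cvg_id].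
  exact: locally_lipschitz_continuous.
(* The summand [e * s] absorbs the error [e] of the slope bounds; it is later used with [e / d], so
   that it amounts to [e] at the end of the segment. *)
pose bd e s := Num.max (al + e * s) (I v - c * s + e * s).
suff P e : 0 < e -> I (v + d *: V) <= bd e d.
  apply/ler_addgt0Pr => e e0.
  have [->|dn0] := eqVneq d 0.
    by rewrite scale0r addr0 mulr0 subr0 ler_wpDr ?(ltW e0) // le_max lexx orbT.
  have := P (e / d); rewrite /bd divfK // -addr_maxl; apply.
  by rewrite divr_gt0 // lt_neqAle eq_sym dn0.
move=> e0.
have bdc : continuous (bd e).
  move=> s; apply: (@continuous_max _ _ (fun s => al + e * s) (fun s => I v - c * s + e * s)).
    by apply: cvgD; [exact: cvg_cst|apply: cvgMl_tmp; exact: cvg_id].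
  apply: cvgD; last by apply: cvgMl_tmp; exact: cvg_id.
  by apply: cvgB; [exact: cvg_cst|apply: cvgMl_tmp; exact: cvg_id].
apply: (@real_induction _ (fun s => I (v + s *: V) <= bd e s)) => //.
- by rewrite scale0r addr0 /bd !mulr0 !addr0 subr0 le_max lexx orbT.
- move=> s /andP[s0 sd] Ps; have [als|sal] := lerP al (I (v + s *: V)).
    have [|h h0 Hh] := H s _ als e e0; first by rewrite s0.
    exists h => // s' /andP[ss' s'h].
    have := Hh 0 (s' - s); rewrite normr0 => /(_ h0).
    rewrite subr_gt0 ss' /= ltrBlDl => /(_ s'h).
    rewrite addr0 -addrA -scalerDl (addrC s) subrK => h1.
    have h2 : 0 <= c * (s' - s) by rewrite mulr_ge0 // subr_ge0 ltW.
    have h3 : 0 <= e * (s' - s) by rewrite mulr_ge0 ?subr_ge0 // ltW.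
    move: Ps h1; rewrite /bd !le_max => /orP[] h4 h1; apply/orP; [left|right]; lra.
  (* Below [al] continuity alone keeps the value below [al] for a while. *)
  have /cvgrPdist_lt/(_ (al - I (v + s *: V))) := Ic s.
  rewrite subr_gt0 => /(_ sal) /nbhs_normP[h /= h0 Hh]; exists h => // s' /andP[ss' s'h].
  have := Hh s'; rewrite /= ltr0_norm ?subr_lt0 // opprB ltrBlDl => /(_ s'h).
  rewrite ltr_norml => /andP[h1 _]; rewrite /bd le_max; apply/orP; left.
  have : 0 <= e * s' by rewrite mulr_ge0 ?(ltW e0) // (le_trans s0) // ltW.
  lra.
- move=> s /andP[s0 sd] Ps.
  have sn : s - s * n.+1%:R^-1 @[n --> \oo] --> s.
    rewrite (_ : nbhs s = nbhs (s - s * 0)); last by rewrite mulr0 subr0.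
    apply: cvgB; first exact: cvg_cst.
    by apply: cvgMl_tmp; exact: cvg_natSinv.
  apply: ler_cvg_to (continuous_cvg _ (Ic s) sn) (continuous_cvg _ (bdc s) sn) _.
  apply: nearW => n; apply: Ps; rewrite subr_ge0 ler_piMr ?(ltW s0) // ?invf_le1 ?ler1n //.
  by rewrite gtrBl mulr_gt0.
Qed.

End Gradient.

(** * Sequential compactness and the tau-norm *)

Section SequentialCompactness.
Variables (R : realType) (T : eqType) (dist : T -> T -> R).
Hypothesis dist_sym : forall x y, dist x y = dist y x.
Hypothesis dist_tri : forall x y z, dist x z <= dist x y + dist y z.
Variable A : set T.

Definition seq_compact := forall u : nat -> T, (forall n, A (u n)) ->
  exists2 phi : nat -> nat, phi @ \oo --> \oo &
    exists2 x, A x & dist (u (phi n)) x @[n --> \oo] --> 0.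

Lemma cvg0_lt (u : nat -> R) e : u n @[n --> \oo] --> 0 -> 0 < e ->
  exists N, forall n, (N <= n)%N -> u n < e.
Proof.
move=> /cvgr0Pnorm_lt/(_ e) H /H[N _ NP]; exists N => n /NP /=.
exact: le_lt_trans (ler_norm _).
Qed.

(** Turns sequential continuity, the form in which the maps below are handled, into a radius. *)
Lemma sequential_nbhs x (Q : T -> Prop) :
  (forall u : nat -> T, (forall n, A (u n)) ->
     (forall n, dist (u n) x < n.+1%:R^-1) -> exists n, Q (u n)) ->
  exists2 k, 0 < k & forall y, A y -> dist y x < k -> Q y.
Proof.
move=> H; apply: contrapT => nex.
have /choice[u uP] : forall n : nat, exists y, [/\ A y, dist y x < n.+1%:R^-1 & ~ Q y].
  move=> n; apply: contrapT => nex'; apply: nex.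
  exists n.+1%:R^-1; first by rewrite invr_gt0.
  by move=> y Ay yx; apply: contrapT => nQ; apply: nex'; exists y.
have [n Qn] := H u (fun n => let: And3 h _ _ := uP n in h)
  (fun n => let: And3 _ h _ := uP n in h).
by case: (uP n).
Qed.

Hypothesis A_compact : seq_compact.

Lemma lebesgue_number (del : T -> R) : (forall x, A x -> 0 < del x) ->
  exists2 eta, 0 < eta & forall y, A y -> exists2 x, A x &
    forall z, A z -> dist z y < eta -> dist z x < del x.
Proof.
move=> del0; apply: contrapT => nex.
have /choice[y yP] : forall n : nat, exists y, A y /\ forall x, A x -> exists z,
    [/\ A z, dist z y < n.+1%:R^-1 & del x <= dist z x].
  move=> n; apply: contrapT => nex'; apply: nex.
  exists n.+1%:R^-1; first by rewrite invr_gt0.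
  move=> y Ay; apply: contrapT => nx; apply: nex'; exists y; split=> // x Ax.
  apply: contrapT => nz; apply: nx; exists x => // z Az zy.
  by rewrite ltNge; apply/negP => h; apply: nz; exists z.
have [phi phioo [x Ax yx]] := A_compact (fun n => (yP n).1).
have d0 := del0 x Ax; have d2 : 0 < del x / 2 by rewrite divr_gt0.
have [N1 N1P] := cvg0_lt yx d2.
have [N2 N2P] := cvg0_lt (cvg_sub phioo (@cvg_natSinv R)) d2.
pose n := maxn N1 N2.
have [z [Az zy]] := (yP (phi n)).2 x Ax; rewrite leNgt => /negP; apply.
apply: le_lt_trans (dist_tri _ (y (phi n)) _) _.
rewrite [ltRHS]splitr ltrD // ?N1P ?leq_maxl //.
by apply: lt_trans zy _; apply: N2P; exact: leq_maxr.
Qed.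

Lemma totally_bounded (eta : R) : 0 < eta ->
  exists s : seq T, {in s, forall x, A x} /\
    forall y, A y -> exists2 x, x \in s & dist y x < eta.
Proof.
move=> eta0; apply: contrapT => nex.
have /choice[F FP] : forall s : seq T, exists y, {in s, forall x, A x} ->
    A y /\ {in s, forall x, eta <= dist y x}.
  move=> s; apply: contrapT => nex'; apply: nex; exists s.
  have sA : {in s, forall x, A x}.
    move=> x xs; apply: contrapT => nAx; apply: nex'; exists x => sA.
    by case: nAx; exact: sA.
  split=> // y Ay; apply: contrapT => nx; apply: nex'; exists y => _; split=> // x xs.
  by rewrite leNgt; apply/negP => h; apply: nx; exists x.
(* Greedy choice: each new point keeps the distance [eta] from all earlier ones, which rules out a
   convergent subsequence. *)
pose l := fix l n := if n is m.+1 then F (l m) :: l m else [::].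
have lA n : {in l n, forall x, A x}.
  elim: n => //= n IH x; rewrite inE => /orP[/eqP->|]; last exact: IH.
  by case: (FP _ IH).
have lin m n : (m < n)%N -> F (l m) \in l n.
  elim: n => // n IH; rewrite ltnS leq_eqVlt => /orP[/eqP->|/IH h] /=.
    by rewrite mem_head.
  by rewrite inE h orbT.
have [phi phioo [x Ax cx]] := A_compact (fun n => (FP _ (lA n)).1).
have e2 : 0 < eta / 2 by rewrite divr_gt0.
have [N NP] := cvg0_lt cx e2.
have [N' _ N'P] : \forall n \near \oo, (phi N < phi n)%N.
  by apply: (phioo [set m | (phi N < m)%N]); exists (phi N).+1.
pose n := maxn N N'.
have lt : (phi N < phi n)%N by apply: N'P; rewrite /= leq_maxr.
have := (FP _ (lA (phi n))).2 _ (lin _ _ lt); rewrite leNgt => /negP; apply.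
apply: le_lt_trans (dist_tri _ x _) _.
by rewrite [ltRHS]splitr ltrD // ?NP ?leq_maxl // dist_sym NP.
Qed.

(** Each point of a finite [eta]-net, with [eta] a Lebesgue number, is replaced by a centre whose
    ball contains its [eta]-ball. *)
Lemma finite_cover (del : T -> R) : (forall x, A x -> 0 < del x) ->
  exists s : seq T, {in s, forall x, A x} /\
    forall y, A y -> exists2 x, x \in s & dist y x < del x.
Proof.
move=> /lebesgue_number[eta eta0 H].
have /choice[f fP] : forall y, exists x, A y -> A x /\
    forall z, A z -> dist z y < eta -> dist z x < del x.
  move=> y; have [Ay|nAy] := pselect (A y); last by exists y.
  by have [x Ax xP] := H y Ay; exists x.
have [s [sA sP]] := totally_bounded eta0.
exists (map f s); split=> [_ /mapP[y /sA Ay ->]|z Az]; first by case: (fP y Ay).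
have [y ys zy] := sP z Az; exists (f y); first exact: map_f.
by case: (fP y (sA y ys)) => _; exact.
Qed.

End SequentialCompactness.

(** * Orthogonal projections and the tau-norm *)

Section TauNorm.
Variables (R : realType) (X : completeNormedModType R).
Variable ip : {dot X for idfun}.
Hypothesis ip_norm : induces_norm ip.
Variables (Y : set X) (K : set nat) (e : nat -> X).
Hypothesis Y_sub : closed_subspace Y.
Hypothesis eY : forall k, K k -> Y (e k).
Hypothesis e1 : forall k, K k -> ip (e k) (e k) = 1.

Let sY : subspace Y := closed_subspaceP Y_sub.
Local Notation P := (orthogonal_projection ip Y).
Local Notation Z := (orthogonal_complement ip Y).
Local Notation N := (tau_norm ip Y K e).

Lemma orthogonal_projectionP u : Y (P u) /\ Z (u - P u).
Proof.
have [y Yy yP] := projection_exists ip_norm u sY Y_sub.2.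
by rewrite /orthogonal_projection; case: xgetP => [x _//|/(_ y)[]]; split.
Qed.

Lemma orthogonal_projection_unique u y : Y y -> Z (u - y) -> P u = y.
Proof.
move=> Yy Zy; have [YP ZP] := orthogonal_projectionP u.
have Yd : Y (y - P u) by exact: (subspaceB sY).
apply/esym/eqP; rewrite -subr_eq0 -normr_eq0 -sqrf_eq0 -(ip_normsq ip_norm).
rewrite {1}(_ : y - P u = (u - P u) - (u - y)); last by rewrite opprB [RHS]addrC addrA subrK.
by rewrite ipDl ipNl ZP // Zy // subrr.
Qed.

Lemma orthogonal_projection_complement u :
  orthogonal_projection ip Z u = u - P u.
Proof.
have [YP ZP] := orthogonal_projectionP u.
rewrite {1}/orthogonal_projection; case: xgetP => [x _ [Zx ZZx]|/(_ (u - P u))[]]; last first.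
  by split=> // v Zv; rewrite opprB addrC subrK ipC Zv.
have Zd : Z (x - (u - P u)).
  by move=> y Yy; rewrite ipDl ipNl Zx // ZP // subrr.
apply/eqP; rewrite -subr_eq0 -normr_eq0 -sqrf_eq0 -(ip_normsq ip_norm).
rewrite {1}(_ : x - _ = P u - (u - x)); last by rewrite !opprB addrCA.
by rewrite ipDl ipNl ZZx // subr0 ipC Zd.
Qed.

Lemma orthogonal_projectionD u v : P (u + v) = P u + P v.
Proof.
have [Yu Zu] := orthogonal_projectionP u; have [Yv Zv] := orthogonal_projectionP v.
apply: orthogonal_projection_unique; first exact: (subspaceD sY).
by move=> y Yy; rewrite opprD addrACA ipDl Zu // Zv // addr0.
Qed.

Lemma orthogonal_projectionN u : P (- u) = - P u.
Proof.
have [Yu Zu] := orthogonal_projectionP u.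
apply: orthogonal_projection_unique.
  by rewrite -scaleN1r; exact: (subspaceZ _ sY).
by move=> y Yy; rewrite -opprD ipNl Zu // oppr0.
Qed.

Lemma orthogonal_projection_id y : Y y -> P y = y.
Proof.
by move=> Yy; apply: orthogonal_projection_unique => // w _; rewrite subrr ip0l.
Qed.

Lemma orthogonal_projection_pythagoras u :
  `|u| ^+ 2 = `|P u| ^+ 2 + `|u - P u| ^+ 2.
Proof.
have [YP ZP] := orthogonal_projectionP u.
rewrite -{1}(subrK (P u) u) (normsqD ip_norm) ZP // mulr0 addr0 addrC //.
Qed.

Lemma orthogonal_projection_le u : `|P u| <= `|u|.
Proof.
rewrite -(ler_pXn2r (_ : 0 < 2)%N) // ?nnegrE // [leRHS]orthogonal_projection_pythagoras.
by rewrite lerDl sqr_ge0.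
Qed.

Lemma orthogonal_projection_compl_le u : `|u - P u| <= `|u|.
Proof.
rewrite -(ler_pXn2r (_ : 0 < 2)%N) // ?nnegrE // [leRHS]orthogonal_projection_pythagoras.
by rewrite lerDr sqr_ge0.
Qed.

Lemma cvg_orthogonal_projection (u : nat -> X) u0 :
  u n @[n --> \oo] --> u0 -> P (u n) @[n --> \oo] --> P u0.
Proof.
move=> uu; apply/cvgrPdist_lt => eps eps0.
have /cvgrPdist_lt/(_ eps eps0) := uu; apply: filterS => n.
apply: le_lt_trans; rewrite -orthogonal_projectionN -orthogonal_projectionD.
exact: orthogonal_projection_le.
Qed.

Let tm k u : R := if k \in K then 2^-1 ^+ k * `|ip (P u) (e k)| else 0.

Let tm_ge0 k u : 0 <= tm k u.
Proof. by rewrite /tm; case: ifP => // _; rewrite mulr_ge0 // exprn_ge0. Qed.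

Let tmE k u : K k -> tm k u = 2^-1 ^+ k * `|ip u (e k)|.
Proof.
move=> Kk; rewrite /tm mem_set //; congr (_ * `|_|).
have [_ ZP] := orthogonal_projectionP u.
by apply/eqP; rewrite eq_sym -subr_eq0 -ipNl -ipDl ZP //; exact: eY.
Qed.

Let tm_ip k u : tm k u <= 2^-1 ^+ k * `|ip u (e k)|.
Proof.
have [Kk|nKk] := pselect (K k); first by rewrite tmE.
by rewrite /tm memNset // mulr_ge0 // exprn_ge0.
Qed.

Let tm_le k u : tm k u <= 2^-1 ^+ k * `|u|.
Proof.
have [Kk|nKk] := pselect (K k); last by rewrite /tm memNset // mulr_ge0 // exprn_ge0.
rewrite tmE // ler_wpM2l ?exprn_ge0 //.
apply: le_trans (cauchy_schwarz ip_norm _ _) _.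
by rewrite (_ : `|e k| = 1) ?mulr1 // ip_norm e1 // sqrtr1.
Qed.

Let tmD k u v : tm k (u + v) <= tm k u + tm k v.
Proof.
have [Kk|nKk] := pselect (K k); last by rewrite /tm memNset // addr0.
by rewrite !tmE // -mulrDr ler_wpM2l ?exprn_ge0 // ipDl ler_normD.
Qed.

Let S n u : R := \sum_(0 <= k < n) tm k u.

Let geom n : \sum_(0 <= k < n) (2^-1 : R) ^+ k = 2 - 2 * 2^-1 ^+ n.
Proof.
elim: n => [|n IH]; first by rewrite big_geq // expr0 mulr1 subrr.
by rewrite big_nat_recr //= IH exprS; field.
Qed.

Let S_le n u : S n u <= 2 * `|u|.
Proof.
apply: (@le_trans _ _ (\sum_(0 <= k < n) 2^-1 ^+ k * `|u|)).
  by apply: ler_sum => k _; exact: tm_le.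
rewrite -mulr_suml geom ler_wpM2r // gerBl mulr_ge0 // exprn_ge0 //.
Qed.

Let S_nd u : {homo S^~ u : m n / (m <= n)%N >-> m <= n}.
Proof.
move=> m n mn; rewrite /S (big_cat_nat (leq0n _) mn) //= lerDl.
by apply: sumr_ge0 => k _; exact: tm_ge0.
Qed.

Let S_cvg u : cvgn (S^~ u).
Proof.
apply: nondecreasing_is_cvgn; first exact: S_nd.
by exists (2 * `|u|) => _ [n _ <-]; exact: S_le.
Qed.

Lemma tau_normE u : N u = Num.max `|u - P u| (limn (S^~ u)).
Proof.
rewrite /tau_norm orthogonal_projection_complement; congr (Num.max _ (limn _)).
by apply/funext => n; rewrite /S big_mkcond.
Qed.

Lemma tau_norm_ge0 u : 0 <= N u.
Proof. by rewrite tau_normE le_max normr_ge0. Qed.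

Lemma tau_norm_le u : N u <= 2 * `|u|.
Proof.
rewrite tau_normE ge_max; apply/andP; split.
  apply: le_trans (orthogonal_projection_compl_le u) _.
  by rewrite ler_peMl // ler1n.
by apply: (cvg_seq_le (@S_cvg u)) => n; exact: S_le.
Qed.

Lemma tau_normD u v : N (u + v) <= N u + N v.
Proof.
rewrite 3!tau_normE ge_max; apply/andP; split.
  rewrite orthogonal_projectionD opprD addrACA; apply: le_trans (ler_normD _ _) _.
  by rewrite lerD // le_max lexx.
apply: (@le_trans _ _ (limn (S^~ u) + limn (S^~ v))).
  apply: (ler_cvg_to (@S_cvg (u + v)) (cvgD (@S_cvg u) (@S_cvg v))).
  apply: nearW => n; rewrite -[leRHS]/(S n u + S n v) /S -big_split /=.
  by apply: ler_sum => k _; exact: tmD.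
by rewrite lerD // le_max lexx orbT.
Qed.

Lemma tau_normN u : N (- u) = N u.
Proof.
rewrite 2!tau_normE orthogonal_projectionN -opprD normrN; congr (Num.max _ (limn _)).
apply/funext => n; apply: eq_bigr => k _; rewrite /tm; case: ifP => // _.
by rewrite orthogonal_projectionN ipNl normrN.
Qed.

(** The first [m] terms of the series tend to 0 by weak convergence, and the tail is uniformly small
    because the sequence is bounded. *)
Lemma tau_norm_cvg0 (u : nat -> X) B : weak_cvg ip u 0 -> (forall n, `|u n| <= B) ->
  u n - P (u n) @[n --> \oo] --> 0 -> N (u n) @[n --> \oo] --> 0.
Proof.
move=> u0 uB uP; have B0 : 0 <= B := le_trans (normr_ge0 _) (uB 0%N).
apply/cvgr0Pnorm_le => eps eps0.
have [m mP] : exists m, 2 * 2^-1 ^+ m * B < eps / 2.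
  have : 2 * 2^-1 ^+ n * B @[n --> \oo] --> 2 * 0 * B.
    apply: cvgMr_tmp; apply: cvgMl_tmp; apply: cvg_expr.
    by rewrite ger0_norm ?invr_ge0 // invf_lt1 ?ltr1n.
  rewrite mulr0 mul0r => h.
  have [m mP] := cvg0_lt h (divr_gt0 eps0 (ltr0n R 2)).
  by exists m; exact: mP.
have Sm : \sum_(0 <= k < m) 2^-1 ^+ k * `|ip (u n) (e k)| @[n --> \oo] --> 0.
  rewrite (_ : nbhs 0 = nbhs (\sum_(0 <= k < m) 2^-1 ^+ k * `|ip 0 (e k)|)).
    by apply: cvg_fsum => k; apply: cvgMl_tmp; apply: cvg_norm; exact: u0.
  by rewrite big1 // => k _; rewrite ip0l normr0 mulr0.
have /cvgr0Pnorm_lt/(_ _ (divr_gt0 eps0 (ltr0n R 2))) := Sm.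
have /cvgr0Pnorm_lt/(_ _ eps0) := uP.
apply: filterS2 => n h1 h2; rewrite ger0_norm ?tau_norm_ge0 // tau_normE ge_max ltW //=.
apply: (cvg_seq_le (@S_cvg (u n))) => j.
apply: (@le_trans _ _ (S (maxn m j) (u n))); first by apply: S_nd; exact: leq_maxr.
rewrite /S (big_cat_nat (leq0n _) (leq_maxl m j)) //= [leRHS]splitr lerD //.
  apply: le_trans (ltW h2); apply: le_trans (ler_norm _).
  by apply: ler_sum => k _; exact: tm_ip.
apply: le_trans (ltW mP).
apply: (@le_trans _ _ (\sum_(m <= k < maxn m j) 2^-1 ^+ k * B)).
  by apply: ler_sum => k _; apply: le_trans (tm_le _ _) _; rewrite ler_wpM2l // exprn_ge0.
rewrite -mulr_suml ler_wpM2r //.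
have := geom (maxn m j); rewrite (big_cat_nat (leq0n _) (leq_maxl m j)) //= geom.
have : 0 <= (2^-1 : R) ^+ maxn m j by rewrite exprn_ge0.
lra.
Qed.

Lemma norm_topology_cvg (u : nat -> X) u0 : N (u n - u0) @[n --> \oo] --> 0 ->
  (u : nat -> norm_topology N) @ \oo --> (u0 : norm_topology N).
Proof.
move=> uu A; rewrite nbhsE => -[B [oB Bu0] BA].
have [eps eps0 H] := oB u0 Bu0.
by have [n nP] := cvg0_lt uu eps0; exists n => // m /= /nP h; apply: BA; exact: H.
Qed.

Lemma norm_topology_usc (I : X -> R) v be :
  upper_semicontinuous (fun u : norm_topology N => (I u)%:E) -> I v < be ->
  exists2 del, 0 < del & forall w, N (w - v) < del -> I w < be.
Proof.
move=> usc Iv; have [|A Av AP] := usc (v : norm_topology N) (- be).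
  by rewrite lte_fin ltrN2.
move: Av; rewrite nbhsE => -[B [oB Bv] BA].
have [eps eps0 H] := oB v Bv; exists eps => // w /H/BA/AP.
by rewrite lte_fin ltrN2.
Qed.

End TauNorm.

(** * Linking *)

Section VariationalInequality.
Variables (R : realType) (X : completeNormedModType R).
Variable ip : {dot X for idfun}.
Hypothesis ip_norm : induces_norm ip.

(** Brouwer's theorem is applied to Nash's map, which raises the weight of each vertex [w j] by the
    violation [a s j] of its inequality and renormalises. At a fixed point with some violation, the
    weights sit exactly on the violating vertices; but the weighted sum of the [g s j] is 0, since
    [U s] is the barycentre. So nothing is violated. *)
Lemma finite_variational_inequality (A : set X) (G : X -> X) n (w : 'I_n.+1 -> X) :
  (forall s : 'I_n.+1 -> R, simplex s -> A (\sum_i s i *: w i)) ->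
  (forall (u : nat -> X) u0, (forall m, A (u m)) -> A u0 ->
     u m @[m --> \oo] --> u0 -> G (u m) @[m --> \oo] --> G u0) ->
  exists2 u, A u & forall j, 0 <= ip (u - G u) (w j - u).
Proof.
move=> Aw Gc; pose U (s : 'I_n.+1 -> R) := \sum_i s i *: w i.
pose g s j := ip (U s - G (U s)) (w j - U s).
pose a s j := Num.max 0 (- g s j).
have a0 s j : 0 <= a s j by rewrite le_max lexx.
have D0 s : 0 < 1 + \sum_k a s k by rewrite ltr_wpDr // sumr_ge0.
pose F s j := (s j + a s j) / (1 + \sum_k a s k).
have [||s sS Fs] := @brouwer_simplex R n F.
- move=> s [s0 s1]; split=> [j|]; first by apply: divr_ge0; [exact: addr_ge0 | exact: ltW].
  by rewrite -mulr_suml big_split /= s1 divff // gt_eqF.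
- move=> s_ s sS_ sS ss.
  have Uc : U (s_ m) @[m --> \oo] --> U s.
    by apply: cvg_fsum => i; apply: cvgZr_tmp; exact: ss.
  have gc j : g (s_ m) j @[m --> \oo] --> g s j.
    apply: (cvg_ip ip_norm); apply: cvgB => //; last exact: cvg_cst.
    by apply: Gc => // [m|]; apply: Aw.
  have ac j : a (s_ m) j @[m --> \oo] --> a s j.
    apply: (@continuous_cvg _ _ _ _ _ _ (fun x : R => Num.max 0 (- x))) (gc j).
    by apply: continuous_max; [exact: cvg_cst|apply: cvgN; exact: cvg_id].
  move=> i; apply: cvgM; first by apply: cvgD.
  apply: cvgV; first by rewrite gt_eqF.
  by apply: cvgD; [exact: cvg_cst|apply: cvg_fsum].
exists (U s); first exact: Aw.
have [s0 s1] := sS.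
have sE j : s j * (\sum_k a s k) = a s j.
  have := Fs j; rewrite /F => /(congr1 (fun x => x * (1 + \sum_k a s k))).
  by rewrite divfK ?gt_eqF // mulrDr mulr1 => /addrI.
have sg : \sum_j s j * g s j = 0.
  have -> : \sum_j s j * g s j = ip (U s - G (U s)) (\sum_j s j *: (w j - U s)).
    by rewrite ipC ip_suml; apply: eq_bigr => j _; rewrite ipZl ipC.
  under eq_bigr do rewrite scalerBr.
  by rewrite sumrB -scaler_suml s1 scale1r subrr ip0r.
have [S0|S0] := eqVneq (\sum_k a s k) 0.
  move=> j; have : a s j = 0.
    by apply/eqP; rewrite -sE S0 mulr0.
  by rewrite /a; case: (lerP 0 (- g s j)) => [h /eqP|]; rewrite /= -?/(g s j); lra.
have {}S0 : 0 < \sum_k a s k by rewrite lt_neqAle eq_sym S0 sumr_ge0.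
have sg_le j : s j * g s j <= 0.
  have [//|h] := lerP (s j * g s j) 0.
  have sj : 0 < s j by rewrite lt_neqAle s0 andbT; apply: contraTneq h => <-; rewrite mul0r ltxx.
  have : 0 < a s j by rewrite -sE mulr_gt0.
  rewrite /a lt_max ltxx /= oppr_gt0 => gj.
  by move: h; rewrite pmulr_rgt0 // => /(lt_trans gj); rewrite ltxx.
have sg0 j : s j * g s j = 0.
  have /eqP := sg; rewrite -oppr_eq0 -sumrN psumr_eq0 => [|i _]; last by rewrite oppr_ge0.
  by move=> /allP/(_ j (mem_index_enum _)); rewrite oppr_eq0 => /eqP.
move=> j; rewrite -/(g s j) leNgt; apply/negP => gj.
have : 0 < a s j by rewrite /a lt_max oppr_gt0 gj orbT.
rewrite -sE pmulr_lgt0 // => sj.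
by have /eqP := sg0 j; rewrite mulf_eq0 (gt_eqF sj) (lt_eqF gj).
Qed.

End VariationalInequality.

(** * Geometry and compactness of the linking set *)

Section LinkingSetGeometry.
Variables (R : realType) (X : completeNormedModType R).
Variable ip : {dot X for idfun}.
Hypothesis ip_norm : induces_norm ip.
Variables (Y : set X) (K : set nat) (e : nat -> X).
Hypothesis Y_sub : closed_subspace Y.
Hypothesis eY : forall k, K k -> Y (e k).
Hypothesis e1 : forall k, K k -> ip (e k) (e k) = 1.
Variables (z : X) (rho : R).
Hypothesis zZ : orthogonal_complement ip Y z.
Hypothesis z1 : `|z| = 1.

Let sY : subspace Y := closed_subspaceP Y_sub.
Local Notation P := (orthogonal_projection ip Y).
Local Notation Z := (orthogonal_complement ip Y).
Local Notation N := (tau_norm ip Y K e).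
Local Notation M := (linking_M Y z rho).
Local Notation M0 := (linking_M0 Y z rho).

(** The span of [Y] and [z], encoded through the only possible coefficient of [z]. *)
Definition ray_span u := Y (u - ip u z *: z).

Lemma ip_zz : ip z z = 1.
Proof. by rewrite (ip_normsq ip_norm) z1 expr1n. Qed.

Lemma ip_Yz y : Y y -> ip y z = 0.
Proof. by move=> Yy; rewrite ipC zZ. Qed.

Lemma ray_spanE y lam : Y y -> ip (y + lam *: z) z = lam.
Proof. by move=> Yy; rewrite ipDl ip_Yz // ipZl ip_zz add0r mulr1. Qed.

Lemma ray_span_Y y : Y y -> ray_span y.
Proof. by move=> Yy; rewrite /ray_span ip_Yz // scale0r subr0. Qed.

Lemma ray_span_z : ray_span z.
Proof. by rewrite /ray_span ip_zz scale1r subrr; case: sY. Qed.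

Lemma ray_span_lin k u v : ray_span u -> ray_span v -> ray_span (k *: u + v).
Proof.
rewrite /ray_span => Yu Yv.
rewrite (_ : _ - _ = k *: (u - ip u z *: z) + (v - ip v z *: z)).
  by case: sY => _; apply.
by rewrite ipDl ipZl scalerDl scalerBr scalerA opprD addrACA.
Qed.

Lemma ray_spanD u v : ray_span u -> ray_span v -> ray_span (u + v).
Proof. by move=> hu hv; rewrite -[u]scale1r; exact: ray_span_lin. Qed.

Lemma ray_spanZ k u : ray_span u -> ray_span (k *: u).
Proof.
move=> hu; rewrite -[k *: u]addr0; apply: ray_span_lin => //.
by apply: ray_span_Y; case: sY.
Qed.

Lemma ray_spanB u v : ray_span u -> ray_span v -> ray_span (u - v).
Proof. by move=> hu hv; rewrite -scaleN1r; apply: ray_spanD => //; exact: ray_spanZ. Qed.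

Lemma linking_MP u : M u <-> [/\ `|u| <= rho, 0 <= ip u z & ray_span u].
Proof.
split=> [[y [lam [-> ur lam0 Yy]]]|[ur uz Yu]].
  by rewrite /ray_span ray_spanE // addrK.
by exists (u - ip u z *: z), (ip u z); rewrite subrK.
Qed.

Lemma linking_M0_sub u : M0 u -> 0 < rho -> M u.
Proof.
move=> [y [lam [-> Yy H]]] rho0; exists y, lam; split=> //.
  by case: H => -[h _] //; rewrite h.
by case: H => -[_] // ->.
Qed.

Lemma linking_M_boundary u : M u -> Num.min (rho - `|u|) (ip u z) <= 0 -> M0 u.
Proof.
move=> /linking_MP[ur uz Yu]; rewrite ge_min => H.
exists (u - ip u z *: z), (ip u z); rewrite subrK; split=> //.
move: H; case/orP => h; [left|right]; split=> //; apply/eqP; rewrite eq_le ?ur ?uz ?h //.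
by rewrite andTb -subr_le0.
Qed.

Lemma linking_M_projection u : M u -> u - P u = ip u z *: z.
Proof.
move=> /linking_MP[_ _ Yu]; rewrite (orthogonal_projection_unique ip_norm Y_sub Yu).
  by rewrite opprB addrC subrK.
by rewrite opprB addrC subrK => y Yy; rewrite ipZl zZ // mulr0.
Qed.

Lemma linking_M_convex (J : finType) (s : J -> R) (w : J -> X) :
  (forall j, 0 <= s j) -> \sum_j s j = 1 -> (forall j, M (w j)) ->
  M (\sum_j s j *: w j).
Proof.
move=> s0 s1 wM; have H j := (linking_MP (w j)).1 (wM j).
apply/linking_MP; split.
- apply: le_trans (ler_norm_sum _ _ _) _; rewrite -[leRHS]mul1r -s1 mulr_suml.
  by apply: ler_sum => j _; rewrite normrZ ger0_norm // ler_wpM2l //; case: (H j).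
- rewrite ip_suml; apply: sumr_ge0 => j _; rewrite ipZl mulr_ge0 //; by case: (H j).
- apply: (big_ind ray_span); first by apply: ray_span_Y; case: sY.
    by move=> x y; exact: ray_spanD.
  by move=> j _; apply: ray_spanZ; case: (H j).
Qed.

Lemma weakly_closed_subspace (u : nat -> X) u0 :
  (forall n, Y (u n)) -> weak_cvg ip u u0 -> Y u0.
Proof.
move=> uY uu; have [YP ZP] := orthogonal_projectionP ip_norm Y_sub u0.
suff : u0 - P u0 = 0 by move=> /subr0_eq ->.
apply/eqP; rewrite -normr_eq0 -sqrf_eq0 -(ip_normsq ip_norm) ipDl ipNl.
rewrite [ip (P u0) _]ipC ZP // subr0.
have h := uu (u0 - P u0).
have E n : ip (u n) (u0 - P u0) = 0 by rewrite ipC ZP.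
by rewrite eq_le (cvg_seq_le h) ?(cvg_seq_ge h) // => n; rewrite E.
Qed.

Lemma linking_M_weakly_closed (u : nat -> X) u0 :
  (forall n, M (u n)) -> weak_cvg ip u u0 -> M u0.
Proof.
move=> uM uu; have H n := (linking_MP (u n)).1 (uM n).
apply/linking_MP; split.
- by apply: (weak_cvg_norm_le ip_norm uu) => n; case: (H n).
- by apply: (cvg_seq_ge (uu z)) => n; case: (H n).
- apply: (@weakly_closed_subspace (fun n => u n - ip (u n) z *: z)).
    by move=> n; case: (H n).
  move=> v; rewrite ipDl ipNl ipZl; under eq_fun do rewrite ipDl ipNl ipZl.
  by apply: cvgB; [exact: uu|apply: cvgMr_tmp; exact: uu].
Qed.

(** On [M] the [Z]-component is [ip u z *: z], for which weak convergence is norm convergence. Weak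
    compactness thereby becomes [tau]-compactness. *)
Lemma linking_M_tau_cvg (u : nat -> X) u0 : (forall n, M (u n)) -> M u0 ->
  weak_cvg ip u u0 -> N (u n - u0) @[n --> \oo] --> 0.
Proof.
move=> uM u0M uu; have H n := (linking_MP (u n)).1 (uM n).
apply: (@tau_norm_cvg0 _ _ _ ip_norm _ _ _ Y_sub eY e1 _ (rho + rho)).
- move=> v; rewrite ip0l -(subrr (ip u0 v)); under eq_fun do rewrite ipDl ipNl.
  by apply: cvgB; [exact: uu|exact: cvg_cst].
- move=> n; apply: le_trans (ler_normB _ _) _; apply: lerD; first by case: (H n).
  by case/linking_MP: u0M.
- have E n : u n - u0 - P (u n - u0) = (ip (u n) z - ip u0 z) *: z.
    rewrite (orthogonal_projectionD ip_norm Y_sub) (orthogonal_projectionN ip_norm Y_sub).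
    by rewrite opprD addrACA -opprD !linking_M_projection // scalerBl.
  under eq_fun do rewrite E.
  rewrite (_ : nbhs 0 = nbhs ((ip u0 z - ip u0 z) *: z)); last by rewrite subrr scale0r.
  by apply: cvgZr_tmp; apply: cvgB; [exact: uu|exact: cvg_cst].
Qed.

Definition homotopy_domain : set (R * X) := [set p | 0 <= p.1 <= 1 /\ M p.2].

Definition homotopy_dist (p q : R * X) : R := Num.max `|p.1 - q.1| (N (p.2 - q.2)).

Lemma homotopy_dist_sym p q : homotopy_dist p q = homotopy_dist q p.
Proof.
by rewrite /homotopy_dist distrC -(@tau_normN _ _ _ ip_norm Y K e Y_sub) opprB.
Qed.

Lemma homotopy_dist_tri p q s :
  homotopy_dist p s <= homotopy_dist p q + homotopy_dist q s.
Proof.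
rewrite {1}/homotopy_dist ge_max; apply/andP; split.
  apply: le_trans (ler_distD q.1 _ _) _.
  by rewrite lerD // /homotopy_dist le_max lexx.
rewrite -(subrK q.2 p.2) -addrA; apply: le_trans (tau_normD ip_norm Y_sub eY e1 _ _) _.
by rewrite lerD // /homotopy_dist le_max lexx orbT.
Qed.

Lemma homotopy_dist_cvg0 (p : nat -> R * X) q :
  (p n).1 @[n --> \oo] --> q.1 -> N ((p n).2 - q.2) @[n --> \oo] --> 0 ->
  homotopy_dist (p n) q @[n --> \oo] --> 0.
Proof.
move=> p1 p2; apply/cvgr0Pnorm_lt => eps eps0.
have /cvgr0Pnorm_lt/(_ _ eps0) := p2; have /cvgrPdist_lt/(_ _ eps0) := p1.
apply: filterS2 => n h1 h2; rewrite ger0_norm ?le_max ?normr_ge0 // gt_max distrC h1 /=.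
exact: le_lt_trans (ler_norm _) h2.
Qed.

Lemma homotopy_subsequence (t : nat -> R) (u : nat -> X) :
  (forall n, 0 <= t n <= 1) -> (forall n, M (u n)) ->
  exists2 phi : nat -> nat, phi @ \oo --> \oo & exists (t0 : R) (u0 : X),
    [/\ 0 <= t0 <= 1, M u0, t (phi n) @[n --> \oo] --> t0,
        weak_cvg ip (u \o phi) u0 &
        homotopy_dist (t (phi n), u (phi n)) (t0, u0) @[n --> \oo] --> 0].
Proof.
move=> t01 uM.
have [|phi phioo [u0 uu]] := @weak_compactness _ _ _ ip_norm u rho.
  by move=> n; case/linking_MP: (uM n).
have [|psi psioo /(_ tt) tc] := @finite_subsequence R unit (fun _ => t \o phi) 1.
  by move=> _ n /=; have /andP[t0 t1] := t01 (phi n); rewrite ger0_norm.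
have u0M : M u0 by apply: linking_M_weakly_closed uu => n; exact: uM.
have uu' := weak_cvg_sub psioo uu.
exists (phi \o psi); first exact: cvg_comp psioo phioo.
exists (limn ((t \o phi) \o psi)), u0; split=> //.
- apply/andP; split.
    by apply: (cvg_seq_ge tc) => n; have /andP[] := t01 (phi (psi n)).
  by apply: (cvg_seq_le tc) => n; have /andP[] := t01 (phi (psi n)).
- apply: homotopy_dist_cvg0 => //.
  by apply: linking_M_tau_cvg => // n; exact: uM.
Qed.

Lemma homotopy_domain_compact : seq_compact homotopy_dist homotopy_domain.
Proof.
move=> p pP.
have [||phi phioo [t0 [u0 [t01 u0M _ _ d0]]]] :=
    @homotopy_subsequence (fun n => (p n).1) (fun n => (p n).2).
- by move=> n; case: (pP n).
- by move=> n; case: (pP n).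
exists phi => //; exists (t0, u0) => //.
Qed.

(** The points [d n + |q m| z] are dense in the half-space over [Y]. Radial retraction to the ball
    brings them into [M] and moves each by at most its distance to any point of the ball. *)
Lemma linking_M_dense_sequence : 0 < rho -> separable_set Y -> exists w : nat -> X,
  (forall j, M (w j)) /\
  forall u (eps : R), M u -> 0 < eps -> exists j, `|w j - u| < eps.
Proof.
move=> rho0 [D [cD DY YD]].
have Y0 : Y 0 by case: sY.
have [d [dY dD]] : exists d : nat -> X, (forall n, Y (d n)) /\
    forall y eps, Y y -> 0 < eps -> exists n, `|d n - y| < eps.
  have /pcard_surjP[f fD] := cD.
  exists (fun n => if `[< Y (f n) >] then f n else 0); split=> [n|y eps Yy eps0].
    by case: asboolP.
  have [x [Dx]] := YD y Yy _ (nbhsx_ballx y _ eps0); rewrite -ball_normE /= => yx.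
  have [n _ fn] := fD x Dx; exists n; rewrite fn; case: asboolP => [_|[]]; last exact: DY.
  by rewrite distrC.
pose q n : R := ratr (odflt 0 (@unpickle rat n)).
pose x i := let k := odflt (0%N, 0%N) (@unpickle (nat * nat)%type i) in
  d k.1 + `|q k.2| *: z.
pose w i := Num.min 1 (rho / `|x i|) *: x i.
have xR i : ray_span (x i).
  by apply: ray_spanD; [exact: ray_span_Y|apply: ray_spanZ; exact: ray_span_z].
have c0 i : 0 <= Num.min 1 (rho / `|x i|).
  by rewrite le_min ler01 divr_ge0 // ltW.
exists w; split=> [i|u eps uM eps0].
  apply/linking_MP; split.
  - rewrite normrZ ger0_norm //; have [->|x0] := eqVneq (x i) 0.
      by rewrite normr0 mulr0 ltW.
    by rewrite -ler_pdivlMr ?normr_gt0 // ge_min lexx orbT.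
  - by rewrite ipZl mulr_ge0 // /x ray_spanE.
  - exact: ray_spanZ.
have [ur uz uR] := (linking_MP u).1 uM.
have e4 : 0 < eps / 4 by rewrite divr_gt0.
have [n dn] := dD (u - ip u z *: z) _ uR e4.
have [m qm] : exists m, `| `|q m| - ip u z| < eps / 4.
  have lt : ip u z < ip u z + eps / 4 by rewrite ltrDl.
  have [a] := rat_in_itvoo lt; rewrite in_itv /= => /andP[a1 a2].
  have a0 : 0 <= ratr a :> R by rewrite (le_trans uz) // ltW.
  exists (pickle a); rewrite /q pickleK /= (ger0_norm a0).
  by rewrite ger0_norm ?subr_ge0 ?(ltW a1) // ltrBlDl.
exists (pickle (n, m)); set i := pickle _.
have xu : `|x i - u| < eps / 2.
  rewrite /x /i pickleK /=.
  have E (p1 p2 p3 p4 : X) : p1 + p2 - p3 = (p1 - (p3 - p4)) + (p2 - p4).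
    by rewrite opprD opprK !addrA (addrAC _ p4) addrK addrAC.
  rewrite (E _ _ _ (ip u z *: z)) -scalerBl.
  apply: le_lt_trans (ler_normD _ _) _; rewrite normrZ z1 mulr1; lra.
suff wx : `|w i - x i| <= `|x i - u|.
  by apply: le_lt_trans (ler_distD (x i) _ _) _; lra.
have [h|h] := lerP `|x i| rho.
  rewrite /w; have [->|x0] := eqVneq (x i) 0; first by rewrite scaler0 subrr normr0.
  by rewrite (min_idPl _) ?scale1r ?subrr ?normr0 // ler_pdivlMr ?normr_gt0 // mul1r.
have x0 : 0 < `|x i| by exact: lt_trans h.
have le1 : rho / `|x i| <= 1 by rewrite ler_pdivrMr // mul1r ltW.
rewrite /w (min_idPr le1) -[X in _ - X]scale1r -scalerBl normrZ ler0_norm ?subr_le0 //.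
rewrite opprB mulrBl mul1r divfK ?gt_eqF //.
apply: le_trans (lerB_dist _ _).
by rewrite lerB.
Qed.

End LinkingSetGeometry.

(** * A fixed point of the linking homotopy *)

Section Linking.
Variables (R : realType) (X : completeNormedModType R).
Variable ip : {dot X for idfun}.
Hypothesis ip_norm : induces_norm ip.
Variables (Y : set X) (K : set nat) (e : nat -> X).
Hypothesis Y_sub : closed_subspace Y.
Hypothesis Y_sep : separable_set Y.
Hypothesis eY : forall k, K k -> Y (e k).
Hypothesis e1 : forall k, K k -> ip (e k) (e k) = 1.
Variables (z : X) (rho r : R).
Hypothesis zZ : orthogonal_complement ip Y z.
Hypothesis z1 : `|z| = 1.
Hypothesis r0 : 0 < r.
Hypothesis r_rho : r < rho.

Let sY : subspace Y := closed_subspaceP Y_sub.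
Local Notation P := (orthogonal_projection ip Y).
Local Notation Z := (orthogonal_complement ip Y).
Local Notation N := (tau_norm ip Y K e).
Local Notation M := (linking_M Y z rho).
Local Notation M0 := (linking_M0 Y z rho).
Local Notation dom := (homotopy_domain Y z rho).
Local Notation dist := (homotopy_dist ip Y K e).
Local Notation E := (ray_span ip Y z).

Let rho0 : 0 < rho := lt_trans r0 r_rho.

Definition tau_continuous (f : R * X -> X) :=
  forall (p : nat -> R * X) q, (forall n, dom (p n)) -> dom q ->
    dist (p n) q @[n --> \oo] --> 0 -> f (p n) @[n --> \oo] --> f q.

Variable f : R * X -> X.
Hypothesis f_cont : tau_continuous f.
Hypothesis f0 : forall u, M u -> f (0, u) = 0.
Hypothesis f_bd : forall (t : R) u, 0 <= t <= 1 -> M0 u ->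
  ~ (Z (u + f (t, u)) /\ `|u + f (t, u)| = r).

(* For [u] in [M], [u - linking_map (t, u)] is
   [P_Y h + (|P_Z h| - r) z] with [h = u + f (t, u)]. *)
Definition linking_map (p : R * X) : X :=
  r *: z - P (f p) - (`|ip p.2 z *: z + (f p - P (f p))| - ip p.2 z) *: z.

Lemma linking_map_span p : E (linking_map p).
Proof.
have Ez : E z by exact: (ray_span_z ip_norm Y_sub).
have EP : E (P (f p)).
  by apply: (ray_span_Y zZ); case: (orthogonal_projectionP ip_norm Y_sub (f p)).
by apply: ray_spanB => //; [apply: ray_spanB => //|]; exact: ray_spanZ.
Qed.

Lemma linking_map0 u : M u -> linking_map (0, u) = r *: z.
Proof.
move=> uM; rewrite /linking_map /= f0 //.
have -> : P 0 = 0 by apply: (orthogonal_projection_id ip_norm Y_sub); case: sY.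
have [_ uz _] := (linking_MP ip_norm rho zZ z1 u).1 uM.
by rewrite !subr0 addr0 normrZ z1 mulr1 ger0_norm // subrr scale0r subr0.
Qed.

(** At a fixed point the [Y]-part of [u + h] is a multiple of [z], hence 0, and the vanishing
    coefficient says that the [Z]-part has norm [r]. *)
Lemma linking_map_fixed t u : M u -> u = linking_map (t, u) ->
  Z (u + f (t, u)) /\ `|u + f (t, u)| = r.
Proof.
move=> uM; have uP := linking_M_projection ip_norm Y_sub zZ z1 uM.
set h := f (t, u) => uE.
have [YP ZP] := orthogonal_projectionP ip_norm Y_sub (u + h).
have hE : ip u z *: z + (h - P h) = u + h - P (u + h).
  by rewrite (orthogonal_projectionD ip_norm Y_sub) -uP opprD addrACA.
have uE' : u = (r - `|u + h - P (u + h)| + ip u z) *: z - P h.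
  have key (a b c : R) (v : X) : a *: z - v - (b - c) *: z = (a - b + c) *: z - v.
    by rewrite addrAC -scalerBl; congr (_ *: _ - _); ring.
  by rewrite -key -hE; exact: uE.
have Pu : P (u + h) = (r - `|u + h - P (u + h)|) *: z.
  have Pu : P u = u - ip u z *: z by rewrite -uP opprB addrC subrK.
  rewrite {1}(orthogonal_projectionD ip_norm Y_sub) {1}Pu {1}uE' scalerDl.
  by rewrite addrAC subrK addrK.
have k0 : r - `|u + h - P (u + h)| = 0.
  have := zZ YP; rewrite {1}Pu ipZr (ip_zz ip_norm z1) mulr1 //.
move: ZP Pu; rewrite k0 scale0r => + Pu; rewrite Pu subr0 => Zu; split=> //.
by move: k0; rewrite Pu subr0 => /eqP; rewrite subr_eq0 => /eqP.
Qed.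

Lemma cvg_linking_map (p : nat -> R * X) q :
  (forall n, dom (p n)) -> dom q -> dist (p n) q @[n --> \oo] --> 0 ->
  ip (p n).2 z @[n --> \oo] --> ip q.2 z ->
  linking_map (p n) @[n --> \oo] --> linking_map q.
Proof.
move=> pd qd pq pz; have fp := f_cont pd qd pq.
have Pf := cvg_orthogonal_projection ip_norm Y_sub fp.
apply: cvgB; first by apply: cvgB => //; exact: cvg_cst.
apply: cvgZr_tmp; apply: cvgB => //; apply: cvg_norm.
by apply: cvgD; [exact: cvgZr_tmp|exact: cvgB].
Qed.

Let mg u := Num.min (rho - `|u|) (ip u z).

Let mg_ge0 u : M u -> 0 <= mg u.
Proof.
by move=> /(linking_MP ip_norm rho zZ z1)[h1 h2 _]; rewrite le_min h2 subr_ge0 h1.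
Qed.

Let cvg_mg (u : nat -> X) u0 : u n @[n --> \oo] --> u0 -> mg (u n) @[n --> \oo] --> mg u0.
Proof.
move=> uu.
have mE v : mg v = ((rho - `|v|) + ip v z - `|(rho - `|v|) - ip v z|) / 2.
  rewrite /mg; case: lerP => h; rewrite ?(ler0_norm, gtr0_norm) ?subr_le0 ?subr_gt0 //; lra.
have h1 : rho - `|u n| @[n --> \oo] --> rho - `|u0|.
  by apply: cvgB; [exact: cvg_cst|exact: cvg_norm].
have h2 : ip (u n) z @[n --> \oo] --> ip u0 z by exact: cvg_weak.
rewrite mE; under eq_fun do rewrite mE.
apply: cvgMr_tmp; apply: cvgB; first exact: cvgD.
by apply: cvg_norm; exact: cvgB.
Qed.

(* The boundary of [M] is closed for the norm but not for [tau]; it is the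
   compactness of [linking_map] that makes sequences of fixed points converge
   for the norm. *)
Let margin : exists2 eta : R, 0 < eta & forall (t : R) u, 0 <= t <= 1 -> M u ->
  u = linking_map (t, u) -> eta <= mg u.
Proof.
apply: contrapT => nex.
have /choice[p pP] : forall n : nat, exists p : R * X,
    [/\ 0 <= p.1 <= 1, M p.2, p.2 = linking_map p & mg p.2 < n.+1%:R^-1].
  move=> n; apply: contrapT => np; apply: nex; exists n.+1%:R^-1; first by rewrite invr_gt0.
  move=> t u t01 uM uE; rewrite leNgt; apply/negP => h; apply: np; by exists (t, u).
have [||phi phioo [t [u [t01 uM _ uu d0]]]] :=
    homotopy_subsequence ip_norm Y_sub eY e1 (rho := rho) zZ z1
      (t := fun n => (p n).1) (u := fun n => (p n).2).
- by move=> n; case: (pP n).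
- by move=> n; case: (pP n).
have d0' : dist (p (phi n)) (t, u) @[n --> \oo] --> 0.
  by under eq_fun do rewrite [p _]surjective_pairing.
have Tc : linking_map (p (phi n)) @[n --> \oo] --> linking_map (t, u).
  apply: cvg_linking_map => //.
  by move=> n; case: (pP (phi n)) => h1 h2 _ _; split.
have uc : (p (phi n)).2 @[n --> \oo] --> linking_map (t, u).
  by apply: cvg_trans Tc; apply: near_eq_cvg; apply: nearW => n; case: (pP (phi n)).
have uE : u = linking_map (t, u) := weak_cvg_unique ip_norm uu (cvg_weak ip_norm uc).
have m0 : mg u <= 0.
  rewrite uE; apply: ler_cvg_to (cvg_mg uc) (cvg_sub phioo (@cvg_natSinv R)) _.
  by apply: nearW => n; apply: ltW; case: (pP (phi n)).
apply: (f_bd t01 (linking_M_boundary ip_norm zZ z1 uM m0)).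
exact: linking_map_fixed.
Qed.

Lemma linking_approximation (theta : X -> R) (w : nat -> X) n :
  (forall u, M u -> 0 <= theta u <= 1) ->
  (forall (u : nat -> X) u0, u m @[m --> \oo] --> u0 ->
      theta (u m) @[m --> \oo] --> theta u0) ->
  (forall j, M (w j)) ->
  exists2 u, M u & forall j, (j <= n)%N ->
    0 <= ip (u - linking_map (theta u, u)) (w j - u).
Proof.
move=> th01 thc wM.
have [||u uM uj] := @finite_variational_inequality _ _ _ ip_norm M
  (fun u => linking_map (theta u, u)) n (fun j => w j).
- by move=> s [s0 s1]; apply: (linking_M_convex ip_norm Y_sub zZ z1).
- move=> u u0 uM u0M uu; have thu := thc _ _ uu.
  apply: cvg_linking_map => [m|||]; [by split=> //=; exact: th01| by split=> //=; exact: th01| |].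
    apply: homotopy_dist_cvg0 => //=.
    have h : 2 * `|u m - u0| @[m --> \oo] --> 0.
      rewrite -(mulr0 2); apply: cvgMl_tmp; apply/norm_cvg0P; rewrite -(subrr u0).
      by apply: cvgB => //; exact: cvg_cst.
    apply: (squeeze_cvgr _ (cvg_cst 0) h); apply: nearW => m.
    by rewrite tau_norm_ge0 // tau_norm_le.
  exact: cvg_weak.
by exists u => // j jn; exact: (uj (Ordinal (jn : (j < n.+1)%N))).
Qed.

(** The cut-off [theta] is 0 on the boundary, where the map becomes the constant [r *: z], and 1
    wherever [mg] is at least [eta], as it is at every fixed point. A solution of the variational
    inequality on [M] is therefore a fixed point for the parameter 1. *)
Theorem homotopy_linking : exists2 u, M u &
  Z (u + f (1, u)) /\ `|u + f (1, u)| = r.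
Proof.
have [eta eta0 etaP] := margin.
have [w [wM wD]] := linking_M_dense_sequence ip_norm Y_sub zZ z1 rho0 Y_sep.
pose theta u := Num.min 1 (mg u / eta).
have th01 u : M u -> 0 <= theta u <= 1.
  by move=> uM; rewrite le_min ler01 ge_min lexx divr_ge0 ?mg_ge0 // ltW.
have thc (u : nat -> X) u0 : u m @[m --> \oo] --> u0 ->
    theta (u m) @[m --> \oo] --> theta u0.
  move=> uu; have mE v : theta v = (1 + mg v / eta - `|1 - mg v / eta|) / 2.
    rewrite /theta; case: lerP => h; rewrite ?(ler0_norm, gtr0_norm) ?subr_le0 ?subr_gt0 //; lra.
  have h1 : mg (u m) / eta @[m --> \oo] --> mg u0 / eta.
    by apply: cvgMr_tmp; exact: cvg_mg.
  rewrite mE; under eq_fun do rewrite mE.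
  apply: cvgMr_tmp; apply: cvgB; first by apply: cvgD => //; exact: cvg_cst.
  by apply: cvg_norm; apply: cvgB => //; exact: cvg_cst.
have /choice[u uP] : forall n : nat, exists u, M u /\ forall j, (j <= n)%N ->
    0 <= ip (u - linking_map (theta u, u)) (w j - u).
  by move=> n; have [u uM uj] := linking_approximation n th01 thc wM; exists u.
have uM n : M (u n) by case: (uP n).
have [|phi phioo [t [u0 [t01 u0M tt uu d0]]]] :=
    homotopy_subsequence ip_norm Y_sub eY e1 (rho := rho) zZ z1 (t := theta \o u) (u := u) _ uM.
  by move=> n; exact: th01.
pose G v := linking_map (theta v, v); pose g := linking_map (t, u0).
have Gc : G (u (phi n)) @[n --> \oo] --> g.
  apply: cvg_linking_map => //.
  by move=> n; split=> //=; exact: th01.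
have uB n : `|u (phi n)| <= rho by case/(linking_MP ip_norm rho zZ z1): (uM (phi n)).
have gdef : g = linking_map (t, u0) by [].
clearbody g.
(* The inequalities for [w j] bound [|u (phi n)|^2] asymptotically by [L (w j)], and
   [L u0 = |u0|^2]. *)
pose L v := ip u0 v - ip g v + ip g u0.
have LE v : L v = `|u0| ^+ 2 + ip (u0 - g) (v - u0).
  by rewrite /L -(ip_normsq ip_norm) !ipDl !ipDr !ipNl !ipNr; ring.
have le_L j (eps : R) : 0 < eps -> \forall n \near \oo, `|u (phi n)| ^+ 2 <= L (w j) + eps.
  move=> eps0.
  have : ip (u (phi n)) (w j) - ip (G (u (phi n))) (w j)
      + ip (G (u (phi n))) (u (phi n)) @[n --> \oo] --> L (w j).
    apply: cvgD; last exact: (cvg_ip_weak ip_norm Gc uu uB).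
    by apply: cvgB; [exact: uu|exact: (cvg_weak ip_norm Gc)].
  move=> /cvgrPdist_lt/(_ eps eps0).
  have : \forall n \near \oo, (j <= phi n)%N by apply: (phioo [set m | (j <= m)%N]); exists j.
  apply: filterS2 => n jn; rewrite ltr_norml => /andP[h _].
  have [_ /(_ j jn)] := uP (phi n).
  rewrite -/(G _) ipDl ipNl !ipDr !ipNr (ip_normsq ip_norm); lra.
have dense v (eps : R) : M v -> 0 < eps -> exists j, `|ip (u0 - g) (w j - v)| < eps.
  move=> vM eps0.
  have [|j jv] := wD v (eps / (1 + `|u0 - g|)) vM; first by rewrite divr_gt0 // ltr_wpDr.
  exists j; apply: le_lt_trans (cauchy_schwarz ip_norm _ _) _.
  move: jv; rewrite ltr_pdivlMr ?ltr_wpDr // mulrDr mulr1 mulrC.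
  by apply: le_lt_trans; rewrite lerDr.
(* For [w j] near [u0] the norms are asymptotically at most that of the weak limit, so convergence
   is in norm, the topology in which [theta] is known to be continuous. *)
have uc : u (phi n) @[n --> \oo] --> u0.
  suff h : u (phi n) - u0 @[n --> \oo] --> 0.
    rewrite -[u0]add0r (_ : (fun _ => _) = (fun n => u (phi n) - u0) + cst u0).
      by apply: cvgD => //; exact: cvg_cst.
    by apply/funext => n; rewrite -[RHS]/(u (phi n) - u0 + u0) subrK.
  apply: cvg_normsq0; apply/cvgr0Pnorm_lt => eps eps0.
  have e4 : 0 < eps / 8 by rewrite divr_gt0.
  have [j jd] := dense u0 _ u0M e4.
  have := le_L j _ e4; have /cvgrPdist_lt/(_ _ e4) := uu u0.
  apply: filterS2 => n h12 h3; rewrite LE in h3.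
  rewrite (ip_normsq ip_norm) ltr_norml in h12; case/andP: h12 => h1 h2.
  rewrite ger0_norm ?sqr_ge0 // (normsqB ip_norm).
  move: jd; rewrite ltr_norml => /andP[_ h4]; lra.
have tE : t = theta u0 by apply: cvg_unique tt (thc _ _ uc).
have VI v : M v -> 0 <= ip (u0 - g) (v - u0).
  move=> vM; rewrite leNgt; apply/negP => neg.
  have eps0 : 0 < - ip (u0 - g) (v - u0) / 4 by rewrite divr_gt0 // oppr_gt0.
  have [j] := dense v _ vM eps0.
  have nc : `|u (phi n)| ^+ 2 @[n --> \oo] --> `|u0| ^+ 2.
    by apply: cvgM; exact: cvg_norm.
  have : `|u0| ^+ 2 <= L (w j) + - ip (u0 - g) (v - u0) / 4.
    exact: (ler_cvg_to nc (cvg_cst _) (le_L j _ eps0)).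
  rewrite LE (_ : w j - u0 = (w j - v) + (v - u0)); last by rewrite addrA subrK.
  rewrite ipDr; move: eps0; move: (ip _ (w j - v)) (ip _ (v - u0)) => a c.
  by rewrite ltr_norml => eps0 h /andP[_ h']; lra.
have [u0r u0z u0E] := (linking_MP ip_norm rho zZ z1 u0).1 u0M.
(* On the boundary the map is constant, and the test point [r *: z] forces [u0 = r *: z], which is
   off the boundary because [0 < r < rho]. *)
have [m0|m0] := lerP (mg u0) 0.
  have mE : mg u0 = 0 by apply/eqP; rewrite eq_le m0 mg_ge0.
  have gE : g = r *: z.
    by rewrite gdef tE /theta mE mul0r (min_idPr ler01) linking_map0.
  have rzM : M (r *: z).
    apply/(linking_MP ip_norm rho zZ z1); split.
    - by rewrite normrZ z1 mulr1 gtr0_norm // ltW.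
    - by rewrite ipZl (ip_zz ip_norm z1) mulr1 ltW.
    - by apply: ray_spanZ => //; exact: (ray_span_z ip_norm Y_sub).
  have := VI _ rzM; rewrite gE -opprB ipNl (ip_normsq ip_norm) oppr_ge0 => h.
  have u0E' : r *: z = u0.
    apply/eqP; rewrite -subr_eq0 -normr_eq0 -sqrf_eq0 eq_le h sqr_ge0 //.
  move: mE; rewrite /mg -u0E' normrZ z1 mulr1 gtr0_norm // ipZl (ip_zz ip_norm z1) mulr1.
  by move/eqP; rewrite gt_eqF // lt_min r0 subr_gt0 r_rho.
have ug : u0 = g.
  apply/eqP; rewrite -subr_eq0; apply: contraT => q0.
  have q1 : 0 < `|u0 - g| by rewrite normr_gt0.
  (* A move of length [mg u0] from [u0] towards [g] stays in [M], which makes it a valid test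
     point. *)
  pose k := mg u0 / `|u0 - g|.
  have k0 : 0 < k by rewrite divr_gt0.
  have kq : k * `|u0 - g| = mg u0 by rewrite divfK // gt_eqF.
  have [mr mz] : mg u0 <= rho - `|u0| /\ mg u0 <= ip u0 z.
    by rewrite /mg !ge_min !lexx orbT.
  have vM : M (u0 - k *: (u0 - g)).
    apply/(linking_MP ip_norm rho zZ z1); split.
    - by apply: le_trans (ler_normB _ _) _; rewrite normrZ gtr0_norm // kq; lra.
    - rewrite ipDl ipNl ipZl subr_ge0; apply: le_trans mz; rewrite -kq ler_pM2l //.
      by apply: le_trans (ip_le ip_norm _ _) _; rewrite z1 mulr1.
    - apply: ray_spanB => //; apply: ray_spanZ => //; apply: ray_spanB => //.
      by rewrite gdef; exact: linking_map_span.
  have := VI _ vM; rewrite addrAC subrr add0r ipNr ipZr (ip_normsq ip_norm).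
  by rewrite oppr_ge0 leNgt mulr_gt0 // exprn_gt0.
rewrite gdef in ug.
have t1 : t = 1.
  have := etaP t u0 t01 u0M ug; rewrite tE /theta => h.
  by rewrite (min_idPl _) // ler_pdivlMr // mul1r.
exists u0 => //; apply: linking_map_fixed => //.
by rewrite -t1.
Qed.

End Linking.

(** * Deformation *)

Section Deformation.
Variables (R : realType) (X : completeNormedModType R).
Variable ip : {dot X for idfun}.
Hypothesis ip_norm : induces_norm ip.
Variables (Y : set X) (K : set nat) (e : nat -> X).
Hypothesis Y_sub : closed_subspace Y.
Hypothesis eY : forall k, K k -> Y (e k).
Hypothesis e1 : forall k, K k -> ip (e k) (e k) = 1.
Variables (z : X) (rho : R).
Hypothesis zZ : orthogonal_complement ip Y z.
Hypothesis z1 : `|z| = 1.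
Variable I : X -> R.
Hypothesis I_lip : locally_lipschitz I.
Hypothesis I_usc : upper_semicontinuous
  (fun u : norm_topology (tau_norm ip Y K e) => (I u)%:E).
Hypothesis I_H : condition_H (tau_norm ip Y K e) I.
Variables (al D eps : R).
Hypothesis al_D : al <= D.
Hypothesis eps0 : 0 < eps.
Hypothesis steep : forall v, al <= I v <= D -> exists2 w, `|w| <= 1 &
  forall xi, generalized_gradient I v xi -> xi w <= - eps.

Local Notation N := (tau_norm ip Y K e).
Local Notation M := (linking_M Y z rho).
Local Notation dom := (homotopy_domain Y z rho).
Local Notation dist := (homotopy_dist ip Y K e).
Local Notation tau_cont := (tau_continuous ip Y K e z rho).

(** If no neighbourhood worked, gradient elements with [- (eps / 2) < xi w] would exist at points
    tending to [v0]. Condition (H) bounds them and places a weak-star limit in the gradient at [v0],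
    where [xi w <= - eps]. *)
Lemma steep_near v0 : al <= I v0 <= D -> exists w (del : R),
  [/\ `|w| <= 1, 0 < del & forall v, N (v - v0) < del -> al <= I v ->
    forall xi, generalized_gradient I v xi -> xi w <= - (eps / 2)].
Proof.
move=> v0D; have [w w1 wP] := steep v0D.
(* Upper semicontinuity supplies the upper end [D + 1] of the strip in which (H) is used. *)
have [d1 d10 d1P] : exists2 d1 : R, 0 < d1 & forall v, N (v - v0) < d1 -> I v < D + 1.
  by apply: (norm_topology_usc I_usc); case/andP: v0D => _ h; rewrite (le_lt_trans h) // ltrDl.
apply: contrapT => nex.
have /choice[p pP] : forall n : nat, exists p : X * {scalar X},
    [/\ N (p.1 - v0) < n.+1%:R^-1, al <= I p.1 <= D + 1,
      generalized_gradient I p.1 p.2 & - (eps / 2) < p.2 w].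
  move=> n; apply: contrapT => np; apply: nex; exists w, (Num.min d1 n.+1%:R^-1).
  split; [exact: w1|by rewrite lt_min d10 invr_gt0 ltr0n|].
  move=> v; rewrite lt_min => /andP[vd vn] alv xi xiI.
  rewrite leNgt; apply/negP => h; apply: np; exists (v, xi); split=> //=.
  by rewrite alv ltW // d1P.
have pv : N ((p n).1 - v0) @[n --> \oo] --> 0.
  apply: (squeeze_cvgr _ (cvg_cst 0) (@cvg_natSinv R)); apply: nearW => n.
  by rewrite tau_norm_ge0 //=; apply: ltW; case: (pP n).
have alD1 : al < D + 1 by lra.
have [[B B0 BP] _] := I_H alD1 (fun n => let: And4 _ h _ _ := pP n in h)
  (norm_topology_cvg pv).
have [||phi phioo [xi0 [xi0d xi0c]]] :=
    @weak_star_subsequence _ _ _ ip_norm (fun n => (p n).2) B.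
- by move=> n; case: (pP n) => _ _ [].
- by move=> n; apply: ltW; apply: (BP n); case: (pP n).
have [_ H2] := I_H alD1 (fun n => let: And4 _ h _ _ := pP (phi n) in h)
  (norm_topology_cvg (cvg_sub phioo pv)).
have := wP _ (H2 (fun n => (p (phi n)).2) xi0
  (fun n => let: And4 _ _ h _ := pP (phi n) in h) xi0d xi0c).
have : - (eps / 2) <= xi0 w.
  by apply: (cvg_seq_ge (xi0c w)) => n; apply: ltW; case: (pP (phi n)).
move=> h1 h2; have := le_trans h1 h2; rewrite lerN2 ler_pdivlMr // => h3.
by have := eps0; lra.
Qed.

Definition admissible (f : R * X -> X) :=
  [/\ tau_cont f, forall u, M u -> f (0, u) = 0 &
    forall p, dom p -> I (p.2 + f p) <= Num.max (I p.2) al].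

Lemma homotopy_dist_time p q : `|p.1 - q.1| <= dist p q.
Proof. by rewrite /homotopy_dist le_max lexx. Qed.

Lemma homotopy_dist_space p q : N (p.2 - q.2) <= dist p q.
Proof. by rewrite /homotopy_dist le_max lexx orbT. Qed.

Lemma cvg_homotopy_dist (p : nat -> R * X) q q0 : dist (p n) q @[n --> \oo] --> 0 ->
  dist (p n) q0 @[n --> \oo] --> dist q q0.
Proof.
move=> /cvgr0Pnorm_lt pq; apply/cvgrPdist_lt => eta eta0; have := pq _ eta0.
apply: filterS => n; apply: le_lt_trans; apply: le_trans (ler_norm _).
have h1 := homotopy_dist_tri ip_norm Y_sub eY e1 q (p n) q0.
have h2 := homotopy_dist_tri ip_norm Y_sub eY e1 (p n) q q0.
have h3 := homotopy_dist_sym ip_norm K e Y_sub q (p n).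
by rewrite ler_norml; apply/andP; split; lra.
Qed.

Lemma tau_cont_cvg0 f (p : nat -> R * X) q : tau_cont f -> (forall n, dom (p n)) ->
  dom q -> dist (p n) q @[n --> \oo] --> 0 ->
  N ((p n).2 + f (p n) - (q.2 + f q)) @[n --> \oo] --> 0.
Proof.
move=> fc pd qd pq.
have h : dist (p n) q + 2 * `|f (p n) - f q| @[n --> \oo] --> 0.
  rewrite (_ : nbhs 0 = nbhs (0 + 2 * `|f q - f q| : R)); last first.
    by rewrite subrr normr0 mulr0 addr0.
  apply: cvgD => //; apply: cvgMl_tmp; apply: cvg_norm.
  by apply: cvgB; [exact: fc|exact: cvg_cst].
apply: (squeeze_cvgr _ (cvg_cst 0) h); apply: nearW => n; rewrite tau_norm_ge0 //=.
rewrite opprD addrACA; apply: le_trans (tau_normD ip_norm Y_sub eY e1 _ _) _.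
by rewrite lerD // ?homotopy_dist_space // tau_norm_le.
Qed.

Lemma superlevel_compact f : tau_cont f ->
  seq_compact dist [set p | dom p /\ al <= I (p.2 + f p)].
Proof.
move=> fc p pP.
have [phi phioo [q qd pq]] := homotopy_domain_compact ip_norm Y_sub eY e1 (rho := rho) zZ z1
  (fun n => (pP n).1).
exists phi => //; exists q => //; split=> //.
rewrite leNgt; apply/negP => /(norm_topology_usc I_usc)[del del0 delP].
have := tau_cont_cvg0 fc (fun n => (pP (phi n)).1) qd pq.
move=> /cvg0_lt/(_ del0)[n /(_ _ (leqnn n))/delP].
by rewrite ltNge (pP (phi n)).2.
Qed.

Lemma seq_lower_bound (T : eqType) (s : seq T) (del : T -> R) :
  {in s, forall x, 0 < del x} -> exists2 d : R, 0 < d & {in s, forall x, d <= del x}.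
Proof.
elim: s => [|x s IH] H; first by exists 1.
have [|d d0 dP] := IH; first by move=> y ys; apply: H; rewrite inE ys orbT.
exists (Num.min d (del x)); first by rewrite lt_min d0 H ?mem_head.
by move=> y; rewrite inE ge_min => /orP[/eqP->|/dP->//]; rewrite lexx orbT.
Qed.

(** Finitely many directions of [steep_near] are glued by a partition of unity. Division by the
    maximum of 1 and [S], rather than by [S], keeps the field continuous everywhere; away from the
    superlevel set both the field and its guaranteed rate fade with the total weight [th]. *)
Lemma descent_field f : tau_cont f -> (forall p, dom p -> I (p.2 + f p) <= D) ->
  exists V (th : R * X -> R) (del : R),
  [/\ 0 < del, tau_cont V,
    forall q, dom q -> `|V q| <= 1 /\ 0 <= th q,
    forall q, dom q -> al <= I (q.2 + f q) -> th q = 1 &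
    forall q (s : R), dom q -> 0 <= s <= del -> al <= I (q.2 + f q + s *: V q) ->
      forall xi, generalized_gradient I (q.2 + f q + s *: V q) xi ->
      xi (V q) <= - (eps / 2 * th q)].
Proof.
move=> fc fD; pose h q := q.2 + f q.
pose A := [set p | dom p /\ al <= I (h p)].
have /choice[W WP] : forall p, exists W : X * R * R, A p ->
    [/\ `|W.1.1| <= 1, 0 < W.1.2, forall v, N (v - h p) < W.1.2 -> al <= I v ->
      forall xi, generalized_gradient I v xi -> xi W.1.1 <= - (eps / 2),
      0 < W.2 & forall q, dom q -> dist q p < W.2 -> N (h q - h p) < W.1.2 / 2].
  move=> p; have [Ap|nAp] := pselect (A p); last by exists (0, 0, 0).
  have [|w [del [w1 del0 wP]]] := @steep_near (h p).
    by case: Ap => pd ->; exact: fD.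
  have [|k k0 kP] := @sequential_nbhs _ _ dist dom p (fun q => N (h q - h p) < del / 2).
    move=> u ud up.
    have u0 : dist (u n) p @[n --> \oo] --> 0.
      apply: (squeeze_cvgr _ (cvg_cst 0) (@cvg_natSinv R)); apply: nearW => n.
      by rewrite (ltW (up n)) andbT; apply: le_trans (homotopy_dist_time _ _).
    have := tau_cont_cvg0 fc ud Ap.1 u0.
    by move=> /cvg0_lt/(_ (divr_gt0 del0 (ltr0n R 2)))[n /(_ _ (leqnn n))]; exists n.
  by exists (w, del, k).
have [s [sA sP]] := finite_cover (homotopy_dist_sym ip_norm K e Y_sub)
  (homotopy_dist_tri ip_norm Y_sub eY e1) (superlevel_compact fc)
  (del := fun p => (W p).2 / 2) (fun p Ap => divr_gt0
    (let: And5 _ _ _ k0 _ := WP p Ap in k0) (ltr0n R 2)).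
(* A step of length [del] costs at most [2 * del] in the [tau]-norm, half of the radius where a
   direction is valid; the other half is left for the distance from [h q] to [h p]. *)
have [|del del0 delP] := @seq_lower_bound _ s (fun p => (W p).1.2 / 4).
  by move=> p /sA Ap; rewrite divr_gt0 //; case: (WP p Ap).
(* Equal to 1 on the half-radius balls of the cover, and to 0 outside the full balls. *)
pose chi p q := Num.max 0 (Num.min 1 (2 - 2 * (dist q p / (W p).2))).
pose S q := \sum_(p <- s) chi p q.
pose a p q := chi p q / Num.max 1 (S q).
pose V q := \sum_(p <- s) a p q *: (W p).1.1.
pose th q := \sum_(p <- s) a p q.
have chi0 p q : 0 <= chi p q by rewrite le_max lexx.
have m0 q : 0 < Num.max 1 (S q) by rewrite lt_max ltr01.
have a0 p q : 0 <= a p q by rewrite divr_ge0 // ltW.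
have thE q : th q = S q / Num.max 1 (S q) by rewrite /th -mulr_suml.
have th1 q : th q <= 1 by rewrite thE ler_pdivrMr // mul1r le_max lexx orbT.
exists V, th, del; split=> //.
- move=> p q pd qd pq.
  have chic x : chi x (p n) @[n --> \oo] --> chi x q.
    have := @cvg_homotopy_dist p q x pq.
    apply: (@continuous_cvg _ _ _ _ _ _ (fun y : R =>
      Num.max 0 (Num.min 1 (2 - 2 * (y / (W x).2))))).
    apply: (@continuous_max _ _ (cst 0)); first exact: cst_continuous.
    apply: (@continuous_min _ _ (cst 1)); first exact: cst_continuous.
    apply: cvgB; first exact: cvg_cst.
    by apply: cvgMl_tmp; apply: cvgMr_tmp; exact: cvg_id.
  apply: cvg_fsum => x; apply: cvgZr_tmp; apply: cvgM => //.
  apply: cvgV; first by rewrite gt_eqF.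
  have Sc : S (p n) @[n --> \oo] --> S q by exact: cvg_fsum.
  apply: (@continuous_cvg _ _ _ _ _ _ (fun y : R => Num.max 1 y)) Sc.
  by apply: (@continuous_max _ _ (cst 1)); [exact: cst_continuous|exact: cvg_id].
- move=> q qd; split; last exact: sumr_ge0.
  apply: le_trans (th1 q); apply: le_trans (ler_norm_sum _ _ _) _.
  rewrite /th big_seq [leRHS]big_seq; apply: ler_sum => p ps.
  rewrite normrZ ger0_norm // ler_piMr //.
  by case: (WP p (sA p ps)).
- move=> q qd alq; have [p ps qp] := sP q (conj qd alq).
  have [_ _ _ k0 _] := WP p (sA p ps).
  have cp : chi p q = 1.
    have : dist q p / (W p).2 < 2^-1 by rewrite ltr_pdivrMr // mulrC.
    move=> lt; rewrite /chi (min_idPl _) ?(max_idPr _) //; lra.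
  have S1 : 1 <= S q.
    by rewrite /S (big_rem p) //= cp lerDl sumr_ge0.
  by rewrite thE (max_idPr S1) divff // gt_eqF // (lt_le_trans ltr01).
move=> q t qd /andP[t0 t1] alt xi xiI.
have V1 : `|V q| <= 1.
  apply: le_trans (th1 q); apply: le_trans (ler_norm_sum _ _ _) _.
  rewrite /th big_seq [leRHS]big_seq; apply: ler_sum => p ps.
  rewrite normrZ ger0_norm // ler_piMr //.
  by case: (WP p (sA p ps)).
rewrite /V linear_sum /th mulr_sumr -sumrN big_seq [leRHS]big_seq.
apply: ler_sum => p ps; rewrite linearZ /=.
have [c0|c0] := eqVneq (chi p q) 0; first by rewrite /a c0 mul0r mul0r mulr0 oppr0.
have [_ _ wP k0 kP] := WP p (sA p ps).
rewrite mulrC -mulNr ler_wpM2r //; apply: wP xiI => //.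
have qp : dist q p < (W p).2.
  rewrite ltNge; apply: contraNN c0 => le.
  have : 1 <= dist q p / (W p).2 by rewrite ler_pdivlMr // mul1r.
  move=> le1; rewrite /chi (max_idPl _) //.
  by rewrite ge_min; apply/orP; right; lra.
rewrite -/(h q) addrAC.
apply: le_lt_trans (tau_normD ip_norm Y_sub eY e1 _ _) _.
have := kP q qd qp.
have : N (t *: V q) <= 2 * del.
  apply: le_trans (tau_norm_le ip_norm Y_sub eY e1 _) _.
  rewrite ler_pM2l // normrZ ger0_norm //.
  by apply: le_trans t1; rewrite ler_piMr.
have := delP p ps; lra.
Qed.

(** The step length [del * q.1] vanishes at time 0, which preserves the initial condition, and is
    [del] at time 1, where descent at the rate [eps / 2] gives the gain. *)
Lemma deformation f : admissible f -> (forall u, M u -> I u <= D) ->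
  exists2 del : R, 0 < del & exists g, [/\ admissible g,
    forall p, dom p -> `|f p - g p| <= del &
    forall u, M u -> I (u + g (1, u)) <= Num.max al (I (u + f (1, u)) - eps / 2 * del)].
Proof.
move=> [fc f0 fI] MD.
have fD p : dom p -> I (p.2 + f p) <= D.
  by move=> pd; apply: le_trans (fI p pd) _; rewrite ge_max al_D MD //; case: pd.
have [V [th [del [del0 Vc Vth thA VI]]]] := descent_field fc fD.
pose g q := f q + (del * q.1) *: V q.
have gI q : dom q -> I (q.2 + g q) <=
    Num.max al (I (q.2 + f q) - eps / 2 * th q * (del * q.1)).
  move=> qd; have [V1 th0] := Vth q qd; have [/andP[q0 q1] _] := qd.
  rewrite /g addrA; apply: (descent_path I_lip).
  - by rewrite mulr_ge0 // ltW.
  - by rewrite mulr_ge0 // divr_ge0 // ltW.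
  move=> s /andP[s0 s1] als; apply: (slope_bound_gradient ip_norm I_lip) => xi.
  apply: VI => //; rewrite s0 /=; apply: (le_trans (ltW s1)).
  by rewrite ler_piMr // ltW.
exists del => //; exists g; split.
- split.
  + move=> p q pd qd pq; apply: cvgD; first exact: fc.
    apply: cvgZ; last exact: Vc.
    apply: cvgMl_tmp; apply/cvgrPdist_lt => eta eta0.
    have /cvgr0Pnorm_lt/(_ _ eta0) := pq; apply: filterS => n.
    apply: le_lt_trans; rewrite distrC; apply: le_trans (homotopy_dist_time _ _) _.
    exact: ler_norm.
  + by move=> u uM; rewrite /g f0 // mulr0 scale0r addr0.
  + move=> p pd; apply: le_trans (gI p pd) _; rewrite ge_max le_max lexx orbT /=.
    apply: le_trans (fI p pd); rewrite gerBl.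
    have [_ th0] := Vth p pd; have [/andP[p0 _] _] := pd.
    by rewrite !mulr_ge0 // ltW // divr_gt0.
- move=> p pd; rewrite /g opprD addrA subrr sub0r normrN normrZ.
  have [V1 _] := Vth p pd; have [/andP[p0 p1] _] := pd.
  have c0 : 0 <= del * p.1 by apply: mulr_ge0 => //; exact: ltW.
  by rewrite (ger0_norm c0) -mulrA ler_piMr ?mulr_ile1 // ltW.
- move=> u uM; have pd : dom (1, u) by split; rewrite //= ler01 lexx.
  apply: le_trans (gI _ pd) _; rewrite /= mulr1.
  have [alI|Ial] := lerP al (I (u + f (1, u))); first by rewrite thA ?mulr1.
  have [_ th0] := Vth _ pd.
  rewrite ge_max le_max lexx /= le_max; apply/orP; left.
  apply: le_trans (ltW Ial); rewrite gerBl.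
  by rewrite !mulr_ge0 // ltW // divr_gt0.
Qed.

End Deformation.

(** * Minimax *)

Section Caristi.
Variable R : realType.

(* Brezis-Browder form of the Ekeland-Caristi principle. *)
Lemma no_strict_descent (T : Type) (S : set T) (phi : T -> R)
    (rel : T -> T -> Prop) (lo : R) :
  S !=set0 -> (forall x, S x -> lo <= phi x) ->
  (forall x y, rel x y -> phi y <= phi x) ->
  (forall x y t, rel x y -> rel y t -> rel x t) ->
  (forall x : nat -> T, (forall n, S (x n)) -> (forall n, rel (x n) (x n.+1)) ->
     exists2 y, S y & forall n, rel (x n) y) ->
  ~ (forall x, S x -> exists2 y, S y & rel x y /\ phi y < phi x).
Proof.
move=> [x0 Sx0] phi_lo rel_phi rel_tr chain step.
pose B x := [set phi y | y in [set y | S y /\ rel x y]].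
have BP x : S x -> has_inf (B x).
  move=> Sx; have [y Sy [xy _]] := step x Sx; split; first by exists (phi y), y.
  by exists lo => _ [t [St _] <-]; exact: phi_lo.
(* Each step covers at least half of the way down to the infimum over the successors. *)
have /choice[F FP] : forall x, exists y, S x ->
    [/\ S y, rel x y & phi y <= (inf (B x) + phi x) / 2].
  move=> x; have [Sx|nSx] := pselect (S x); last by exists x.
  have [y Sy [xy lt]] := step x Sx.
  have iy : inf (B x) <= phi y by apply: ge_inf; [case: (BP x Sx)|exists y].
  have d0 : 0 < (phi x - inf (B x)) / 2 by rewrite divr_gt0 // subr_gt0 (le_lt_trans iy).
  have [_ [t [St xt] <-] h] := inf_adherent d0 (BP x Sx).
  by exists t => _; split=> //; lra.
pose x n := iter n F x0.
have Sx n : S (x n) by elim: n => //= n IH; case: (FP _ IH).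
have xx n : rel (x n) (x n.+1) by case: (FP _ (Sx n)).
have [y Sy xy] := chain x Sx xx.
have [t St [yt lt]] := step y Sy.
(* Since [t] is a successor of every [x n], the excess over [phi t] is halved at each step; so
   [phi y <= phi t], although [t] was taken strictly lower than [y]. *)
have gap n : (phi (x n.+1) - phi t) <= (phi (x n) - phi t) / 2.
  have [_ _] := FP _ (Sx n).
  have : inf (B (x n)) <= phi t.
    apply: ge_inf; first by case: (BP _ (Sx n)).
    by exists t => //; split=> //; apply: rel_tr yt.
  rewrite -[F _]/(x n.+1); lra.
have geo n : phi (x n) - phi t <= (phi x0 - phi t) * 2^-1 ^+ n.
  elim: n => [|n IH]; first by rewrite expr0 mulr1.
  by apply: le_trans (gap n) _; rewrite exprSr mulrA ler_pM2r // invr_gt0.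
have lim0 : (phi x0 - phi t) * 2^-1 ^+ n @[n --> \oo] --> 0.
  rewrite -(mulr0 (phi x0 - phi t)); apply: cvgMl_tmp; apply: cvg_expr.
  by rewrite ger0_norm ?invr_ge0 // invf_lt1 ?ltr1n.
have : phi y - phi t <= 0.
  apply: (cvg_seq_ge lim0) => n; apply: le_trans (geo n).
  by rewrite lerD2r rel_phi.
by rewrite subr_le0 leNgt lt.
Qed.

End Caristi.

Section Minimax.
Variables (R : realType) (X : completeNormedModType R).
Variable ip : {dot X for idfun}.
Hypothesis ip_norm : induces_norm ip.
Variables (Y : set X) (K : set nat) (e : nat -> X).
Hypothesis Y_sub : closed_subspace Y.
Hypothesis Y_sep : separable_set Y.
Hypothesis eY : forall k, K k -> Y (e k).
Hypothesis e1 : forall k, K k -> ip (e k) (e k) = 1.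
Variables (z : X) (rho r : R).
Hypothesis zZ : orthogonal_complement ip Y z.
Hypothesis z1 : `|z| = 1.
Hypothesis r0 : 0 < r.
Hypothesis r_rho : r < rho.
Variable I : X -> R.
Hypothesis I_lip : locally_lipschitz I.
Hypothesis I_usc : upper_semicontinuous
  (fun u : norm_topology (tau_norm ip Y K e) => (I u)%:E).
Hypothesis I_H : condition_H (tau_norm ip Y K e) I.
Variables (b D : R).
Hypothesis I_S : forall u, orthogonal_complement ip Y u -> `|u| = r -> b <= I u.
Hypothesis I_M : forall u, linking_M Y z rho u -> I u <= D.
Hypothesis I_M0 : forall u, linking_M0 Y z rho u -> I u <= 0.
Hypothesis b0 : 0 < b.

Local Notation N := (tau_norm ip Y K e).
Local Notation M := (linking_M Y z rho).
Local Notation dom := (homotopy_domain Y z rho).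
Local Notation dist := (homotopy_dist ip Y K e).
Local Notation tau_cont := (tau_continuous ip Y K e z rho).

Let rzM : M (r *: z).
Proof.
apply/(linking_MP ip_norm rho zZ z1); split.
- by rewrite normrZ z1 mulr1 gtr0_norm // ltW.
- by rewrite ipZl (ip_zz ip_norm z1) mulr1 ltW.
- by apply: ray_spanZ => //; exact: (ray_span_z ip_norm Y_sub).
Qed.

Lemma linking_bound_le : b <= D.
Proof.
apply: (@le_trans _ _ (I (r *: z))); last exact: I_M.
apply: I_S; first by move=> y Yy; rewrite ipZl zZ // mulr0.
by rewrite normrZ z1 mulr1 gtr0_norm.
Qed.

Section Steep.
Variables (al eps : R).
Hypothesis al_b : 0 <= al < b.
Hypothesis eps0 : 0 < eps.
Hypothesis steep : forall v, al <= I v <= D -> exists2 w, `|w| <= 1 &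
  forall xi, generalized_gradient I v xi -> xi w <= - eps.

Local Notation adm := (admissible ip Y K e z rho I al).

Let phi (f : R * X -> X) : R := sup [set I (u + f (1, u)) | u in M].

Let al_D : al <= D.
Proof. by case/andP: al_b => _ /ltW h; exact: le_trans h linking_bound_le. Qed.

Let dom1 u : M u -> dom (1, u).
Proof. by move=> uM; split; rewrite //= ler01 lexx. Qed.

Let phi_has_sup f : adm f -> has_sup [set I (u + f (1, u)) | u in M].
Proof.
move=> [_ _ fI]; split; first by exists (I (r *: z + f (1, r *: z))), (r *: z).
exists D => _ [u uM <-]; apply: le_trans (fI _ (dom1 uM)) _.
by rewrite ge_max al_D I_M.
Qed.

Let phi_ge f u : adm f -> M u -> I (u + f (1, u)) <= phi f.
Proof.
by move=> fA uM; apply: ub_le_sup; [case: (phi_has_sup fA)|exists u].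
Qed.

Let phi_le f c : (forall u, M u -> I (u + f (1, u)) <= c) -> phi f <= c.
Proof.
move=> H; apply: ge_sup; first by exists (I (r *: z + f (1, r *: z))), (r *: z).
by move=> _ [u uM <-]; exact: H.
Qed.

(** On [M_0] the displaced value is at most the maximum of [I u <= 0] and [al], hence less than [b];
    so the homotopy misses the sphere there and the linking theorem applies. *)
Let b_phi f : adm f -> b <= phi f.
Proof.
move=> fA; have [fc f0 fI] := fA.
have [u uM [Zu ur]] : exists2 u, M u &
    orthogonal_complement ip Y (u + f (1, u)) /\ `|u + f (1, u)| = r.
  apply: (homotopy_linking ip_norm Y_sub Y_sep eY e1 zZ z1 r0 r_rho fc f0).
  move=> t u t01 uM0 [Zu ur].
  have uM : M u by apply: linking_M0_sub uM0 _; exact: lt_trans r0 r_rho.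
  have := fI (t, u) (conj t01 uM); rewrite leNgt => /negP; apply.
  apply: lt_le_trans (I_S Zu ur).
  case/andP: al_b => al0 alb; rewrite gt_max alb andbT /=.
  exact: le_lt_trans (I_M0 uM0) b0.
by apply: le_trans (phi_ge fA uM); exact: I_S.
Qed.

(** A deformation moves points by at most [del] and lowers [phi] by at least [eps / 2 * del]; this
    is the ratio. *)
Let c := 2 / eps.
Let c0 : 0 < c. Proof. by rewrite divr_gt0. Qed.

Let rel f g := forall p, dom p -> `|f p - g p| <= c * (phi f - phi g).

Let rel_phi f g : rel f g -> phi g <= phi f.
Proof.
move=> /(_ _ (dom1 rzM)) h; rewrite -subr_ge0 -(pmulr_rge0 _ c0).
exact: le_trans h.
Qed.

Let rel_trans f g h : rel f g -> rel g h -> rel f h.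
Proof.
move=> fg gh p pd; apply: le_trans (ler_distD (g p) _ _) _.
by have := fg p pd; have := gh p pd; rewrite !mulrBr; lra.
Qed.

(** The values [phi (x n)] decrease and stay above [b], so [rel] makes the sequence uniformly Cauchy
    on [dom]. Continuity of [I] at each limit point gives [phi y <= l]. *)
Let rel_chain (x : nat -> R * X -> X) : (forall n, adm (x n)) ->
  (forall n, rel (x n) (x n.+1)) -> exists2 y, adm y & forall n, rel (x n) y.
Proof.
move=> xA xx.
have rel_le n m : (n <= m)%N -> rel (x n) (x m).
  elim: m => [|m IH]; first by rewrite leqn0 => /eqP -> p _; rewrite !subrr normr0 mulr0.
  rewrite leq_eqVlt => /orP[/eqP->|/IH h]; last exact: rel_trans h (xx m).
  by move=> p _; rewrite !subrr normr0 mulr0.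
have phi_cvg : cvgn (phi \o x).
  apply: nonincreasing_is_cvgn; first by move=> n m nm; apply: rel_phi; exact: rel_le.
  by exists b => _ [n _ <-]; exact: b_phi.
pose l := limn (phi \o x).
have phil : phi (x n) @[n --> \oo] --> l by exact: phi_cvg.
have l_le n : l <= phi (x n).
  apply: ler_cvg_to phil (cvg_cst (phi (x n))) _; exists n => // m /= nm.
  by apply: rel_phi; exact: rel_le.
pose y p := limn (fun n => x n p).
have xy p : dom p -> x n p @[n --> \oo] --> y p.
  move=> pd; apply: cauchy_seq_cvg => eta eta0.
  have h : c * (phi (x n) - l) @[n --> \oo] --> 0.
    rewrite -(mulr0 c) -(subrr l); apply: cvgMl_tmp; apply: cvgB => //; exact: cvg_cst.
  have [n0 n0P] := cvg0_lt h (divr_gt0 eta0 (ltr0n R 2)).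
  have near n : (n0 <= n)%N -> `|x n0 p - x n p| < eta / 2.
    move=> nn; apply: le_lt_trans (n0P n0 (leqnn _)).
    apply: le_trans (rel_le _ _ nn p pd) _; rewrite ler_pM2l // lerD2l lerN2.
    exact: l_le.
  exists n0 => n m /near h1 /near h2.
  by rewrite (splitr eta); apply: le_lt_trans (ler_distD (x n0 p) _ _) _; rewrite ltrD // distrC.
have xyl n p : dom p -> `|x n p - y p| <= c * (phi (x n) - l).
  move=> pd; have h1 : `|x n p - x m p| @[m --> \oo] --> `|x n p - y p|.
    by apply: cvg_norm; apply: cvgB; [exact: cvg_cst|exact: xy].
  have h2 : c * (phi (x n) - phi (x m)) @[m --> \oo] --> c * (phi (x n) - l).
    by apply: cvgMl_tmp; apply: cvgB => //; exact: cvg_cst.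
  by apply: ler_cvg_to h1 h2 _; exists n => // m /= nm; exact: rel_le.
have Ixy p : dom p -> I (p.2 + x n p) @[n --> \oo] --> I (p.2 + y p).
  move=> pd; apply: continuous_cvg; first exact: locally_lipschitz_continuous.
  by apply: cvgD; [exact: cvg_cst|exact: xy].
have phiy : phi y <= l.
  apply: phi_le => u uM; apply: ler_cvg_to (Ixy _ (dom1 uM)) phil _.
  by apply: nearW => n; exact: phi_ge.
exists y; last first.
  move=> n p pd; apply: le_trans (xyl n p pd) _.
  by rewrite ler_pM2l // lerD2l lerN2.
split.
- move=> p q pd qd pq; apply/cvgrPdist_lt => eta eta0.
  have e3 : 0 < eta / 4 by rewrite divr_gt0.
  have h : c * (phi (x n) - l) @[n --> \oo] --> 0.
    rewrite -(mulr0 c) -(subrr l); apply: cvgMl_tmp; apply: cvgB => //; exact: cvg_cst.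
  have [n /(_ _ (leqnn n)) nP] := cvg0_lt h e3.
  have [xc _ _] := xA n; have /cvgrPdist_lt/(_ _ e3) := xc p q pd qd pq.
  apply: filterS => m h1.
  have h2 := xyl n q qd; have h3 := xyl n (p m) (pd m).
  have h4 := ler_distD (x n q) (y q) (y (p m)).
  have h5 := ler_distD (x n (p m)) (x n q) (y (p m)).
  rewrite distrC in h2; lra.
- move=> u uM; have d0 : dom (0, u) by split; rewrite //= lexx ler01.
  have E : (fun n => x n (0, u)) = cst 0 by apply/funext => n; have [_ ->] := xA n.
  have := xy _ d0; rewrite E => h; apply: cvg_unique h _ => //; exact: cvg_cst.
- move=> p pd; apply: (cvg_seq_le (Ixy p pd)) => n.
  by have [_ _ ->] := xA n.
Qed.

Lemma not_steep : False.
Proof.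
apply: (@no_strict_descent R _ adm phi rel b _ _ rel_phi rel_trans rel_chain).
- exists (fun _ => 0); split=> // [p q _ _ _|p pd]; first exact: cvg_cst.
  by rewrite addr0 le_max lexx.
- exact: b_phi.
move=> f fA.
have [del del0 [g [gA fg gI]]] := deformation ip_norm Y_sub eY e1 zZ z1
  I_lip I_usc I_H al_D eps0 steep fA I_M.
(* The alternative [phi g <= al] is excluded by [al < b <= phi g]. *)
have lt : phi g <= phi f - eps / 2 * del.
  have h : phi g <= Num.max al (phi f - eps / 2 * del).
    apply: phi_le => u uM; apply: le_trans (gI u uM) _.
    by rewrite ge_max !le_max lexx /= lerD2r phi_ge ?orbT.
  have := b_phi gA; case/andP: al_b => _ alb bg.
  by move: h; rewrite le_max => /orP[h|//]; lra.
have ed : 0 < eps / 2 * del by rewrite mulr_gt0 // divr_gt0.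
exists g => //; split; last by lra.
move=> p pd; apply: le_trans (fg p pd) _.
rewrite -(ler_pM2l (divr_gt0 eps0 (ltr0n R 2))) mulrA.
by rewrite /c mulrA divfK // divff ?gt_eqF // mul1r; lra.
Qed.

End Steep.

Lemma almost_critical_point (eps : R) : 0 < eps -> exists v l,
  [/\ b - eps <= I v <= D + eps, lambda I v = l%:E, 0 <= l & l <= eps].
Proof.
move=> eps0; apply: contrapT => nex.
pose al := Num.max 0 (b - eps).
apply: (@not_steep al eps) => //.
  by rewrite le_max lexx gt_max b0 gtrBl.
move=> v /andP[alv vD].
have [l [w [lE l0 w1 wP]]] := lambda_descent ip_norm I_lip v.
exists w => // xi xiI; apply: le_trans (wP xi xiI) _; rewrite lerN2.
rewrite leNgt; apply/negP => h; apply: nex; exists v, l; split=> //; last exact: ltW.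
apply/andP; split; last by rewrite (le_trans vD) // lerDl ltW.
by apply: le_trans alv; rewrite le_max lexx orbT.
Qed.

Lemma minimax : exists (c : R) (u_ : nat -> X),
    [/\ b <= c <= D, I (u_ n) @[n --> \oo] --> c
      & lambda I (u_ n) @[n --> \oo] --> 0%E].
Proof.
have /choice[p pP] : forall n : nat, exists p : X * R,
    [/\ b - n.+1%:R^-1 <= I p.1 <= D + n.+1%:R^-1, lambda I p.1 = p.2%:E,
      0 <= p.2 & p.2 <= n.+1%:R^-1].
  move=> n; have [|v [l vl]] := @almost_critical_point n.+1%:R^-1; first by rewrite invr_gt0.
  by exists (v, l).
have n1 (n : nat) : n.+1%:R^-1 <= 1 :> R by rewrite invf_le1 // ler1n.
(* The levels are only known to approach [[b, D]]; a subsequence makes them converge. *)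
have [|phi phioo /(_ tt)/cvg_ex[c /= Ic]] :=
  @finite_subsequence R unit (fun _ n => I (p n).1) (b + D + 1).
  move=> _ n; have [/andP[h1 h2] _ _ _] := pP n.
  have bD := linking_bound_le; have := b0.
  move: (n1 n) h1 h2; move: (_^-1) (I _) => i y i1 h1 h2 b1.
  by rewrite ler_norml; apply/andP; split; lra.
have inv0 := cvg_sub phioo (@cvg_natSinv R).
exists c, (fun n => (p (phi n)).1); split.
- apply/andP; split.
    rewrite -[b]subr0; apply: ler_cvg_to (cvgB (cvg_cst b) inv0) Ic _.
    by apply: nearW => n /=; have [/andP[]] := pP (phi n).
  rewrite -[D]addr0; apply: ler_cvg_to Ic (cvgD (cvg_cst D) inv0) _.
  by apply: nearW => n /=; have [/andP[]] := pP (phi n).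
- exact: Ic.
- have E n : lambda I (p (phi n)).1 = (p (phi n)).2%:E by case: (pP (phi n)).
  under eq_fun do rewrite E.
  apply: cvg_EFin; first exact: nearW.
  apply: (squeeze_cvgr _ (cvg_cst 0) inv0); apply: nearW => n.
  by have [_ _ -> ->] := pP (phi n).
Qed.

End Minimax.

Theorem theorem5p13 (R : realType) (X : completeNormedModType R)
    (ip : {dot X for idfun}) (ip_norm : induces_norm ip)
    (Y Z : set X) (Y_sub : closed_subspace Y) (Y_sep : separable_set Y)
    (ZE : Z = orthogonal_complement ip Y)
    (K : set nat) (e : nat -> X) (e_tot : total_orthonormal_sequence ip Y K e)
    (rho r : R) (r_gt0 : 0 < r) (r_lt_rho : r < rho)
    (z : X) (zZ : Z z) (z_norm : `|z| = 1)
    (I : X -> R) (I_lip : locally_lipschitz I)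
    (I_usc : upper_semicontinuous
       (fun u : norm_topology (tau_norm ip Y K e) => (I u)%:E))
    (I_H : condition_H (tau_norm ip Y K e) I)
    (b d : \bar R)
    (bE : b = ereal_inf [set (I u)%:E | u in sphere_in Z r])
    (dE : d = ereal_sup [set (I u)%:E | u in linking_M Y z rho])
    (b_gt0 : (0 < b)%E)
    (supM0 : ereal_sup [set (I u)%:E | u in linking_M0 Y z rho] = 0%E)
    (d_fin : (d < +oo)%E) :
  exists (c : R) (u_ : nat -> X),
    [/\ (b <= c%:E <= d)%E,
        I (u_ n) @[n --> \oo] --> c
      & lambda I (u_ n) @[n --> \oo] --> 0%E].
Proof.
have [_ eY e_on _] := e_tot.
have e1 k : K k -> ip (e k) (e k) = 1 by move=> Kk; rewrite e_on // eqxx.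
have zZ' : orthogonal_complement ip Y z by rewrite -ZE.
have I_S u : Z u -> `|u| = r -> (b <= (I u)%:E)%E.
  by move=> Zu ur; rewrite bE; apply: ereal_inf_lbound; exists u.
have I_M u : linking_M Y z rho u -> ((I u)%:E <= d)%E.
  by move=> uM; rewrite dE; apply: ereal_sup_ubound; exists u.
have I_M0 u : linking_M0 Y z rho u -> I u <= 0.
  move=> uM; have : ((I u)%:E <= 0)%E.
    by rewrite -supM0; apply: ereal_sup_ubound; exists u.
  by rewrite lee_fin.
have rzZ : Z (r *: z) by rewrite ZE => y Yy; rewrite ipZl zZ' // mulr0.
have rzr : `|r *: z| = r by rewrite normrZ z_norm mulr1 gtr0_norm.
have rzM : linking_M Y z rho (r *: z).
  exists 0, r; rewrite add0r rzr; split; rewrite // ?(ltW r_lt_rho) ?(ltW r_gt0) //.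
  by case: (closed_subspaceP Y_sub).
(* The value at [r *: z], a point of the sphere and of [M], together with [b_gt0] and [d_fin], makes
   [b] and [d] finite. *)
have bI := I_S _ rzZ rzr; have Id := I_M _ rzM.
case: b b_gt0 bI I_S {bE} => [b| |] //= b_gt0 bI I_S.
case: d d_fin Id I_M {dE} => [d| |] //= _ Id I_M.
have [c [u_ [cbd cI cl]]] := minimax ip_norm Y_sub Y_sep eY e1 zZ' z_norm
  r_gt0 r_lt_rho I_lip I_usc I_H (b := b) (D := d)
  (fun u Zu ur => ltac:(by rewrite -lee_fin; apply: I_S => //; rewrite ZE))
  I_M I_M0 b_gt0.
by exists c, u_; split=> //; rewrite !lee_fin.
Qed.
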